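(* Let $D\subset\mathbb{R}^2$ be a connected and simply connected domain with non-empty interior, bounded by a smooth closed curve $\gamma$, and let $n\ge 1$ be an integer. Let $H$ be a smooth real-valued function on a neighborhood of $D$ which is constant on $\gamma$ and whose $j$-th normal derivatives vanish along $\gamma$ for $j=1,\dots,n-1$. Let $V_n$ be the vector field on $D$ whose two components are the real and imaginary parts of $(\partial_x+i\partial_y)^nH(x,y)$. Assume that $V_n$ has only isolated zeros in $D$ and no zeros on $\gamma$. Then $V_n$ has $n$ zeros in the interior of $D$, counted with multiplicities.
   Context: Multiplicity of an isolated zero of $V_n$ means its index; the claim is that the sum of the indices of the zeros of $V_n$ in the interior of $D$ equals $n$. The $j$-th normal derivative along $\gamma$ means $\partial_s^jH(\gamma(t)+s\,n(t))|_{s=0}$, where $\gamma(t)$ is an arc length parametrization and $n(t)$ the inward unit normal. *)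

(* Defs.v *)
From Stdlib Require Import Reals Lra List.
From Coquelicot Require Import Coquelicot.
Open Scope R_scope.

Definition pt := (R * R)%type.

Definition dist2 (p q : pt) : R :=
  sqrt ((fst p - fst q) ^ 2 + (snd p - snd q) ^ 2).

Definition interior2 (D : pt -> Prop) (p : pt) : Prop :=
  exists eps, 0 < eps /\ forall q, dist2 q p < eps -> D q.

Definition open2 (U : pt -> Prop) : Prop := forall p, U p -> interior2 U p.

Definition closed2 (D : pt -> Prop) : Prop := open2 (fun p => ~ D p).

Definition bounded2 (D : pt -> Prop) : Prop :=
  exists M, forall p, D p -> dist2 p (0, 0) <= M.

Definition frontier2 (D : pt -> Prop) (p : pt) : Prop :=
  forall eps, 0 < eps ->
    (exists q, D q /\ dist2 q p < eps) /\ (exists q, ~ D q /\ dist2 q p < eps).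

Definition pd (b : bool) (f : pt -> R) (p : pt) : R :=
  if b then Derive (fun t => f (t, snd p)) (fst p)
  else Derive (fun t => f (fst p, t)) (snd p).

Definition iter_pd (w : list bool) (f : pt -> R) : pt -> R :=
  fold_right pd f w.

Definition smooth_on (U : pt -> Prop) (f : pt -> R) : Prop :=
  forall (w : list bool) (p : pt), U p ->
    ex_derive (fun t => iter_pd w f (t, snd p)) (fst p) /\
    ex_derive (fun t => iter_pd w f (fst p, t)) (snd p) /\
    continuous (iter_pd w f) p.

Definition smooth1 (f : R -> R) : Prop :=
  forall (k : nat) (x : R), ex_derive (Derive_n f k) x.

Definition pdC (b : bool) (f : pt -> C) (p : pt) : C :=
  (pd b (fun q => Re (f q)) p, pd b (fun q => Im (f q)) p).

Definition Lop (f : pt -> C) : pt -> C :=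
  fun p => Cplus (pdC true f p) (Cmult Ci (pdC false f p)).

Definition Vfield (n : nat) (H : pt -> R) : pt -> pt :=
  fun p => let z := Nat.iter n Lop (fun q => RtoC (H q)) p in (Re z, Im z).

Definition is_zero (V : pt -> pt) (p : pt) : Prop := V p = (0, 0).

Definition index_is (V : pt -> pt) (z : pt) (k : Z) : Prop :=
  exists r0, 0 < r0 /\
  forall r, 0 < r < r0 ->
    exists theta : R -> R,
      (forall t, 0 <= t <= 1 -> continuous theta t) /\
      (forall t, 0 <= t <= 1 ->
         let q := (fst z + r * cos (2 * PI * t), snd z + r * sin (2 * PI * t)) in
         let v := V q in
         v <> (0, 0) /\
         v = (dist2 v (0, 0) * cos (theta t), dist2 v (0, 0) * sin (theta t))) /\
      theta 1 - theta 0 = 2 * PI * IZR k.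

Definition sumZ (l : list Z) : Z := fold_right Z.add 0%Z l.

(* Main.v *)
Require Import Defs.
From Stdlib Require Import Reals Lra Lia List ZArith Classical ClassicalEpsilon.
From Coquelicot Require Import Coquelicot.
Open Scope R_scope.

(* On gamma all derivatives of H of order 1, ..., n-1 vanish, so the tensor of order n of the
   derivatives is a multiple of the n-th power of the unit normal nu, and V_n is a real multiple of
   nu^n: V_n turns n times as much as nu along gamma.

   Sums of indices are compared with turning numbers through a fine square grid. Weight a cell by 1
   if its lower left corner lies in D and by 0 otherwise. The weighted sum over the cells of the
   variation of the argument of a field around the cell only depends on the edges where the weight
   jumps. These are close to gamma, and there the variation is, up to a gradient, the turning of
   the field along gamma times the displacement of the parameter. Hence this sum is om * m, with om
   the turning of the field along gamma and m independent of the field. For V_n it is also 2 PI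
   times the sum of the indices of the zeros, and for p - q it is 2 PI or 0 according as q is in D
   or not.

   It remains to see that nu itself gives 2 PI. Take q = gamma + a nu and q' = gamma - a nu, for a
   small. The vector gamma(s) - gamma(t) - a nu(t) never vanishes on the (s,t)-torus and is - a nu
   on the diagonal, so the turning of nu is the sum of those of gamma - q and gamma - q'. Exactly
   one of q, q' lies in D, so the sum for nu is 2 PI + 0. *)

(** The factor m is never computed, and the orientation of gamma is never determined. Writing omi
    and omo for the turnings of gamma - q and gamma - q', with q the point in D, the identities omi
    * m = 2 PI, omo * m = 0 and om = omi + omo settle the count by linearity. What makes m
    independent of the field: a lift of the argument along gamma grows by om over a period L, so
    subtracting om / L times the parameter leaves an L-periodic function, that is, a function of the
    point of gamma. On nearby edges it contributes a gradient. Parameters are only defined modulo L,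
    so their small displacements along edges need not add up to zero around the domain; this defect,
    divided by L, is m. Neither the nearby points of gamma nor the displacements have to be chosen
    continuously. The grid is taken fine compared with the room around D inside the neighborhood of
    definition and with the gaps between zeros, and is translated so that no zero and neither test
    point lies on a grid line. *)

(** * Square neighborhoods and continuity *)

(** Convertible with the ball of the product uniform structure, so that passing from one to the
    other costs no estimate. *)
Definition near (e : R) (p q : pt) : Prop :=
  Rabs (fst q - fst p) < e /\ Rabs (snd q - snd p) < e.

Lemma near_refl (e : R) (p : pt) : 0 < e -> near e p p.
Proof. intros He; split; rewrite Rminus_diag, Rabs_R0; exact He. Qed.

Lemma near_sym (e : R) (p q : pt) : near e p q -> near e q p.
Proof. intros [H1 H2]; split; rewrite Rabs_minus_sym; assumption. Qed.

Lemma near_le (e e' : R) (p q : pt) : e <= e' -> near e p q -> near e' p q.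
Proof. intros He [H1 H2]; split; lra. Qed.

Lemma near_trans (e e' : R) (p q r : pt) : near e p q -> near e' q r -> near (e + e') p r.
Proof.
  intros [H1 H2] [H3 H4]; split.
  - replace (fst r - fst p) with ((fst r - fst q) + (fst q - fst p)) by ring.
    eapply Rle_lt_trans; [apply Rabs_triang | lra].
  - replace (snd r - snd p) with ((snd r - snd q) + (snd q - snd p)) by ring.
    eapply Rle_lt_trans; [apply Rabs_triang | lra].
Qed.

Lemma continuous_near_iff (f : pt -> R) (p : pt) :
  continuous f p <->
  forall e, 0 < e -> exists d, 0 < d /\ forall q, near d p q -> Rabs (f q - f p) < e.
Proof.
  unfold continuous. rewrite filterlim_locally. split.
  - intros H e He. destruct (H (mkposreal e He)) as [d Hd].
    exists d; split; [apply cond_pos|]. intros q Hq. exact (Hd q Hq).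
  - intros H e. destruct (H e (cond_pos e)) as (d & Hd & Hq).
    exists (mkposreal d Hd). intros q Hq'. exact (Hq q Hq').
Qed.

Lemma continuous_R_iff (f : R -> R) (x : R) :
  continuous f x <->
  forall e, 0 < e -> exists d, 0 < d /\ forall y, Rabs (y - x) < d -> Rabs (f y - f x) < e.
Proof.
  unfold continuous. rewrite filterlim_locally. split.
  - intros H e He. destruct (H (mkposreal e He)) as [d Hd].
    exists d; split; [apply cond_pos|]. intros q Hq. exact (Hd q Hq).
  - intros H e. destruct (H e (cond_pos e)) as (d & Hd & Hq).
    exists (mkposreal d Hd). intros q Hq'. exact (Hq q Hq').
Qed.

Section Pairs.
Context {T : UniformSpace}.

Lemma continuous_pair (f g : T -> R) (x : T) :
  continuous f x -> continuous g x -> continuous (fun y => (f y, g y) : pt) x.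
Proof.
  unfold continuous. rewrite !filterlim_locally. intros Hf Hg e.
  generalize (filter_and _ _ (Hf e) (Hg e)). apply filter_imp.
  intros y [H1 H2]. split; assumption.
Qed.

Lemma continuous_pt_fst (F : T -> pt) (x : T) :
  continuous F x -> continuous (fun y => fst (F y)) x.
Proof.
  intros HF. apply (continuous_comp F fst); [exact HF|].
  destruct (F x); apply continuous_fst.
Qed.

Lemma continuous_pt_snd (F : T -> pt) (x : T) :
  continuous F x -> continuous (fun y => snd (F y)) x.
Proof.
  intros HF. apply (continuous_comp F snd); [exact HF|].
  destruct (F x); apply continuous_snd.
Qed.

Lemma continuous_Rplus (f g : T -> R) (x : T) :
  continuous f x -> continuous g x -> continuous (fun y => f y + g y) x.
Proof. intros Hf Hg. exact (continuous_plus f g x Hf Hg). Qed.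

Lemma continuous_Rminus (f g : T -> R) (x : T) :
  continuous f x -> continuous g x -> continuous (fun y => f y - g y) x.
Proof. intros Hf Hg. exact (continuous_minus f g x Hf Hg). Qed.

Lemma continuous_Ropp (f : T -> R) (x : T) :
  continuous f x -> continuous (fun y => - f y) x.
Proof. intros Hf. exact (continuous_opp f x Hf). Qed.

Lemma continuous_Rmult (f g : T -> R) (x : T) :
  continuous f x -> continuous g x -> continuous (fun y => f y * g y) x.
Proof. intros Hf Hg. exact (continuous_mult f g x Hf Hg). Qed.

Lemma continuous_Rdiv (f g : T -> R) (x : T) :
  g x <> 0 -> continuous f x -> continuous g x -> continuous (fun y => f y / g y) x.
Proof.
  intros Hn Hf Hg. apply continuous_Rmult; [exact Hf|].
  apply (continuous_comp g Rinv); [exact Hg | exact (continuous_Rinv _ Hn)].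
Qed.

Lemma continuous_derivable_comp (h h' : R -> R) (f : T -> R) (x : T) :
  (forall y, is_derive h y (h' y)) -> continuous f x -> continuous (fun y => h (f y)) x.
Proof.
  intros Hh Hf. apply (continuous_comp f h); [exact Hf|].
  apply (ex_derive_continuous h (f x)). eexists; apply Hh.
Qed.

Lemma continuous_comp_atan (f : T -> R) (x : T) :
  continuous f x -> continuous (fun y => atan (f y)) x.
Proof.
  apply continuous_derivable_comp with (h' := fun y => / (1 + y ^ 2)).
  intros y. apply is_derive_Reals, derivable_pt_lim_atan.
Qed.

Lemma continuous_comp_Rabs (f : T -> R) (x : T) :
  continuous f x -> continuous (fun y => Rabs (f y)) x.
Proof.
  intros Hf. apply (continuous_comp f Rabs); [exact Hf|].
  apply continuous_R_iff. intros e He. exists e; split; [exact He|].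
  intros y Hy. eapply Rle_lt_trans; [apply Rabs_triang_inv2 | exact Hy].
Qed.

End Pairs.

(** With points read as complex numbers, [dot z w] and [crs z w] are the real and imaginary parts of
    the conjugate of z times w. *)
Definition dot (z w : pt) : R := fst z * fst w + snd z * snd w.
Definition crs (z w : pt) : R := fst z * snd w - snd z * fst w.

Section PairsDot.
Context {T : UniformSpace}.

Lemma continuous_dot (F G : T -> pt) (x : T) :
  continuous F x -> continuous G x -> continuous (fun y => dot (F y) (G y)) x.
Proof.
  intros HF HG. unfold dot. apply continuous_Rplus; apply continuous_Rmult;
    auto using continuous_pt_fst, continuous_pt_snd.
Qed.

Lemma continuous_crs (F G : T -> pt) (x : T) :
  continuous F x -> continuous G x -> continuous (fun y => crs (F y) (G y)) x.
Proof.
  intros HF HG. unfold crs. apply continuous_Rminus; apply continuous_Rmult;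
    auto using continuous_pt_fst, continuous_pt_snd.
Qed.
End PairsDot.

(** * Arguments of planar vectors *)

Definition isarg (z : pt) (a : R) : Prop :=
  exists r, 0 < r /\ z = (r * cos a, r * sin a).

(** The signed angle from z to w as long as [dot z w] is positive; in the other cases it has no such
    meaning. *)
Definition rel (z w : pt) : R := atan (crs z w / dot z w).

Lemma isarg_neq0 (z : pt) (a : R) : isarg z a -> z <> (0, 0).
Proof.
  intros (r & Hr & ->) E. injection E as E1 E2.
  assert (cos a = 0) by nra. assert (sin a = 0) by nra.
  pose proof (sin2_cos2 a) as S. unfold Rsqr in S. nra.
Qed.

Lemma isarg_rel (z w : pt) (a : R) : isarg z a -> 0 < dot z w -> isarg w (a + rel z w).
Proof.
  intros (r & Hr & ->) Hd. unfold rel. set (d := dot _ w) in *. set (c := crs _ w).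
  assert (Hq : 0 < sqrt (1 + (c / d) ^ 2)).
  { apply sqrt_lt_R0. nra. }
  exists (d * sqrt (1 + (c / d) ^ 2) / r). split.
  - apply Rdiv_lt_0_compat; nra.
  - rewrite cos_plus, sin_plus, cos_atan, sin_atan.
    replace ((c / d)²) with ((c / d) ^ 2) by (unfold Rsqr; ring).
    set (q := sqrt _) in *.
    pose proof (sin2_cos2 a) as S. unfold Rsqr in S.
    assert (E1 : d * cos a - c * sin a = r * fst w).
    { unfold d, c, dot, crs; simpl.
      transitivity (r * fst w * (sin a * sin a + cos a * cos a)); [ring | rewrite S; ring]. }
    assert (E2 : d * sin a + c * cos a = r * snd w).
    { unfold d, c, dot, crs; simpl.
      transitivity (r * snd w * (sin a * sin a + cos a * cos a)); [ring | rewrite S; ring]. }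
    destruct w as [w1 w2]; simpl in E1, E2. f_equal.
    + transitivity ((d * cos a - c * sin a) / r); [rewrite E1; field; lra | field; split; [lra | split; lra]].
    + transitivity ((d * sin a + c * cos a) / r); [rewrite E2; field; lra | field; split; [lra | split; lra]].
Qed.

Lemma isarg_ex (z : pt) : z <> (0, 0) -> exists a, isarg z a.
Proof.
  intros Hz. destruct z as [x y].
  assert (B : forall a, 0 < dot (cos a, sin a) (x, y) -> exists b, isarg (x, y) b).
  { intros a Ha. exists (a + rel (cos a, sin a) (x, y)). apply isarg_rel; [|exact Ha].
    exists 1; split; [lra | f_equal; ring]. }
  destruct (Rtotal_order x 0) as [Hx | [Hx | Hx]].
  - apply (B PI). unfold dot; simpl. rewrite cos_PI, sin_PI. lra.
  - destruct (Rtotal_order y 0) as [Hy | [Hy | Hy]].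
    + apply (B (- (PI / 2))). unfold dot; simpl. rewrite cos_neg, sin_neg, cos_PI2, sin_PI2. lra.
    + subst; contradiction.
    + apply (B (PI / 2)). unfold dot; simpl. rewrite cos_PI2, sin_PI2. lra.
  - apply (B 0). unfold dot; simpl. rewrite cos_0, sin_0. lra.
Qed.

Lemma isarg_crs (z w : pt) (a b : R) :
  isarg z a -> isarg w b -> crs z w = 0 -> sin (b - a) = 0.
Proof.
  intros (r & Hr & ->) (s & Hs & ->). unfold crs; simpl. intros E.
  rewrite sin_minus.
  assert (r * s * (sin b * cos a - cos b * sin a) = 0) by (rewrite <- E; ring).
  assert (0 < r * s) by nra. nra.
Qed.

Lemma isarg_unique (z : pt) (a b : R) :
  isarg z a -> isarg z b -> exists k : Z, b - a = 2 * PI * IZR k.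
Proof.
  intros Ha Hb.
  assert (S : sin (b - a) = 0).
  { apply (isarg_crs z z); auto. unfold crs; ring. }
  assert (C : 0 < cos (b - a)).
  { destruct Ha as (r & Hr & E). destruct Hb as (s & Hs & E').
    rewrite E in E'. injection E' as E1 E2. rewrite cos_minus.
    pose proof (sin2_cos2 a) as Q. unfold Rsqr in Q.
    assert (s * (cos b * cos a + sin b * sin a) = r).
    { transitivity (r * (sin a * sin a + cos a * cos a)); [|rewrite Q; ring].
      rewrite Rmult_plus_distr_l, <- !Rmult_assoc, <- E1, <- E2. ring. }
    nra. }
  destruct (sin_eq_0_0 _ S) as [k Hk].
  destruct (Z.Even_or_Odd k) as [[j Hj] | [j Hj]].
  - exists j. rewrite Hk, Hj, mult_IZR. ring.
  - exfalso. rewrite Hk, Hj, plus_IZR, mult_IZR in C.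
    replace ((2 * IZR j + 1) * PI) with (2 * IZR j * PI + PI) in C by ring.
    rewrite neg_cos in C.
    assert (0 < cos (2 * IZR j * PI)); [|lra].
    assert (sin (IZR j * PI) = 0) as S' by (apply sin_eq_0_1; exists j; reflexivity).
    replace (2 * IZR j * PI) with (2 * (IZR j * PI)) by ring.
    rewrite cos_2a_sin, S'. lra.
Qed.

(** The zeros of [sin] are PI apart, and intermediate values would produce another one at distance
    at most 1 above the lower value. Serves to compare lifts and, in [path_in_domain], as a
    connectedness argument. *)
Lemma sin_zero_const (g : R -> R) :
  (forall t, continuous g t) -> (forall t, sin (g t) = 0) -> forall s t, g s = g t.
Proof.
  intros Hc Hs.
  assert (K : forall s t, g s < g t -> False).
  { intros s t Hlt. set (d := Rmin 1 (g t - g s)).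
    assert (Hd : 0 < d <= 1 /\ d <= g t - g s).
    { unfold d. pose proof (Rmin_l 1 (g t - g s)). pose proof (Rmin_r 1 (g t - g s)).
      split; [split; [apply Rmin_pos; lra | lra] | lra]. }
    destruct (IVT_gen_consistent g s t (g s + d) Hc) as (x & _ & Hx).
    { rewrite Rmin_left, Rmax_right by lra. lra. }
    pose proof (Hs x) as Sx. rewrite Hx, sin_plus, Hs in Sx.
    pose proof (sin2_cos2 (g s)) as Q. unfold Rsqr in Q. rewrite Hs in Q.
    assert (0 < sin d) by (apply sin_gt_0; [lra | pose proof PI2_3_2; lra]).
    assert (cos (g s) <> 0) by (intros E; rewrite E in Q; lra).
    assert (cos (g s) * sin d = 0) by lra.
    destruct (Rmult_integral _ _ H1); [contradiction | lra]. }
  intros s t. destruct (Rtotal_order (g s) (g t)) as [Hlt | [He | Hlt]]; auto.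
  - exfalso; eauto.
  - exfalso; apply (K t s); lra.
Qed.

Definition lift {T : UniformSpace} (F : T -> pt) (th : T -> R) : Prop :=
  forall x, continuous th x /\ isarg (F x) (th x).

Lemma lift_comp {S T : UniformSpace} (F : T -> pt) (th : T -> R) (c : S -> T) :
  lift F th -> (forall x, continuous c x) -> lift (fun x => F (c x)) (fun x => th (c x)).
Proof.
  intros HF Hc x. split; [|apply HF].
  apply (continuous_comp c th); [apply Hc | apply HF].
Qed.

Lemma lift_ext {T : UniformSpace} (F G : T -> pt) (th : T -> R) :
  (forall x, F x = G x) -> lift F th -> lift G th.
Proof. intros E HF x. rewrite <- E. apply HF. Qed.

(** Parallel fields may point in opposite directions: the arguments then differ by an odd multiple
    of PI, which is still constant. This is what allows V_n to be a real multiple of either sign of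
    the n-th power of the normal. *)
Lemma lift_parallel (f g : R -> pt) (th ps : R -> R) :
  lift f th -> lift g ps -> (forall t, crs (f t) (g t) = 0) ->
  forall s t, ps s - th s = ps t - th t.
Proof.
  intros Hf Hg Hp. apply (sin_zero_const (fun t => ps t - th t)).
  - intros t. apply continuous_Rminus; [apply Hg | apply Hf].
  - intros t. apply (isarg_crs (f t) (g t)); [apply Hf | apply Hg | apply Hp].
Qed.

Lemma crs_diag (z : pt) : crs z z = 0.
Proof. unfold crs; ring. Qed.

Lemma lift_unique (f : R -> pt) (th ps : R -> R) :
  lift f th -> lift f ps -> forall s t, ps s - th s = ps t - th t.
Proof. intros H1 H2. apply (lift_parallel f f); auto. intros; apply crs_diag. Qed.

Lemma rel_bound (z w : pt) : - (PI / 2) < rel z w < PI / 2.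
Proof. unfold rel. pose proof (atan_bound (crs z w / dot z w)); lra. Qed.

Lemma rel_diag (z : pt) : rel z z = 0.
Proof. unfold rel. rewrite crs_diag. unfold Rdiv; rewrite Rmult_0_l. apply atan_0. Qed.

(** Both sides lead from an argument of x to one of z, so they differ by a multiple of 2 PI. Three
    angles below PI / 2 in absolute value leave only the multiple 0. *)
Lemma rel_trans (x y z : pt) :
  0 < dot x y -> 0 < dot y z -> 0 < dot x z -> rel x z = rel x y + rel y z.
Proof.
  intros H1 H2 H3.
  assert (Hx : x <> (0, 0)) by (intros ->; unfold dot in H1; simpl in H1; lra).
  destruct (isarg_ex x Hx) as [a Ha].
  pose proof (isarg_rel _ _ _ (isarg_rel _ _ _ Ha H1) H2) as K1.
  pose proof (isarg_rel _ _ _ Ha H3) as K2.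
  destruct (isarg_unique _ _ _ K1 K2) as [k Hk].
  pose proof (rel_bound x y). pose proof (rel_bound y z). pose proof (rel_bound x z).
  pose proof PI_RGT_0 as HPI.
  assert (- 1 < IZR k < 1).
  { split; nra. }
  assert (k = 0)%Z.
  { assert (-1 < k < 1)%Z; [|lia]. split; apply lt_IZR; lra. }
  subst k. lra.
Qed.

Lemma lift_half_plane {T : UniformSpace} (f : T -> pt) (z : pt) (a : R) :
  isarg z a -> (forall t, continuous f t) -> (forall t, 0 < dot z (f t)) ->
  lift f (fun t => a + rel z (f t)).
Proof.
  intros Ha Hf Hd t. split; [|apply isarg_rel; auto].
  apply continuous_Rplus; [apply continuous_const|].
  apply continuous_comp_atan. apply continuous_Rdiv.
  - specialize (Hd t); lra.
  - apply continuous_crs; [apply continuous_const | apply Hf].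
  - apply continuous_dot; [apply continuous_const | apply Hf].
Qed.

(** * Compactness of boxes *)

Definition inbox (M : R) (p : pt) : Prop := - M <= fst p <= M /\ - M <= snd p <= M.

(** A Lebesgue number argument for properties that pass to smaller scales. *)
Lemma box_uniform (M : R) (P : R -> pt -> Prop) :
  (forall e e' q, 0 < e' <= e -> P e q -> P e' q) ->
  (forall p, inbox M p -> exists d, 0 < d /\ forall q, near d p q -> P d q) ->
  exists d, 0 < d /\ forall q, inbox M q -> P d q.
Proof.
  intros Hmono Hloc.
  (* [compactness_value_2d] expects a gauge on the whole plane; points outside the box receive the
     radius 1. *)
  set (Q := fun p d => 0 < d /\ (inbox M p -> forall q, near d p q -> P d q)).
  assert (HQ : forall p, exists d, Q p d).
  { intros p. destruct (classic (inbox M p)) as [Hp | Hp].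
    - destruct (Hloc p Hp) as (d & Hd & H). exists d; split; auto.
    - exists 1; split; [lra | contradiction]. }
  set (dd := fun p => proj1_sig (constructive_indefinite_description _ (HQ p))).
  assert (Hdd : forall p, Q p (dd p)).
  { intros p. unfold dd. destruct (constructive_indefinite_description _ (HQ p)); auto. }
  destruct (compactness_value_2d (-M) M (-M) M
    (fun x y => mkposreal (dd (x, y)) (proj1 (Hdd (x, y))))) as [d Hd].
  exists d; split; [apply cond_pos|].
  intros [x y] [Hx Hy]; simpl in Hx, Hy.
  apply NNPP; intros Hn. apply (Hd x y Hx Hy). intros (u & v & Hu & Hv & H1 & H2 & H3).
  apply Hn; simpl in *. apply Hmono with (dd (u, v)).
  - split; [apply cond_pos | exact H3].
  - apply (proj2 (Hdd (u, v))); [split; assumption | split; assumption].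
Qed.

Lemma dot_pos_near (z : pt) : z <> (0, 0) ->
  exists e, 0 < e /\ forall w w', near e z w -> near e z w' -> 0 < dot w w'.
Proof.
  intros Hz. destruct z as [x y]. set (s := Rabs x + Rabs y).
  assert (Hs : 0 < s).
  { unfold s. destruct (Req_dec x 0) as [-> | Hx].
    - assert (y <> 0) by (intros ->; apply Hz; reflexivity).
      pose proof (Rabs_pos_lt y H). rewrite Rabs_R0. lra.
    - pose proof (Rabs_pos_lt x Hx). pose proof (Rabs_pos y). lra. }
  (* By [K] the product is at least [s * s] times 1/2 - 1/4 - 1/32, the 1/2 coming from the
     inequality between the sum of squares and the square of the sum. *)
  exists (s / 8). split; [lra|].
  intros [a b] [a' b'] [H1 H2] [H3 H4]; unfold dot; simpl in *.
  assert (K : forall u v v', Rabs (v - u) < s / 8 -> Rabs (v' - u) < s / 8 ->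
    Rabs u * Rabs u - s / 4 * Rabs u - s * s / 64 <= v * v').
  { intros u v v' G1 G2.
    replace (v * v') with (u * u + (u * (v - u) + u * (v' - u) + (v - u) * (v' - u))) by ring.
    replace (u * u) with (Rabs u * Rabs u)
      by (rewrite <- Rabs_mult; apply Rabs_pos_eq; nra).
    assert (Rabs (u * (v - u) + u * (v' - u) + (v - u) * (v' - u)) <=
      Rabs u * (s / 8) + Rabs u * (s / 8) + s / 8 * (s / 8)).
    { eapply Rle_trans; [apply Rabs_triang|]. apply Rplus_le_compat.
      - eapply Rle_trans; [apply Rabs_triang|]. rewrite !Rabs_mult.
        pose proof (Rabs_pos u). nra.
      - rewrite Rabs_mult. apply Rmult_le_compat; try apply Rabs_pos; lra. }
    pose proof (Rle_abs (- (u * (v - u) + u * (v' - u) + (v - u) * (v' - u)))).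
    rewrite Rabs_Ropp in H0. lra. }
  pose proof (K x a a' H1 H3). pose proof (K y b b' H2 H4).
  assert (s * s / 2 <= Rabs x * Rabs x + Rabs y * Rabs y).
  { unfold s. pose proof (Rle_0_sqr (Rabs x - Rabs y)) as Q. unfold Rsqr in Q. lra. }
  assert (s * s = s * Rabs x + s * Rabs y) by (unfold s at 2; ring).
  assert (0 < s * s) by nra. lra.
Qed.

Lemma continuous_pt_near (F : pt -> pt) (p : pt) : continuous F p ->
  forall e, 0 < e -> exists d, 0 < d /\ forall q, near d p q -> near e (F p) (F q).
Proof.
  intros HF e He.
  destruct (proj1 (continuous_near_iff _ _) (continuous_pt_fst _ _ HF) e He) as (d & Hd & H1).
  destruct (proj1 (continuous_near_iff _ _) (continuous_pt_snd _ _ HF) e He) as (d' & Hd' & H2).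
  exists (Rmin d d'). split; [apply Rmin_pos; auto|].
  intros q Hq. split; [apply H1 | apply H2]; eapply near_le; eauto; [apply Rmin_l | apply Rmin_r].
Qed.

Lemma continuous_pt_near_R (F : R -> pt) (x : R) : continuous F x ->
  forall e, 0 < e -> exists d, 0 < d /\ forall y, Rabs (y - x) < d -> near e (F x) (F y).
Proof.
  intros HF e He.
  destruct (proj1 (continuous_R_iff _ _) (continuous_pt_fst _ _ HF) e He) as (d & Hd & H1).
  destruct (proj1 (continuous_R_iff _ _) (continuous_pt_snd _ _ HF) e He) as (d' & Hd' & H2).
  exists (Rmin d d'). split; [apply Rmin_pos; auto|].
  intros q Hq. pose proof (Rmin_l d d'). pose proof (Rmin_r d d').
  split; [apply H1 | apply H2]; lra.
Qed.

Lemma continuous_dot_pos (F : pt -> pt) (p : pt) : continuous F p -> F p <> (0, 0) ->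
  exists d, 0 < d /\ forall q q', near d p q -> near d p q' -> 0 < dot (F q) (F q').
Proof.
  intros HF Hp. destruct (dot_pos_near _ Hp) as (e & He & H).
  destruct (continuous_pt_near F p HF e He) as (d & Hd & K).
  exists d; split; auto.
Qed.

(** * Continuous arguments on the plane *)

Definition smul (c : R) (p : pt) : pt := (c * fst p, c * snd p).

Fixpoint rsum (N : nat) (f : nat -> R) : R :=
  match N with O => 0 | S k => rsum k f + f k end.

Lemma continuous_smul {T : UniformSpace} (c : T -> R) (F : T -> pt) (x : T) :
  continuous c x -> continuous F x -> continuous (fun y => smul (c y) (F y)) x.
Proof.
  intros Hc HF. apply continuous_pair; apply continuous_Rmult;
    auto using continuous_pt_fst, continuous_pt_snd.
Qed.

(** The ray from the origin to p is cut into N steps so short that consecutive values of F make an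
    acute angle, and the angles [rel] are added up. Uniform continuity on the box lets one N serve
    all p, so the sum is continuous in p. *)
Lemma lift_box (F : pt -> pt) (a M : R) :
  (forall p, continuous F p) -> (forall p, F p <> (0, 0)) -> isarg (F (0, 0)) a -> 0 < M ->
  exists th : pt -> R, th (0, 0) = a /\
    forall p, inbox M p -> continuous th p /\ isarg (F p) (th p).
Proof.
  intros Hc Hn Ha HM.
  destruct (box_uniform M (fun e q => forall q', near e q q' -> 0 < dot (F q) (F q')))
    as (d & Hd & HdP).
  - intros e e' q He HP q' Hq'. apply HP. eapply near_le; [|exact Hq']; lra.
  - intros p _. destruct (continuous_dot_pos F p (Hc p) (Hn p)) as (d & Hd & H).
    exists (d / 2). split; [lra|]. intros q Hq q' Hq'. apply H.
    + eapply near_le; [|exact Hq]; lra.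
    + replace d with (d / 2 + d / 2) by field. eapply near_trans; eauto.
  - destruct (INR_unbounded (M / d)) as [N HN].
    assert (HN0 : 0 < INR N).
    { apply Rle_lt_trans with (M / d); [|exact HN]. apply Rlt_le, Rdiv_lt_0_compat; auto. }
    set (pk := fun (k : nat) (p : pt) => smul (INR k / INR N) p).
    assert (Hdot : forall k p, (k < N)%nat -> inbox M p -> 0 < dot (F (pk k p)) (F (pk (S k) p))).
    { intros k p Hk Hp. apply HdP.
      - assert (Hq : 0 <= INR k / INR N <= 1).
        { split; [apply Rle_div_r; try lra; rewrite Rmult_0_l; apply pos_INR|].
          apply Rle_div_l; [lra|]. rewrite Rmult_1_l. apply le_INR; lia. }
        destruct Hp as [[H1 H2] [H3 H4]].
        unfold pk, smul; split; simpl; split; nra.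
      - unfold pk, smul.
        assert (E : forall x, - M <= x <= M -> Rabs (INR (S k) / INR N * x - INR k / INR N * x) < d).
        { intros x Hx. rewrite S_INR.
          replace ((INR k + 1) / INR N * x - INR k / INR N * x) with (x / INR N) by (field; lra).
          unfold Rdiv. rewrite Rabs_mult, (Rabs_pos_eq (/ INR N)) by (apply Rlt_le, Rinv_0_lt_compat; auto).
          apply Rle_lt_trans with (M / INR N).
          - apply Rmult_le_compat_r; [apply Rlt_le, Rinv_0_lt_compat; auto|]. apply Rabs_le; lra.
          - apply Rlt_div_l; [auto|]. apply Rlt_div_l in HN; [|auto]. lra. }
        split; simpl; apply E; apply Hp. }
    exists (fun p => a + rsum N (fun k => rel (F (pk k p)) (F (pk (S k) p)))). split.
    + assert (E : forall m, rsum m (fun k => rel (F (pk k (0, 0))) (F (pk (S k) (0, 0)))) = 0).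
      { induction m; simpl; [reflexivity|]. rewrite IHm. unfold pk, smul; simpl.
        rewrite !Rmult_0_r. rewrite rel_diag. ring. }
      rewrite E; ring.
    + intros p Hp. split.
      * apply continuous_Rplus; [apply continuous_const|].
        assert (E : forall m, (m <= N)%nat ->
          continuous (fun q => rsum m (fun k => rel (F (pk k q)) (F (pk (S k) q)))) p).
        { induction m; intros Hm; simpl; [apply continuous_const|].
          apply continuous_Rplus; [apply IHm; lia|].
          assert (Ck : forall k, continuous (fun q => F (pk k q)) p).
          { intros k. apply (continuous_comp (pk k) F); [|apply Hc].
            unfold pk. apply (continuous_smul (T := prod_UniformSpace _ _) (fun _ => INR k / INR N) (fun q => q)).
            - apply continuous_const.
            - apply continuous_id. }
          apply continuous_comp_atan. apply continuous_Rdiv.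
          - specialize (Hdot m p ltac:(lia) Hp); lra.
          - apply continuous_crs; apply Ck.
          - apply continuous_dot; apply Ck. }
        apply E; lia.
      * assert (E : forall m, (m <= N)%nat ->
          isarg (F (pk m p)) (a + rsum m (fun k => rel (F (pk k p)) (F (pk (S k) p))))).
        { induction m; intros Hm; simpl rsum.
          - replace (pk 0%nat p) with ((0, 0) : pt).
            + rewrite Rplus_0_r; exact Ha.
            + unfold pk, smul; simpl; f_equal; field; lra.
          - rewrite <- Rplus_assoc. apply isarg_rel; [apply IHm; lia|].
            apply Hdot; [lia | exact Hp]. }
        specialize (E N (Nat.le_refl N)).
        replace (pk N p) with p in E; [exact E|].
        unfold pk, smul. destruct p; simpl; f_equal; field; lra.
Qed.

(** Retraction onto the unit interval. It turns data on a segment or a rectangle into data on the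
    whole line or plane, where lifts are defined. *)
Definition clamp (x : R) : R := Rmax 0 (Rmin 1 x).

Lemma clamp_bound (x : R) : 0 <= clamp x <= 1.
Proof.
  unfold clamp. split; [apply Rmax_l|]. apply Rmax_lub; [lra | apply Rmin_l].
Qed.

Lemma clamp_id (x : R) : 0 <= x <= 1 -> clamp x = x.
Proof. intros Hx. unfold clamp. rewrite Rmin_right, Rmax_right; lra. Qed.

Lemma continuous_clamp (x : R) : continuous clamp x.
Proof.
  apply continuous_R_iff. intros e He. exists e. split; [auto|]. intros y Hy.
  revert Hy. unfold clamp, Rmax, Rmin.
  repeat (destruct (Rle_dec _ _)); unfold Rabs; repeat destruct (Rcase_abs _); lra.
Qed.

(** Continuation of the argument along the ray from the origin determines the value at p. Hence the
    lifts over boxes of all sizes, normalized at the origin, are restrictions of the single function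
    [th] defined by this continuation. *)
Lemma lift_plane (F : pt -> pt) :
  (forall p, continuous F p) -> (forall p, F p <> (0, 0)) -> exists th, lift F th.
Proof.
  intros Hc Hn. destruct (isarg_ex _ (Hn (0, 0))) as [a Ha].
  set (ray := fun p l => F (smul (clamp l) p)).
  set (th := fun p => epsilon (inhabits 0)
    (fun v => exists t, lift (ray p) t /\ t 0 = a /\ t 1 = v)).
  exists th.
  assert (K : forall M t, 0 < M -> t (0, 0) = a ->
    (forall p, inbox M p -> continuous t p /\ isarg (F p) (t p)) ->
    forall p, inbox M p -> th p = t p).
  { intros M t HM H0 Ht p Hp.
    assert (Hr : lift (ray p) (fun l => t (smul (clamp l) p))).
    { intros l. pose proof (clamp_bound l) as Hl.
      assert (Hb : inbox M (smul (clamp l) p)).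
      { destruct Hp as [[] []]. unfold smul; split; simpl; split; nra. }
      destruct (Ht _ Hb) as [T1 T2]. split; [|exact T2].
      apply (continuous_comp (fun l => smul (clamp l) p) t); [|exact T1].
      apply continuous_smul; [apply continuous_clamp | apply continuous_const]. }
    assert (E0 : smul (clamp 0) p = (0, 0)).
    { rewrite clamp_id by lra. unfold smul; f_equal; ring. }
    assert (E1 : smul (clamp 1) p = p).
    { rewrite clamp_id by lra. unfold smul; destruct p; simpl; f_equal; ring. }
    assert (X : exists v, exists t, lift (ray p) t /\ t 0 = a /\ t 1 = v).
    { exists (t p). exists (fun l => t (smul (clamp l) p)). rewrite E0, E1. auto. }
    apply (epsilon_spec (inhabits 0)) in X. fold (th p) in X.
    destruct X as (s & Hs & Hs0 & Hs1).
    pose proof (lift_unique _ _ _ Hs Hr 0 1) as U. simpl in U.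
    rewrite E0, E1, H0, Hs0, Hs1 in U. lra. }
  enough (G : forall p : pt, continuous th p /\ isarg (F p) (th p)) by exact G.
  intros p. set (M := Rabs (fst p) + Rabs (snd p) + 1).
  pose proof (Rabs_pos (fst p)) as P1. pose proof (Rabs_pos (snd p)) as P2.
  assert (HM : 0 < M) by (unfold M; lra).
  destruct (lift_box F a M Hc Hn Ha HM) as (t & Ht0 & Ht).
  assert (Hnb : forall q, near 1 p q -> inbox M q).
  { intros q [H1 H2]. apply Rabs_lt_between in H1. apply Rabs_lt_between in H2.
    pose proof (Rle_abs (fst p)). pose proof (Rle_abs (snd p)).
    pose proof (Rle_abs (- fst p)) as G1. pose proof (Rle_abs (- snd p)) as G2.
    rewrite Rabs_Ropp in G1, G2.
    unfold M; split; split; lra. }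
  assert (Hpp : inbox M p) by (apply Hnb, near_refl; lra).
  split.
  - apply (continuous_ext_loc _ t).
    + exists (mkposreal 1 Rlt_0_1). intros q Hq. symmetry. apply (K M); auto. 
    + apply Ht; auto.
  - rewrite (K M t); auto. apply Ht; auto.
Qed.

Lemma lift_line (f : R -> pt) :
  (forall t, continuous f t) -> (forall t, f t <> (0, 0)) -> exists th, lift f th.
Proof.
  intros Hc Hn. destruct (lift_plane (fun p => f (fst p))) as [th Hth].
  - intros p. apply (continuous_comp fst f); [destruct p; apply continuous_fst | apply Hc].
  - intros p; apply Hn.
  - exists (fun t => th (t, 0)).
    refine (lift_comp (fun p : pt => f (fst p)) th (fun t : R => (t, 0) : pt) Hth _).
    intros t. apply continuous_pair; [apply continuous_id | apply continuous_const].
Qed.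

(** * Variation of the argument along segments *)

Definition seg (a b : pt) (t : R) : pt :=
  (fst a + clamp t * (fst b - fst a), snd a + clamp t * (snd b - snd a)).

Lemma seg_0 (a b : pt) : seg a b 0 = a.
Proof. unfold seg. rewrite clamp_id by lra. destruct a; simpl; f_equal; ring. Qed.

Lemma seg_1 (a b : pt) : seg a b 1 = b.
Proof. unfold seg. rewrite clamp_id by lra. destruct b; simpl; f_equal; ring. Qed.

Lemma continuous_seg (a b : pt) (t : R) : continuous (seg a b) t.
Proof.
  apply continuous_pair; apply continuous_Rplus; try apply continuous_const;
    apply continuous_Rmult; try apply continuous_const; apply continuous_clamp.
Qed.

(** The value is arbitrary when F has no lift along the segment. In the final count such edges only
    bound cells of weight 0. *)
Definition darg (F : pt -> pt) (a b : pt) : R :=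
  epsilon (inhabits 0) (fun d => exists th, lift (fun t => F (seg a b t)) th /\ th 1 - th 0 = d).

Lemma darg_lift (F : pt -> pt) (a b : pt) (th : R -> R) :
  lift (fun t => F (seg a b t)) th -> darg F a b = th 1 - th 0.
Proof.
  intros Hth. unfold darg.
  match goal with |- epsilon _ ?P = _ => assert (X : exists d, P d) by (exists (th 1 - th 0), th; auto) end.
  apply (epsilon_spec (inhabits 0)) in X. destruct X as (ps & Hps & <-).
  pose proof (lift_unique _ _ _ Hth Hps 0 1). lra.
Qed.

Lemma continuous_along_seg (F : pt -> pt) (a b : pt) :
  (forall t, continuous F (seg a b t)) -> forall t, continuous (fun t => F (seg a b t)) t.
Proof. intros HF t. apply (continuous_comp (seg a b) F); [apply continuous_seg | apply HF]. Qed.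

Lemma darg_half_plane (F : pt -> pt) (a b z : pt) :
  (forall t, continuous F (seg a b t)) -> (forall t, 0 < dot z (F (seg a b t))) ->
  darg F a b = rel z (F b) - rel z (F a).
Proof.
  intros Hc Hd.
  assert (Hz : z <> (0, 0)).
  { intros ->. specialize (Hd 0). unfold dot in Hd; simpl in Hd; lra. }
  destruct (isarg_ex z Hz) as [al Hal].
  rewrite (darg_lift F a b _ (lift_half_plane _ z al Hal (continuous_along_seg F a b Hc) Hd)).
  rewrite seg_0, seg_1. ring.
Qed.

Lemma darg_arg (F : pt -> pt) (a b : pt) (al : R) :
  (forall t, continuous F (seg a b t)) -> (forall t, F (seg a b t) <> (0, 0)) ->
  isarg (F a) al -> isarg (F b) (al + darg F a b).
Proof.
  intros Hc Hn Hal.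
  destruct (lift_line _ (continuous_along_seg F a b Hc) Hn) as [th Hth].
  rewrite (darg_lift _ _ _ _ Hth).
  destruct (Hth 0) as [_ H0]. destruct (Hth 1) as [_ H1]. rewrite seg_0 in H0. rewrite seg_1 in H1.
  destruct (isarg_unique _ _ _ H0 Hal) as [k Hk].
  destruct H1 as (r & Hr & E). exists r; split; [exact Hr|]. rewrite E.
  replace (al + (th 1 - th 0)) with (th 1 + 2 * IZR k * PI) by lra.
  f_equal; f_equal.
  - rewrite cos_plus.
    assert (S : sin (IZR k * PI) = 0) by (apply sin_eq_0_1; exists k; reflexivity).
    replace (2 * IZR k * PI) with (2 * (IZR k * PI)) by ring.
    rewrite cos_2a_sin, sin_2a, S. ring.
  - rewrite sin_plus.
    assert (S : sin (IZR k * PI) = 0) by (apply sin_eq_0_1; exists k; reflexivity).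
    replace (2 * IZR k * PI) with (2 * (IZR k * PI)) by ring.
    rewrite cos_2a_sin, sin_2a, S. ring.
Qed.

(** Counterclockwise. Opposite sides are run in the same direction, so that two neighboring cells
    contain literally the same term for their common edge, with opposite signs. *)
Definition circ (F : pt -> pt) (x x' y y' : R) : R :=
  darg F (x, y) (x', y) + darg F (x', y) (x', y')
  - darg F (x, y') (x', y') - darg F (x, y) (x, y').

(** Composed with the retraction [c] onto the rectangle, F has a lift over the whole plane, and the
    four sides become differences of its values at the corners. *)
Lemma circ_zero (F : pt -> pt) (x x' y y' : R) :
  x <= x' -> y <= y' ->
  (forall p, x <= fst p <= x' -> y <= snd p <= y' -> continuous F p /\ F p <> (0, 0)) ->
  circ F x x' y y' = 0.
Proof.
  intros Hx Hy HF.
  set (c := fun p : pt => (x + clamp (fst p) * (x' - x), y + clamp (snd p) * (y' - y)) : pt).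
  assert (Hin : forall p, x <= fst (c p) <= x' /\ y <= snd (c p) <= y').
  { intros p. unfold c; simpl. pose proof (clamp_bound (fst p)). pose proof (clamp_bound (snd p)).
    repeat split; nra. }
  destruct (lift_plane (fun p => F (c p))) as [th Hth].
  - intros p. apply (continuous_comp c F).
    + apply continuous_pair; (apply continuous_Rplus; [apply continuous_const|];
        apply continuous_Rmult; [|apply continuous_const]).
      * apply (continuous_comp fst clamp); [destruct p; apply continuous_fst | apply continuous_clamp].
      * apply (continuous_comp snd clamp); [destruct p; apply continuous_snd | apply continuous_clamp].
    + apply HF; apply Hin.
  - intros p; apply HF; apply Hin.
  - assert (E : forall (u v : R -> R) (a b : pt), (forall t, continuous u t) -> (forall t, continuous v t) ->
        (forall t, c (u t, v t) = seg a b t) ->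
        darg F a b = th (u 1, v 1) - th (u 0, v 0)).
    { intros u v a b Hu Hv Huv. apply (darg_lift F a b (fun t => th (u t, v t))).
      apply (lift_ext (fun t => F (c (u t, v t)))).
      - intros t; rewrite Huv; reflexivity.
      - refine (lift_comp (fun p => F (c p)) th (fun t : R => (u t, v t) : pt) Hth _).
        intros t; apply continuous_pair; auto. }
    assert (C0 : clamp 0 = 0) by (apply clamp_id; lra).
    assert (C1 : clamp 1 = 1) by (apply clamp_id; lra).
    unfold circ.
    rewrite (E (fun t => t) (fun _ => 0) (x, y) (x', y)), (E (fun _ => 1) (fun t => t) (x', y) (x', y')),
      (E (fun t => t) (fun _ => 1) (x, y') (x', y')), (E (fun _ => 0) (fun t => t) (x, y) (x, y'));
      try (intros; apply continuous_id); try (intros; apply continuous_const);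
      try (intros; unfold c, seg; simpl; rewrite ?C0, ?C1; f_equal; ring).
Qed.

Definition psub (p q : pt) : pt := (fst p - fst q, snd p - snd q).

Lemma continuous_psub {T : UniformSpace} (F G : T -> pt) (x : T) :
  continuous F x -> continuous G x -> continuous (fun y => psub (F y) (G y)) x.
Proof.
  intros HF HG. apply continuous_pair; apply continuous_Rminus;
    auto using continuous_pt_fst, continuous_pt_snd.
Qed.

Lemma continuous_from (q p : pt) : continuous (fun p => psub p q) p.
Proof.
  apply (continuous_psub (T := prod_UniformSpace _ _) (fun p => p) (fun _ => q)).
  - apply continuous_id.
  - apply continuous_const.
Qed.

Lemma psub_neq0 (p q : pt) : p <> q -> psub p q <> (0, 0).
Proof.
  intros H E. apply H. destruct p, q; unfold psub in E; simpl in E. injection E as E1 E2.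
  f_equal; lra.
Qed.

Lemma atan_diff (u v c : R) : 0 < c -> v < u -> 0 < atan (u / c) - atan (v / c) < PI.
Proof.
  intros Hc Huv.
  assert (v / c < u / c) by (apply Rmult_lt_compat_r; [apply Rinv_0_lt_compat; auto | auto]).
  pose proof (atan_increasing _ _ H).
  pose proof (atan_bound (u / c)). pose proof (atan_bound (v / c)). lra.
Qed.

(* Each side contributes an angle in (0, PI), and the total is a multiple of 2 PI. *)
Lemma circ_inside (q : pt) (x x' y y' : R) :
  x < fst q < x' -> y < snd q < y' -> circ (fun p => psub p q) x x' y y' = 2 * PI.
Proof.
  intros Hx Hy. set (F := fun p => psub p q).
  assert (Hc : forall p, continuous F p) by (intros; apply continuous_from).
  assert (Hsx : forall (a b : pt) t u, fst a <= fst b -> u = fst (seg a b t) -> fst a <= u <= fst b).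
  { intros a b t u Hab ->. unfold seg; simpl. pose proof (clamp_bound t). split; nra. }
  assert (Hsy : forall (a b : pt) t u, snd a <= snd b -> u = snd (seg a b t) -> snd a <= u <= snd b).
  { intros a b t u Hab ->. unfold seg; simpl. pose proof (clamp_bound t). split; nra. }
  assert (B1 : forall t, 0 < dot (0, -1) (F (seg (x, y) (x', y) t))).
  { intros t. pose proof (Hsy (x, y) (x', y) t _ ltac:(simpl; lra) eq_refl) as K; simpl in K.
    unfold F, psub, dot; simpl. simpl in *. lra. }
  assert (B2 : forall t, 0 < dot (1, 0) (F (seg (x', y) (x', y') t))).
  { intros t. pose proof (Hsx (x', y) (x', y') t _ ltac:(simpl; lra) eq_refl) as K; simpl in K.
    unfold F, psub, dot; simpl. simpl in *. lra. }
  assert (B3 : forall t, 0 < dot (0, 1) (F (seg (x, y') (x', y') t))).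
  { intros t. pose proof (Hsy (x, y') (x', y') t _ ltac:(simpl; lra) eq_refl) as K; simpl in K.
    unfold F, psub, dot; simpl. simpl in *. lra. }
  assert (B4 : forall t, 0 < dot (-1, 0) (F (seg (x, y) (x, y') t))).
  { intros t. pose proof (Hsx (x, y) (x, y') t _ ltac:(simpl; lra) eq_refl) as K; simpl in K.
    unfold F, psub, dot; simpl. simpl in *. lra. }
  assert (N : forall z w, 0 < dot z w -> w <> (0, 0)).
  { intros z w Hd ->. unfold dot in Hd; simpl in Hd; lra. }
  pose proof (fun al => darg_arg F (x, y) (x', y) al (fun t => Hc _) (fun t => N _ _ (B1 t))) as A1.
  pose proof (fun al => darg_arg F (x', y) (x', y') al (fun t => Hc _) (fun t => N _ _ (B2 t))) as A2.
  pose proof (fun al => darg_arg F (x, y') (x', y') al (fun t => Hc _) (fun t => N _ _ (B3 t))) as A3.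
  pose proof (fun al => darg_arg F (x, y) (x, y') al (fun t => Hc _) (fun t => N _ _ (B4 t))) as A4.
  assert (H0 : F (x, y) <> (0, 0)).
  { unfold F, psub; simpl. intros E. injection E as E1 E2. lra. }
  destruct (isarg_ex _ H0) as [al Hal].
  pose proof (A2 _ (A1 _ Hal)) as R1. pose proof (A3 _ (A4 _ Hal)) as R2.
  destruct (isarg_unique _ _ _ R2 R1) as [k Hk].
  unfold circ. fold F.
  assert (D1 : 0 < darg F (x, y) (x', y) < PI).
  { rewrite (darg_half_plane F _ _ _ (fun t => Hc _) B1). unfold rel, crs, dot, F, psub; simpl.
    replace (0 * (x' - fst q) + -1 * (y - snd q)) with (snd q - y) by ring.
    replace (0 * (x - fst q) + -1 * (y - snd q)) with (snd q - y) by ring.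
    apply atan_diff; lra. }
  assert (D2 : 0 < darg F (x', y) (x', y') < PI).
  { rewrite (darg_half_plane F _ _ _ (fun t => Hc _) B2). unfold rel, crs, dot, F, psub; simpl.
    replace (1 * (x' - fst q) + 0 * (y' - snd q)) with (x' - fst q) by ring.
    replace (1 * (x' - fst q) + 0 * (y - snd q)) with (x' - fst q) by ring.
    apply atan_diff; lra. }
  assert (D3 : 0 < - darg F (x, y') (x', y') < PI).
  { rewrite (darg_half_plane F _ _ _ (fun t => Hc _) B3). unfold rel, crs, dot, F, psub; simpl.
    replace (0 * (x' - fst q) + 1 * (y' - snd q)) with (y' - snd q) by ring.
    replace (0 * (x - fst q) + 1 * (y' - snd q)) with (y' - snd q) by ring.
    rewrite Ropp_minus_distr. apply atan_diff; lra. }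
  assert (D4 : 0 < - darg F (x, y) (x, y') < PI).
  { rewrite (darg_half_plane F _ _ _ (fun t => Hc _) B4). unfold rel, crs, dot, F, psub; simpl.
    replace (-1 * (x - fst q) + 0 * (y' - snd q)) with (fst q - x) by ring.
    replace (-1 * (x - fst q) + 0 * (y - snd q)) with (fst q - x) by ring.
    rewrite Ropp_minus_distr. apply atan_diff; lra. }
  pose proof PI_RGT_0 as HPI.
  assert (E : darg F (x, y) (x', y) + darg F (x', y) (x', y') - darg F (x, y') (x', y')
    - darg F (x, y) (x, y') = 2 * PI * IZR k) by lra.
  rewrite E in *.
  assert (K : 0 < 2 * PI * IZR k < 4 * PI) by lra.
  assert (0 < IZR k < 2) by (split; nra).
  assert (k = 1)%Z as ->.
  { assert (0 < k < 2)%Z; [|lia]. split; apply lt_IZR; lra. }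
  ring.
Qed.

(** * Index of an isolated zero *)

Definition nrm (z : pt) : R := dist2 z (0, 0).

Lemma nrm_eq (z : pt) : nrm z = sqrt (fst z ^ 2 + snd z ^ 2).
Proof. unfold nrm, dist2; simpl. f_equal; ring. Qed.

Lemma isarg_nrm (z : pt) (a : R) : isarg z a -> 0 < nrm z /\ z = (nrm z * cos a, nrm z * sin a).
Proof.
  intros (r & Hr & ->).
  assert (E : nrm (r * cos a, r * sin a) = r).
  { rewrite nrm_eq; simpl fst; simpl snd. pose proof (sin2_cos2 a) as Q. unfold Rsqr in Q.
    replace ((r * cos a) ^ 2 + (r * sin a) ^ 2) with (r ^ 2)
      by (transitivity (r ^ 2 * (sin a * sin a + cos a * cos a)); [rewrite Q; ring | ring]).
    replace (r ^ 2) with (r * r) by ring. apply sqrt_square; lra. }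
  rewrite E. auto.
Qed.

Lemma nrm_bound (z : pt) : Rabs (fst z) <= nrm z /\ Rabs (snd z) <= nrm z /\
  nrm z <= Rabs (fst z) + Rabs (snd z).
Proof.
  rewrite nrm_eq. repeat split.
  - rewrite <- sqrt_Rsqr_abs. apply sqrt_le_1_alt. unfold Rsqr. nra.
  - rewrite <- sqrt_Rsqr_abs. apply sqrt_le_1_alt. unfold Rsqr. nra.
  - pose proof (Rabs_pos (fst z)). pose proof (Rabs_pos (snd z)).
    rewrite <- (sqrt_square (Rabs (fst z) + Rabs (snd z))) by lra.
    apply sqrt_le_1_alt. rewrite <- (pow2_abs (fst z)), <- (pow2_abs (snd z)). nra.
Qed.

Lemma nrm_pos (z : pt) : z <> (0, 0) -> 0 < nrm z.
Proof. intros Hz. destruct (isarg_ex z Hz) as [a Ha]. apply (isarg_nrm z a Ha). Qed.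

Lemma lift_plane_unique (F : pt -> pt) (th ps : pt -> R) :
  lift F th -> lift F ps -> forall p q, ps p - th p = ps q - th q.
Proof.
  intros H1 H2 p q.
  pose proof (lift_unique _ _ _ (lift_comp F th (seg p q) H1 (continuous_seg p q))
    (lift_comp F ps (seg p q) H2 (continuous_seg p q)) 0 1) as E.
  simpl in E. rewrite seg_0, seg_1 in E. exact E.
Qed.

Lemma continuous_nrm {T : UniformSpace} (F : T -> pt) (x : T) :
  continuous F x -> continuous (fun y => nrm (F y)) x.
Proof.
  intros HF.
  apply (continuous_ext (fun y => sqrt (fst (F y) * fst (F y) + snd (F y) * snd (F y)))).
  { intros y; rewrite nrm_eq; f_equal; ring. }
  apply (continuous_comp (fun y => fst (F y) * fst (F y) + snd (F y) * snd (F y)) sqrt).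
  - apply continuous_Rplus; apply continuous_Rmult;
      auto using continuous_pt_fst, continuous_pt_snd.
  - apply continuous_sqrt.
Qed.

Definition polar (z : pt) (r t : R) : pt :=
  (fst z + r * cos (2 * PI * t), snd z + r * sin (2 * PI * t)).


Lemma near_nrm (z q : pt) (r : R) : nrm (psub q z) < r -> near r z q.
Proof.
  intros H. destruct (nrm_bound (psub q z)) as (H1 & H2 & _). unfold psub in *; simpl in *.
  split; lra.
Qed.

(** Polar coordinates with the logarithm of the radius unroll the punctured disc; capping the radius
    at [r0 / 2] extends them to the whole plane, where [lift_plane] applies. One turn in t gives a
    second lift of the same field, hence a constant difference 2 PI k. *)
Lemma polar_lift (V : pt -> pt) (z : pt) (r0 : R) : 0 < r0 ->
  (forall q, near r0 z q -> q <> z -> continuous V q /\ V q <> (0, 0)) ->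
  exists (k : Z) (th : pt -> R) (r1 : R), 0 < r1 /\
    (forall p, continuous th p) /\
    (forall r t, 0 < r < r1 -> isarg (V (polar z r t)) (th (ln r, t))) /\
    (forall s t, th (s, t + 1) = th (s, t) + 2 * PI * IZR k).
Proof.
  intros Hr0 HV. set (m := fun s => Rmin (exp s) (r0 / 2)).
  assert (Hm : forall s, 0 < m s < r0).
  { intros s. unfold m. pose proof (exp_pos s). split; [apply Rmin_pos; lra|].
    pose proof (Rmin_r (exp s) (r0 / 2)); lra. }
  assert (Hcm : forall s, continuous m s).
  { intros s. apply (continuous_ext (fun s => (exp s + r0 / 2 - Rabs (exp s - r0 / 2)) / 2)).
    { intros y. unfold m, Rmin. destruct (Rle_dec _ _).
      - rewrite Rabs_left1 by lra. lra.
      - rewrite Rabs_pos_eq by lra. lra. }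
    assert (He : continuous exp s) by (apply (ex_derive_continuous exp s); auto_derive; auto).
    apply continuous_Rdiv; [lra | | apply continuous_const].
    apply continuous_Rminus; [|apply continuous_comp_Rabs; apply continuous_Rminus];
      try apply continuous_Rplus; auto; apply continuous_const. }
  assert (Hn : forall r t, nrm (psub (polar z r t) z) = Rabs r).
  { intros r t. rewrite nrm_eq. unfold polar, psub; simpl fst; simpl snd.
    rewrite <- sqrt_Rsqr_abs. f_equal. unfold Rsqr.
    pose proof (sin2_cos2 (2 * PI * t)) as Q. unfold Rsqr in Q.
    transitivity (r * r * (sin (2 * PI * t) * sin (2 * PI * t) + cos (2 * PI * t) * cos (2 * PI * t)));
      [ring | rewrite Q; ring]. }
  set (c := fun p : pt => polar z (m (fst p)) (snd p)).
  assert (Hgood : forall p, continuous V (c p) /\ V (c p) <> (0, 0)).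
  { intros p. destruct (Hm (fst p)) as [m1 m2]. apply HV.
    - apply near_nrm. unfold c. rewrite Hn, Rabs_pos_eq; lra.
    - intros E. pose proof (Hn (m (fst p)) (snd p)) as E'. unfold c in E. rewrite E in E'.
      rewrite nrm_eq in E'. unfold psub in E'; simpl fst in E'; simpl snd in E'.
      rewrite !Rminus_diag in E'. replace (0 ^ 2 + 0 ^ 2) with 0 in E' by ring.
      rewrite sqrt_0, Rabs_pos_eq in E'; lra. }
  assert (Hcc : forall p, continuous c p).
  { intros p.
    assert (Cm : continuous (fun p : pt => m (fst p)) p).
    { apply (continuous_comp fst m); [destruct p; apply continuous_fst | apply Hcm]. }
    assert (Ct : continuous (fun p : pt => 2 * PI * snd p) p).
    { apply (continuous_Rmult (T := prod_UniformSpace _ _) (fun _ => 2 * PI) snd);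
      [apply continuous_const | destruct p; apply continuous_snd]. }
    apply continuous_pair; apply continuous_Rplus; try apply continuous_const;
      apply continuous_Rmult; auto.
    - apply (continuous_comp (fun p : pt => 2 * PI * snd p) cos); auto. apply continuous_cos.
    - apply (continuous_comp (fun p : pt => 2 * PI * snd p) sin); auto. apply continuous_sin. }
  destruct (lift_plane (fun p => V (c p))) as [th Hth].
  { intros p. apply (continuous_comp c V); [apply Hcc | apply Hgood]. }
  { intros p; apply Hgood. }
  assert (Hth' : lift (fun p => V (c p)) (fun p => th (fst p, snd p + 1))).
  { apply (lift_ext (fun p => V (c (fst p, snd p + 1)))).
    - intros [s t]. unfold c; simpl. f_equal. unfold polar.
      replace (2 * PI * (t + 1)) with (2 * PI * t + 2 * PI) by ring.
      rewrite cos_plus, sin_plus, cos_2PI, sin_2PI. f_equal; ring.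
    - refine (lift_comp (fun p => V (c p)) th (fun p : pt => (fst p, snd p + 1) : pt) Hth _).
      intros p. apply continuous_pair.
      + destruct p; apply continuous_fst.
      + apply (continuous_Rplus (T := prod_UniformSpace _ _) snd (fun _ => 1));
        [destruct p; apply continuous_snd | apply continuous_const]. }
  destruct (isarg_unique _ _ _ (proj2 (Hth (0, 0))) (proj2 (Hth' (0, 0)))) as [k Hk].
  exists k, th, (r0 / 2). split; [lra|]. split; [intros p; apply Hth|]. split.
  - intros r t Hr. pose proof (proj2 (Hth (ln r, t))) as E. unfold c, m in E; simpl in E.
    rewrite exp_ln in E by lra. rewrite Rmin_left in E by lra. exact E.
  - intros s t. pose proof (lift_plane_unique _ _ _ Hth Hth' (0, 0) (s, t)) as E. simpl in E, Hk. lra.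
Qed.

Lemma shift_int (f : R -> R) (c L : R) : (forall t, f (t + L) = f t + c) ->
  forall (k : Z) t, f (t + IZR k * L) = f t + IZR k * c.
Proof.
  intros H.
  assert (N : forall n t, f (t + INR n * L) = f t + INR n * c).
  { induction n; intros t; [simpl; rewrite !Rmult_0_l, !Rplus_0_r; reflexivity|].
    rewrite S_INR. replace (t + (INR n + 1) * L) with ((t + INR n * L) + L) by ring.
    rewrite H, IHn. ring. }
  intros k t. destruct (Z_le_gt_dec 0 k) as [Hk | Hk].
  - rewrite <- (Z2Nat.id k Hk), <- INR_IZR_INZ. apply N.
  - assert (E : IZR k = - INR (Z.to_nat (- k))).
    { rewrite INR_IZR_INZ, Z2Nat.id by lia. rewrite opp_IZR. ring. }
    rewrite E. specialize (N (Z.to_nat (- k)) (t + - INR (Z.to_nat (- k)) * L)).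
    replace (t + - INR (Z.to_nat (- k)) * L + INR (Z.to_nat (- k)) * L) with t in N by ring.
    lra.
Qed.

(** Passage from circles to rectangles: along a side, the lift of V in polar coordinates minus k
    times the argument of p - z is a function [Psi] of the point alone, because one more turn adds 2
    PI k to both terms. So V and k times p - z vary alike up to a gradient, and [circ_inside]
    concludes. *)
Lemma index_exists (V : pt -> pt) (z : pt) (r0 : R) : 0 < r0 ->
  (forall q, near r0 z q -> q <> z -> continuous V q /\ V q <> (0, 0)) ->
  exists k, index_is V z k /\
    exists r1, 0 < r1 /\ forall x x' y y',
      near r1 z (x, y) -> near r1 z (x', y') -> x < fst z < x' -> y < snd z < y' ->
      circ V x x' y y' = 2 * PI * IZR k.
Proof.
  intros Hr0 HV.
  destruct (polar_lift V z r0 Hr0 HV) as (k & th & r1 & Hr1 & Hc & Ha & Hp).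
  pose proof PI_RGT_0 as HPI.
  exists k. split.
  - exists r1. split; [exact Hr1|]. intros r Hr. exists (fun t => th (ln r, t)). split; [|split].
    + intros t _. apply (continuous_comp (fun t : R => (ln r, t) : pt) th); [|apply Hc].
      apply continuous_pair; [apply continuous_const | apply continuous_id].
    + intros t _. pose proof (Ha r t Hr) as E. split.
      * exact (isarg_neq0 _ _ E).
      * apply (isarg_nrm _ _ E).
    + rewrite <- (Rplus_0_l 1), Hp. lra.
  (* Two coordinates below [r1 / 2] give a Euclidean norm below [r1]. *)
  - exists (Rmin (r1 / 2) r0). split; [apply Rmin_pos; lra|].
    intros x x' y y' N1 N2 Hx Hy.
    rewrite <- (circ_inside z x x' y y' Hx Hy).
    set (W := fun p => psub p z).
    (* A choice of argument without continuity; it is harmless since [Psi] takes the same value for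
       every choice. *)
    set (T := fun p => epsilon (inhabits 0) (isarg (W p))).
    set (Psi := fun p => th (ln (nrm (W p)), T p / (2 * PI)) - IZR k * T p).
    assert (E : forall a b,
        (forall t, x <= fst (seg a b t) <= x' /\ y <= snd (seg a b t) <= y' /\ seg a b t <> z) ->
        darg V a b = IZR k * darg W a b + Psi b - Psi a).
    { intros a b Hab.
      assert (HW : forall t, W (seg a b t) <> (0, 0)) by (intros t; apply psub_neq0, Hab).
      assert (HcW : forall t, continuous (fun t => W (seg a b t)) t).
      { apply continuous_along_seg. intros; apply continuous_from. }
      assert (HN : forall t, near (Rmin (r1 / 2) r0) z (seg a b t)).
      { intros t. destruct (Hab t) as (B1 & B2 & _). destruct N1 as [C1 C2], N2 as [C3 C4].
        cbn [fst snd] in C1, C2, C3, C4. apply Rabs_lt_between in C1, C2, C3, C4. split; apply Rabs_lt_between; lra. }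
      assert (HNr : forall t, 0 < nrm (W (seg a b t)) < r1).
      { intros t. split; [apply nrm_pos, HW|].
        destruct (nrm_bound (W (seg a b t))) as (_ & _ & B). destruct (HN t) as [C1 C2].
        pose proof (Rmin_l (r1 / 2) r0). unfold W, psub in *. simpl fst in *; simpl snd in *. lra. }
      assert (HVc : forall t, continuous V (seg a b t)).
      { intros t. apply HV; [eapply near_le; [|apply HN]; apply Rmin_r | apply Hab]. }
      destruct (lift_line _ HcW HW) as [al Hal].
      rewrite (darg_lift W a b al Hal).
      rewrite (darg_lift V a b (fun t => th (ln (nrm (W (seg a b t))), al t / (2 * PI)))).
      - assert (HP : forall t, th (ln (nrm (W (seg a b t))), al t / (2 * PI)) = Psi (seg a b t) + IZR k * al t).
        { intros t. unfold Psi.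
          assert (X : isarg (W (seg a b t)) (T (seg a b t))).
          { unfold T. apply epsilon_spec. eexists; apply Hal. }
          destruct (isarg_unique _ _ _ X (proj2 (Hal t))) as [j Hj].
          set (s := ln (nrm (W (seg a b t)))). set (Tt := T (seg a b t)) in *.
          replace (al t) with (Tt + 2 * PI * IZR j) by lra.
          replace ((Tt + 2 * PI * IZR j) / (2 * PI)) with (Tt / (2 * PI) + IZR j * 1) by (field; lra).
          rewrite (shift_int (fun t => th (s, t)) (2 * PI * IZR k) 1 (Hp s)). ring. }
        rewrite !HP, seg_0, seg_1. ring.
      - intros t. split.
        + apply (continuous_comp (fun t => (ln (nrm (W (seg a b t))), al t / (2 * PI)) : pt) th); [|apply Hc].
          apply continuous_pair.
          * apply (continuous_comp (fun t => nrm (W (seg a b t))) ln).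
            -- apply continuous_nrm, HcW.
            -- apply (ex_derive_continuous ln). auto_derive. apply HNr.
          * apply continuous_Rdiv; [lra | apply Hal | apply continuous_const].
        + pose proof (Ha _ (al t / (2 * PI)) (HNr t)) as E. cbv beta.
          replace (seg a b t) with (polar z (nrm (W (seg a b t))) (al t / (2 * PI))) at 1; [exact E|].
          unfold polar. replace (2 * PI * (al t / (2 * PI))) with (al t) by (field; lra).
          destruct (isarg_nrm _ _ (proj2 (Hal t))) as [_ Q].
          revert Q. generalize (nrm (W (seg a b t))). intros n Q.
          unfold W, psub in Q. injection Q as Q1 Q2.
          rewrite (surjective_pairing (seg a b t)). f_equal; unfold seg; simpl; lra. }
    unfold circ. rewrite !E; [fold W; ring | ..].
    all: intros t; pose proof (clamp_bound t); unfold seg; simpl; repeat split; try nra.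
    all: intros Ez; rewrite <- Ez in Hx, Hy; simpl in Hx, Hy; nra.
Qed.

(** * Sums over the cells of a grid *)

Lemma rsum_ext (N : nat) (f g : nat -> R) :
  (forall i, (i < N)%nat -> f i = g i) -> rsum N f = rsum N g.
Proof.
  induction N; intros H; simpl; [reflexivity|].
  rewrite IHN by (intros; apply H; lia). rewrite H by lia. reflexivity.
Qed.

Lemma rsum_plus (N : nat) (f g : nat -> R) : rsum N (fun i => f i + g i) = rsum N f + rsum N g.
Proof. induction N; simpl; [ring | rewrite IHN; ring]. Qed.

Lemma rsum_scal (N : nat) (c : R) (f : nat -> R) : rsum N (fun i => c * f i) = c * rsum N f.
Proof. induction N; simpl; [ring | rewrite IHN; ring]. Qed.

Lemma rsum_zero (N : nat) (f : nat -> R) : (forall i, (i < N)%nat -> f i = 0) -> rsum N f = 0.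
Proof.
  intros H. rewrite (rsum_ext N f (fun _ => 0 * 0)); [|intros; rewrite H by auto; ring].
  rewrite rsum_scal; ring.
Qed.

Lemma rsum_swap (N M : nat) (f : nat -> nat -> R) :
  rsum N (fun i => rsum M (fun j => f i j)) = rsum M (fun j => rsum N (fun i => f i j)).
Proof.
  induction N; simpl; [symmetry; apply rsum_zero; reflexivity|].
  rewrite IHN, rsum_plus. reflexivity.
Qed.

Lemma rsum_single (N m : nat) (f : nat -> R) :
  (m < N)%nat -> (forall i, (i < N)%nat -> i <> m -> f i = 0) -> rsum N f = f m.
Proof.
  induction N; intros Hm Hf; [lia|]. simpl.
  destruct (Nat.eq_dec m N) as [-> | Hne].
  - rewrite rsum_zero; [ring|]. intros; apply Hf; lia.
  - rewrite IHN, (Hf N); [ring | lia | lia | lia | intros; apply Hf; lia].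
Qed.

(** In every case [c i * v (S i)] equals [c (S i) * v (S i)], so the sum telescopes to the two end
    terms. *)
Lemma rsum_by_parts (N : nat) (c v : nat -> R) :
  c 0%nat = 0 -> c N = 0 -> (forall i, (i < N)%nat -> c i <> c (S i) -> v (S i) = 0) ->
  rsum N (fun i => c i * (v (S i) - v i)) = 0.
Proof.
  intros H0 HN Hv.
  assert (E : forall n, (n <= N)%nat -> rsum n (fun i => c i * (v (S i) - v i)) = c n * v n).
  { induction n; intros Hn; simpl; [rewrite H0; ring|]. rewrite IHn by lia.
    destruct (Req_dec (c n) (c (S n))) as [E | E]; [rewrite E; ring|].
    rewrite (Hv n) by (auto; lia). ring. }
  rewrite E, HN by lia. ring.
Qed.

(* The total of [h] and [v], given on the horizontal and vertical edges of an N x N grid,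
   around all cells, the cell (i,j) having weight [c i j]. *)
Definition flux (N : nat) (c h v : nat -> nat -> R) : R :=
  rsum N (fun i => rsum N (fun j => c i j * (h i j + v (S i) j - h i (S j) - v i j))).

Lemma flux_comb (N : nat) (c h v h1 v1 h2 v2 : nat -> nat -> R) (k : R) :
  (forall i j, h i j = k * h1 i j + h2 i j) -> (forall i j, v i j = k * v1 i j + v2 i j) ->
  flux N c h v = k * flux N c h1 v1 + flux N c h2 v2.
Proof.
  intros Hh Hv. unfold flux. rewrite <- rsum_scal, <- rsum_plus.
  apply rsum_ext; intros i _. rewrite <- rsum_scal, <- rsum_plus.
  apply rsum_ext; intros j _. rewrite !Hh, !Hv. ring.
Qed.

Lemma flux_gradient (N : nat) (c g : nat -> nat -> R) :
  flux N c (fun i j => g (S i) j - g i j) (fun i j => g i (S j) - g i j) = 0.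
Proof. apply rsum_zero; intros i _. apply rsum_zero; intros j _. ring. Qed.

(** Vertical edges are summed by parts along rows, horizontal ones along columns. An edge between
    cells of equal weight cancels whatever value it carries. *)
Lemma flux_boundary (N : nat) (c h v : nat -> nat -> R) :
  (forall i, c i 0%nat = 0 /\ c i N = 0 /\ c 0%nat i = 0 /\ c N i = 0) ->
  (forall i j, (i < N)%nat -> (j < N)%nat -> c i j <> c (S i) j -> v (S i) j = 0) ->
  (forall i j, (i < N)%nat -> (j < N)%nat -> c i j <> c i (S j) -> h i (S j) = 0) ->
  flux N c h v = 0.
Proof.
  intros Hc Hv Hh. unfold flux.
  transitivity (rsum N (fun i => rsum N (fun j => c i j * (v (S i) j - v i j))) +
    (-1) * rsum N (fun i => rsum N (fun j => c i j * (h i (S j) - h i j)))).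
  - rewrite <- rsum_scal, <- rsum_plus. apply rsum_ext; intros i _.
    rewrite <- rsum_scal, <- rsum_plus. apply rsum_ext; intros j _. ring.
  - rewrite rsum_swap.
    rewrite (rsum_zero N (fun j => rsum N (fun i => _))).
    + rewrite (rsum_zero N (fun i => rsum N (fun j => _))); [ring|].
      intros i Hi. apply (rsum_by_parts N (c i) (h i)); try apply Hc. intros; apply Hh; auto.
    + intros j Hj. apply (rsum_by_parts N (fun i => c i j) (fun i => v i j)); try apply Hc.
      intros; apply Hv; auto.
Qed.

(** * Fields near a closed curve *)

Lemma period_reduce (L t : R) : 0 < L -> exists k : Z, 0 <= t + IZR k * L < L.
Proof.
  intros HL. exists (- Int_part (t / L))%Z. rewrite opp_IZR.
  destruct (base_Int_part (t / L)) as [H1 H2].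
  assert (E : t = t / L * L) by (field; lra).
  split; rewrite E at 1; nra.
Qed.

Section Curve.
Context (gamma : R -> pt) (L : R).
Hypothesis HL : 0 < L.
Hypothesis Hper : forall t, gamma (t + L) = gamma t.
Hypothesis Hlip : forall s t, Rabs (fst (gamma s) - fst (gamma t)) <= Rabs (s - t) /\
                              Rabs (snd (gamma s) - snd (gamma t)) <= Rabs (s - t).
Hypothesis Hsimple : forall s t, 0 <= s < L -> 0 <= t < L -> gamma s = gamma t -> s = t.

Lemma period_Z (k : Z) (t : R) : gamma (t + IZR k * L) = gamma t.
Proof.
  rewrite (surjective_pairing (gamma t)), (surjective_pairing (gamma (t + _))). f_equal.
  - rewrite (shift_int (fun t => fst (gamma t)) 0 L); [ring | intros; rewrite Hper; ring].
  - rewrite (shift_int (fun t => snd (gamma t)) 0 L); [ring | intros; rewrite Hper; ring].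
Qed.

Lemma near_gamma (s t e : R) : Rabs (s - t) < e -> near e (gamma t) (gamma s).
Proof. intros H. destruct (Hlip s t). split; lra. Qed.

Lemma continuous_gamma (t : R) : continuous gamma t.
Proof.
  apply (continuous_ext (fun t => (fst (gamma t), snd (gamma t)))).
  { intros; symmetry; apply surjective_pairing. }
  apply continuous_pair; apply continuous_R_iff; intros e He; exists e; (split; [auto|]);
    intros y Hy; destruct (Hlip y t); lra.
Qed.

Lemma curve_simple (s t : R) : gamma s = gamma t -> exists k : Z, s - t = IZR k * L.
Proof.
  intros E.
  destruct (period_reduce L s HL) as [i Hi]. destruct (period_reduce L t HL) as [j Hj].
  assert (s + IZR i * L = t + IZR j * L).
  { apply Hsimple; auto. rewrite !period_Z. exact E. }
  exists (j - i)%Z. rewrite minus_IZR. lra.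
Qed.

Lemma curve_uniform (P : R -> R -> Prop) :
  (forall e e' t, 0 < e' <= e -> P e t -> P e' t) ->
  (forall e t k, P e t -> P e (t + IZR k * L)) ->
  (forall t, exists d, 0 < d /\ forall s, Rabs (s - t) < d -> P d s) ->
  exists d, 0 < d /\ forall t, P d t.
Proof.
  intros Hm Hk Hloc.
  destruct (box_uniform L (fun e p => P e (fst p))) as (d & Hd & H).
  - intros; eapply Hm; eauto.
  - intros p _. destruct (Hloc (fst p)) as (d & Hd & H). exists d. split; [auto|].
    intros q Hq. apply H, Hq.
  - exists d. split; [auto|]. intros t. destruct (period_reduce L t HL) as [k Hkt].
    replace t with ((t + IZR k * L) + IZR (- k) * L) by (rewrite opp_IZR; ring).
    apply Hk. apply (H (t + IZR k * L, 0)). split; simpl; lra.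
Qed.

(** Uniform continuity of the inverse of gamma on the circle of parameters modulo L. Around a pair
    of parameters with the same image, the parameters are close modulo L; around any other pair, the
    images stay apart. *)
Lemma curve_inj_uniform (eta : R) : 0 < eta ->
  exists rho, 0 < rho /\ forall s t, near rho (gamma s) (gamma t) ->
    exists k : Z, Rabs (t - s - IZR k * L) < eta.
Proof.
  intros Heta.
  destruct (box_uniform L (fun e p => near e (gamma (fst p)) (gamma (snd p)) ->
    exists k : Z, Rabs (snd p - fst p - IZR k * L) < eta)) as (d & Hd & H).
  - intros e e' q He HP Hn. apply HP. eapply near_le; [|exact Hn]; lra.
  - intros [s t] _.
    destruct (classic (gamma t = gamma s)) as [E | E].
    + exists (eta / 2). split; [lra|]. intros [s' t'] [H1 H2] _; simpl in *.
      destruct (curve_simple _ _ E) as [k Hk]. exists k.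
      apply Rabs_lt_between in H1, H2. apply Rabs_lt_between. lra.
    + set (w := psub (gamma t) (gamma s)).
      assert (Hw : 0 < nrm w) by (apply nrm_pos, psub_neq0, E).
      (* Three displacements below [nrm w / 6] make each coordinate of w smaller than [nrm w / 2],
         against the bound of the norm by the sum of the coordinates. *)
      exists (nrm w / 6). split; [lra|]. intros [s' t'] [H1 H2] Hn; simpl in *. exfalso.
      assert (B : near (nrm w / 2) (gamma s) (gamma t)).
      { replace (nrm w / 2) with (nrm w / 6 + nrm w / 6 + nrm w / 6) by lra.
        apply near_trans with (gamma t'); [apply near_trans with (gamma s')|].
        - apply near_gamma; exact H1.
        - exact Hn.
        - apply near_sym, near_gamma; exact H2. }
      destruct (nrm_bound w) as (_ & _ & C). destruct B as [B1 B2].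
      unfold w, psub in *. simpl fst in C; simpl snd in C. lra.
  - exists d. split; [auto|]. intros s t Hn.
    destruct (period_reduce L s HL) as [i Hi]. destruct (period_reduce L t HL) as [j Hj].
    destruct (H (s + IZR i * L, t + IZR j * L)) as [k Hk].
    + split; simpl; lra.
    + simpl. rewrite !period_Z. exact Hn.
    + simpl in Hk. exists (k + i - j)%Z. rewrite minus_IZR, plus_IZR.
      replace (t - s - (IZR k + IZR i - IZR j) * L) with
        (t + IZR j * L - (s + IZR i * L) - IZR k * L) by ring. exact Hk.
Qed.

Definition turns (f : R -> pt) (om : R) : Prop :=
  exists th, lift f th /\ forall t, th (t + L) = th t + om.

Definition regular_along (F : pt -> pt) : Prop :=
  forall t, F (gamma t) <> (0, 0) /\
    exists d, 0 < d /\ forall q, near d (gamma t) q -> continuous F q.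

(** Chosen without continuity. The factor 4 covers both ends of an edge: the first is within [2 * s]
    of gamma and the second within [2 * s] of the first. *)
Definition tau (s : R) (p : pt) : R := epsilon (inhabits 0) (fun t => near (4 * s) (gamma t) p).

(* Displacement of the parameter from [p] to [p']; its choice does not involve the field. *)
Definition shift (rho s : R) (p p' : pt) : R :=
  epsilon (inhabits 0)
    (fun x => Rabs x < rho /\ gamma (tau s p + x) = gamma (tau s p')).

(** The function [th t - om / L * t] is L-periodic, so its value at [T p] depends only on the point
    [gamma (T p)]; with the small angle from there to p it forms [G]. The bound [rho] is left free
    because [shift] depends on it and has to be the same for all fields to be compared. *)
Lemma darg_near_curve (F : pt -> pt) (om : R) :
  regular_along F -> turns (fun t => F (gamma t)) om ->
  exists r0, 0 < r0 /\ forall rho, 0 < rho <= r0 ->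
  exists s0, 0 < s0 /\ forall s, 0 < s < s0 ->
  exists G : pt -> R, forall p p', (exists t, near (2 * s) (gamma t) p) -> near (2 * s) p p' ->
    darg F p p' = om / L * shift rho s p p' + (G p' - G p).
Proof.
  intros HF (th & Hth & Hom).
  destruct (curve_uniform (fun e t => forall q q', near e (gamma t) q -> near e (gamma t) q' ->
    continuous F q /\ 0 < dot (F q) (F q'))) as (e & He & Hdot).
  - intros e e' t He H q q' Hq Hq'. apply H; eapply near_le; eauto; lra.
  - intros e t k H q q'. rewrite period_Z. apply H.
  - intros t. destruct (HF t) as (Hn & d & Hd & Hc).
    destruct (continuous_dot_pos F (gamma t)) as (d' & Hd' & Hp); [apply Hc, near_refl; auto | auto |].
    exists (Rmin d d' / 2). pose proof (Rmin_l d d'). pose proof (Rmin_r d d').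
    split; [pose proof (Rmin_pos d d' Hd Hd'); lra|]. intros s Hs q q' Hq Hq'.
    apply near_gamma in Hs.
    pose proof (near_trans _ _ _ _ _ Hs Hq) as N1. pose proof (near_trans _ _ _ _ _ Hs Hq') as N2.
    split; [apply Hc; eapply near_le; [|exact N1]; lra | apply Hp; [eapply near_le; [|exact N1] | eapply near_le; [|exact N2]]; lra].
  - exists e. split; [auto|]. intros rho Hrho.
    destruct (curve_inj_uniform rho (proj1 Hrho)) as (r1 & Hr1 & Hinj).
    (* The chosen points of gamma for p and p' are within 4 s + 2 s + 4 s of each other. *)
    exists (Rmin r1 e / 10). split; [pose proof (Rmin_pos r1 e Hr1 He); lra|].
    intros s [Hs0 Hs]. pose proof (Rmin_l r1 e) as M1. pose proof (Rmin_r r1 e) as M2.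
    set (T := tau s).
    exists (fun p => th (T p) - om / L * T p + rel (F (gamma (T p))) (F p)).
    intros p p' [t Ht] Hpp.
    assert (Hp : near (4 * s) (gamma (T p)) p).
    { unfold T, tau. apply epsilon_spec. exists t. eapply near_le; [|exact Ht]; lra. }
    assert (Hp' : near (4 * s) (gamma (T p')) p').
    { unfold T, tau. apply epsilon_spec. exists t. replace (4 * s) with (2 * s + 2 * s) by ring.
      eapply near_trans; eauto. }
    set (x := shift rho s p p').
    assert (Hx : Rabs x < rho /\ gamma (T p + x) = gamma (T p')).
    { unfold x, shift. apply epsilon_spec.
      destruct (Hinj (T p) (T p')) as [k Hk].
      - apply near_le with (4 * s + 2 * s + 4 * s); [lra|].
        eapply near_trans; [eapply near_trans; eauto | apply near_sym; exact Hp'].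
      - exists (T p' - T p - IZR k * L). split; [exact Hk|]. fold T.
        replace (T p + (T p' - T p - IZR k * L)) with (T p' + IZR (- k) * L)
          by (rewrite opp_IZR; ring). apply period_Z. }
    destruct Hx as [Hx1 Hx2].
    (* Reference direction: along the edge and along the arc of gamma of displacement x, all values
       of F have a positive product with z, so every variation is a difference of values of
       [rel z]. *)
    set (z := F (gamma (T p))).
    assert (E1 : darg F p p' = rel z (F p') - rel z (F p)).
    { assert (Hsg : forall t, near e (gamma (T p)) (seg p p' t)).
      { intros u. apply near_le with (4 * s + 2 * s); [lra|]. apply near_trans with p; [exact Hp|].
        destruct Hpp as [P1 P2]. apply Rabs_lt_between in P1, P2. pose proof (clamp_bound u).
        split; unfold seg; simpl; apply Rabs_lt_between; nra. }
      apply darg_half_plane.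
      - intros u. apply (Hdot (T p) _ _ (Hsg u) (Hsg u)).
      - intros u. apply (Hdot (T p)); [apply near_refl; auto | apply Hsg]. }
    assert (E2 : th (T p + x) - th (T p) = rel z (F (gamma (T p'))) ).
    { set (c := fun u => T p + clamp u * x).
      assert (Hcc : forall u, continuous c u).
      { intros u. apply continuous_Rplus; [apply continuous_const|].
        apply continuous_Rmult; [apply continuous_clamp | apply continuous_const]. }
      assert (Hnr : forall u, near e (gamma (T p)) (gamma (c u))).
      { intros u. apply near_gamma. unfold c. pose proof (clamp_bound u).
        replace (T p + clamp u * x - T p) with (clamp u * x) by ring.
        rewrite Rabs_mult, (Rabs_pos_eq (clamp u)) by lra. pose proof (Rabs_pos x). nra. }
      destruct (isarg_ex z (proj1 (HF (T p)))) as [al Hal].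
      pose proof (lift_comp _ _ c Hth Hcc) as L1.
      assert (L2 : lift (fun u => F (gamma (c u))) (fun u => al + rel z (F (gamma (c u))))).
      { apply lift_half_plane; [exact Hal | |].
        - intros u. apply (continuous_comp (fun u => gamma (c u)) F).
          + apply (continuous_comp c gamma); [apply Hcc | apply continuous_gamma].
          + apply (Hdot (T p) _ _ (Hnr u) (Hnr u)).
        - intros u. apply (Hdot (T p)); [apply near_refl; auto | apply Hnr]. }
      pose proof (lift_unique _ _ _ L1 L2 0 1) as U. simpl in U.
      replace (c 0) with (T p) in U by (unfold c; rewrite clamp_id by lra; ring).
      replace (c 1) with (T p + x) in U by (unfold c; rewrite clamp_id by lra; ring).
      fold z in U. rewrite rel_diag, Hx2 in U. lra. }
    assert (E3 : rel z (F p') = rel z (F (gamma (T p'))) + rel (F (gamma (T p'))) (F p')).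
    { assert (N1 : near e (gamma (T p)) (gamma (T p'))).
      { rewrite <- Hx2. apply near_gamma. replace (T p + x - T p) with x by ring. lra. }
      assert (N2 : near e (gamma (T p)) p').
      { apply near_le with (4 * s + 2 * s); [lra|]. eapply near_trans; eauto. }
      apply rel_trans.
      - apply (Hdot (T p)); [apply near_refl; auto | exact N1].
      - apply (Hdot (T p')); [apply near_refl; auto | eapply near_le; [|exact Hp']; lra].
      - apply (Hdot (T p)); [apply near_refl; auto | exact N2]. }
    assert (E4 : th (T p + x) - om / L * (T p + x) = th (T p') - om / L * T p').
    { destruct (curve_simple _ _ Hx2) as [k Hk].
      replace (T p + x) with (T p' + IZR k * L) by lra.
      rewrite (shift_int th om L Hom). field. lra. }
    rewrite E1, E3, <- E2. fold z. lra.
Qed.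
End Curve.

(** * Rotation number of a simple closed curve *)

Lemma turns_parallel (L : R) (f g : R -> pt) (om om' : R) :
  (forall t, crs (f t) (g t) = 0) -> turns L f om -> turns L g om' -> om = om'.
Proof.
  intros Hp (th & Hth & E) (ps & Hps & E').
  pose proof (lift_parallel _ _ _ _ Hth Hps Hp 0 (0 + L)) as U.
  rewrite E, E' in U. lra.
Qed.

Lemma turns_unique (L : R) (f : R -> pt) (om om' : R) :
  turns L f om -> turns L f om' -> om = om'.
Proof. apply turns_parallel. intros; apply crs_diag. Qed.

Lemma turns_ext (L : R) (f g : R -> pt) (om : R) :
  (forall t, f t = g t) -> turns L f om -> turns L g om.
Proof. intros E (th & Hth & H). exists th; split; [|exact H]. exact (lift_ext _ _ _ E Hth). Qed.

Lemma lift_plane_shift (F : pt -> pt) (th : pt -> R) (x y : R) :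
  lift F th -> (forall s t, F (s + x, t + y) = F (s, t)) ->
  exists c, forall s t, th (s + x, t + y) = th (s, t) + c.
Proof.
  intros Hth HF.
  assert (H' : lift F (fun p => th (fst p + x, snd p + y))).
  { apply (lift_ext (fun p => F (fst p + x, snd p + y))).
    - intros [s t]; apply HF.
    - refine (lift_comp F th (fun p : pt => (fst p + x, snd p + y) : pt) Hth _).
      intros [s t]. apply continuous_pair.
      + apply (continuous_Rplus (T := prod_UniformSpace _ _) fst (fun _ => x));
          [apply continuous_fst | apply continuous_const].
      + apply (continuous_Rplus (T := prod_UniformSpace _ _) snd (fun _ => y));
          [apply continuous_snd | apply continuous_const]. }
  exists (th (0 + x, 0 + y) - th (0, 0)). intros s t.
  pose proof (lift_plane_unique _ _ _ Hth H' (0, 0) (s, t)) as E. simpl in E. lra.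
Qed.

Lemma turns_exists (L : R) (f : R -> pt) :
  (forall t, continuous f t) -> (forall t, f t <> (0, 0)) -> (forall t, f (t + L) = f t) ->
  exists om, turns L f om.
Proof.
  intros Hc Hn Hp. destruct (lift_line f Hc Hn) as [th Hth].
  exists (th (0 + L) - th 0), th. split; [exact Hth|]. intros t.
  assert (H' : lift f (fun t => th (t + L))).
  { apply (lift_ext (fun t => f (t + L))); [exact Hp|].
    refine (lift_comp f th (fun t => t + L) Hth _). intros u.
    apply (continuous_Rplus (T := R_UniformSpace)); [apply continuous_id | apply continuous_const]. }
  pose proof (lift_unique _ _ _ Hth H' 0 t) as E. simpl in E. lra.
Qed.

(** A lift over the plane changes by one and the same constant under translation by L, whatever the
    stage l. *)
Lemma turns_homotopy (L : R) (H : R -> R -> pt) (om om' : R) :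
  (forall p, continuous (fun p : pt => H (fst p) (snd p)) p) ->
  (forall t l, 0 <= l <= 1 -> H t l <> (0, 0)) ->
  (forall t l, H (t + L) l = H t l) ->
  turns L (fun t => H t 0) om -> turns L (fun t => H t 1) om' -> om = om'.
Proof.
  intros Hc Hn Hp T0 T1.
  assert (Cc : forall p : pt, continuous (fun p : pt => (fst p, clamp (snd p)) : pt) p).
  { intros [s t]. apply continuous_pair; [apply continuous_fst|].
    apply (continuous_comp snd clamp); [apply continuous_snd | apply continuous_clamp]. }
  destruct (lift_plane (fun p => H (fst p) (clamp (snd p)))) as [th Hth].
  - intros p. apply (continuous_comp (fun p : pt => (fst p, clamp (snd p)) : pt)
      (fun p : pt => H (fst p) (snd p))); [apply Cc | apply Hc].
  - intros p. apply Hn, clamp_bound.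
  - destruct (lift_plane_shift _ _ L 0 Hth) as [c Hcst].
    { intros s t; simpl. rewrite Hp, Rplus_0_r. reflexivity. }
    assert (K : forall l, 0 <= l <= 1 -> turns L (fun t => H t l) c).
    { intros l Hl. exists (fun t => th (t, l)). split.
      - apply (lift_ext (fun t => H t (clamp l))); [intros; rewrite clamp_id by auto; reflexivity|].
        refine (lift_comp (fun p : pt => H (fst p) (clamp (snd p))) th (fun t : R => (t, l) : pt) Hth _).
        intros t. apply continuous_pair; [apply continuous_id | apply continuous_const].
      - intros t. pose proof (Hcst t l) as E. rewrite Rplus_0_r in E. exact E. }
    rewrite (turns_unique _ _ _ _ T0 (K 0 ltac:(lra))).
    apply (turns_unique _ _ _ _ (K 1 ltac:(lra)) T1).
Qed.

Section Tube.
Context (gamma T : R -> pt) (L K : R).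
Hypothesis HL : 0 < L.
Hypothesis Hper : forall t, gamma (t + L) = gamma t.
Hypothesis HTper : forall t, T (t + L) = T t.
Hypothesis Hsimple : forall s t, 0 <= s < L -> 0 <= t < L -> gamma s = gamma t -> s = t.
Hypothesis HT1 : forall t, is_derive (fun u => fst (gamma u)) t (fst (T t)).
Hypothesis HT2 : forall t, is_derive (fun u => snd (gamma u)) t (snd (T t)).
Hypothesis Hunit : forall t, fst (T t) ^ 2 + snd (T t) ^ 2 = 1.
Hypothesis HK : 0 < K.
Hypothesis HTlip : forall s t, Rabs (fst (T s) - fst (T t)) <= K * Rabs (s - t) /\
                               Rabs (snd (T s) - snd (T t)) <= K * Rabs (s - t).

Lemma unit_bound (t : R) : -1 <= fst (T t) <= 1 /\ -1 <= snd (T t) <= 1.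
Proof. pose proof (Hunit t). split; split; nra. Qed.

Lemma mean_value (f f' : R -> R) (s t : R) : (forall x, is_derive f x (f' x)) ->
  exists c, Rabs (c - s) <= Rabs (t - s) /\ f t - f s = f' c * (t - s).
Proof.
  intros Hf. destruct (MVT_gen f s t f') as (c & Hc & E).
  - intros; apply Hf.
  - intros x _. apply continuity_pt_filterlim, (ex_derive_continuous f x). eexists; apply Hf.
  - exists c. split; [|exact E]. revert Hc. unfold Rmin, Rmax. destruct (Rle_dec s t); intros Hc.
    + rewrite !Rabs_pos_eq; lra.
    + rewrite !Rabs_left1; lra.
Qed.

Lemma gamma_lip (s t : R) : Rabs (fst (gamma s) - fst (gamma t)) <= Rabs (s - t) /\
                            Rabs (snd (gamma s) - snd (gamma t)) <= Rabs (s - t).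
Proof.
  split.
  - destruct (mean_value _ _ t s HT1) as (c & _ & E). rewrite E, Rabs_mult.
    pose proof (Rabs_pos (s - t)). destruct (unit_bound c) as [B _].
    assert (Rabs (fst (T c)) <= 1) by (apply Rabs_le; lra). nra.
  - destruct (mean_value _ _ t s HT2) as (c & _ & E). rewrite E, Rabs_mult.
    pose proof (Rabs_pos (s - t)). destruct (unit_bound c) as [_ B].
    assert (Rabs (snd (T c)) <= 1) by (apply Rabs_le; lra). nra.
Qed.

(** The tangent after a positive quarter turn: inward or outward according to the orientation of
    gamma. The sign of a in [off] absorbs the ambiguity. *)
Definition nu (t : R) : pt := (- snd (T t), fst (T t)).

Definition off (a t : R) : pt :=
  (fst (gamma t) + a * fst (nu t), snd (gamma t) + a * snd (nu t)).

Lemma nu_per (t : R) : nu (t + L) = nu t.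
Proof. unfold nu. rewrite HTper. reflexivity. Qed.

Lemma T_per_Z (k : Z) (t : R) : T (t + IZR k * L) = T t.
Proof. apply (period_Z T L HTper). Qed.

Lemma continuous_T (t : R) : continuous T t.
Proof.
  apply (continuous_ext (fun t => (fst (T t), snd (T t)))).
  { intros; symmetry; apply surjective_pairing. }
  apply continuous_pair; apply continuous_R_iff; intros e He; exists (e / K);
    (split; [apply Rdiv_lt_0_compat; auto|]); intros y Hy; destruct (HTlip y t);
    apply Rlt_div_r in Hy; lra.
Qed.

Lemma continuous_nu (t : R) : continuous nu t.
Proof.
  apply continuous_pair; [apply continuous_Ropp; apply continuous_pt_snd | apply continuous_pt_fst];
    apply continuous_T.
Qed.

Lemma continuous_off (a t : R) : continuous (off a) t.
Proof.
  pose proof (continuous_gamma gamma gamma_lip t) as Hg. pose proof (continuous_nu t) as Hnu.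
  apply continuous_pair; apply continuous_Rplus;
    [apply continuous_pt_fst | apply continuous_Rmult
    | apply continuous_pt_snd | apply continuous_Rmult]; auto;
    try apply continuous_const; [apply continuous_pt_fst | apply continuous_pt_snd]; auto.
Qed.

(** The scalar product of the relation with [T s] eliminates b and leaves [(t - s) * w = a * v],
    where w is at least 3/4 and v at most 2 K |t - s| in absolute value. With |a| at most 1 / (8 K)
    the right side is at most |t - s| / 4, which forces t = s. *)
Lemma tube_close (s t a b : R) :
  Rabs (t - s) <= / (8 * K) -> Rabs a <= / (8 * K) ->
  fst (gamma t) - fst (gamma s) + a * fst (nu t) + b * fst (nu s) = 0 ->
  snd (gamma t) - snd (gamma s) + a * snd (nu t) + b * snd (nu s) = 0 -> t = s.
Proof.
  intros Hts Ha E1 E2. unfold nu in E1, E2; simpl in E1, E2.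
  destruct (mean_value _ _ s t HT1) as (c1 & C1 & M1).
  destruct (mean_value _ _ s t HT2) as (c2 & C2 & M2).
  rewrite M1 in E1. rewrite M2 in E2.
  destruct (HTlip c1 s) as [L1 _]. destruct (HTlip c2 s) as [_ L2].
  destruct (HTlip t s) as [L3 L4].
  destruct (unit_bound s) as [B1 B2]. pose proof (Hunit s) as Hu.
  set (d := Rabs (t - s)) in *.
  assert (HKi : K * / (8 * K) = / 8) by (field; lra).
  assert (Hd0 : 0 <= d) by apply Rabs_pos.
  assert (HKd : K * d <= / 8) by (rewrite <- HKi; apply Rmult_le_compat_l; lra).
  assert (G1 : Rabs (fst (T c1) - fst (T s)) <= / 8)
    by (eapply Rle_trans; [exact L1|]; eapply Rle_trans; [|exact HKd]; apply Rmult_le_compat_l; lra).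
  assert (G2 : Rabs (snd (T c2) - snd (T s)) <= / 8)
    by (eapply Rle_trans; [exact L2|]; eapply Rle_trans; [|exact HKd]; apply Rmult_le_compat_l; lra).
  set (p := fst (T s)) in *. set (q := snd (T s)) in *.
  set (w := fst (T c1) * p + snd (T c2) * q).
  assert (Hw : 3 / 4 <= w).
  { unfold w. apply Rabs_le_between in G1, G2.
    replace (fst (T c1) * p + snd (T c2) * q) with
      (1 + (fst (T c1) - p) * p + (snd (T c2) - q) * q) by (rewrite <- Hu; ring).
    assert (- / 8 <= (fst (T c1) - p) * p) by nra.
    assert (- / 8 <= (snd (T c2) - q) * q) by nra. lra. }
  set (v := (snd (T t) - q) * p - (fst (T t) - p) * q).
  assert (Hv : Rabs v <= 2 * (K * d)).
  { unfold v. eapply Rle_trans; [apply Rabs_triang|]. rewrite Rabs_Ropp, !Rabs_mult.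
    assert (Rabs p <= 1) by (apply Rabs_le; lra). assert (Rabs q <= 1) by (apply Rabs_le; lra).
    pose proof (Rabs_pos p). pose proof (Rabs_pos q).
    pose proof (Rabs_pos (snd (T t) - q)). pose proof (Rabs_pos (fst (T t) - p)). nra. }
  assert (E : (t - s) * w = a * v).
  { unfold w, v.
    assert (Z : (fst (T c1) * (t - s) + a * - snd (T t) + b * - q) * p +
      (snd (T c2) * (t - s) + a * fst (T t) + b * p) * q = 0) by (rewrite E1, E2; ring).
    lra. }
  assert (F : d * w <= / (8 * K) * (2 * (K * d))).
  { unfold d at 1. rewrite <- (Rabs_pos_eq w) by lra. rewrite <- Rabs_mult, E, Rabs_mult.
    apply Rmult_le_compat; auto using Rabs_pos. }
  replace (/ (8 * K) * (2 * (K * d))) with (d / 4) in F by (field; lra).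
  assert (d = 0) by nra.
  unfold d in H. destruct (Req_dec (t - s) 0) as [X | X]; [lra|].
  pose proof (Rabs_pos_lt _ X). lra.
Qed.

(** Two offsets are allowed in order to cover both the intersection of gamma with a parallel curve
    (b = 0) and the intermediate vectors of the homotopy in [rotation_number]. Uniform injectivity
    of gamma reduces the claim to close parameters. *)
Lemma tube_injective :
  exists d, 0 < d /\ forall s t a b, Rabs a <= d -> Rabs b <= d ->
    fst (gamma t) - fst (gamma s) + a * fst (nu t) + b * fst (nu s) = 0 ->
    snd (gamma t) - snd (gamma s) + a * snd (nu t) + b * snd (nu s) = 0 ->
    exists k : Z, t - s = IZR k * L.
Proof.
  assert (HKi : 0 < / (8 * K)) by (apply Rinv_0_lt_compat; lra).
  destruct (curve_inj_uniform gamma L HL Hper gamma_lip Hsimple _ HKi) as (rho & Hrho & Hinj).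
  (* The two offsets together move each coordinate by at most 2 rho / 3, less than the rho of
     uniform injectivity. *)
  exists (Rmin (rho / 3) (/ (8 * K))). split; [apply Rmin_pos; lra|].
  intros s t a b Ha Hb E1 E2.
  pose proof (Rmin_l (rho / 3) (/ (8 * K))) as M1. pose proof (Rmin_r (rho / 3) (/ (8 * K))) as M2.
  assert (G : forall u v, -1 <= u <= 1 -> -1 <= v <= 1 -> Rabs (- (a * u + b * v)) < rho).
  { intros u v Hu Hv. rewrite Rabs_Ropp. eapply Rle_lt_trans; [apply Rabs_triang|]. rewrite !Rabs_mult.
    assert (Rabs u <= 1) by (apply Rabs_le; lra). assert (Rabs v <= 1) by (apply Rabs_le; lra).
    pose proof (Rabs_pos a). pose proof (Rabs_pos b). nra. }
  destruct (unit_bound s) as [B1 B2]. destruct (unit_bound t) as [B3 B4].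
  destruct (Hinj s t) as [k Hk].
  - split.
    + replace (fst (gamma t) - fst (gamma s)) with (- (a * fst (nu t) + b * fst (nu s))) by lra.
      apply G; unfold nu; simpl; lra.
    + replace (snd (gamma t) - snd (gamma s)) with (- (a * snd (nu t) + b * snd (nu s))) by lra.
      apply G; unfold nu; simpl; lra.
  - exists k.
    assert (Ek : forall u, gamma (u + IZR (- k) * L) = gamma u) by (intros; apply period_Z; auto).
    assert (Et : T (t + IZR (- k) * L) = T t) by apply T_per_Z.
    assert (X : t + IZR (- k) * L = s); [|rewrite opp_IZR in X; lra].
    apply (tube_close s _ a b).
    + rewrite opp_IZR. replace (t + - IZR k * L - s) with (t - s - IZR k * L) by ring. lra.
    + lra.
    + rewrite Ek. unfold nu in *. rewrite Et. exact E1.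
    + rewrite Ek. unfold nu in *. rewrite Et. exact E2.
Qed.

(* Lifting [gamma s - off a t] to the (s,t)-plane, the variation along the diagonal, where this
   vector is [- a nu], is the sum of those in [s] and in [t]; moving [off a] back onto [gamma]
   exchanges the latter for the winding number around a point on the other side. *)
Lemma rotation_number :
  exists d, 0 < d /\ forall a, 0 < Rabs a <= d ->
    (forall s t, gamma s <> off a t) /\
    forall om al al' t1 t2, turns L nu om ->
      turns L (fun s => psub (gamma s) (off a t1)) al ->
      turns L (fun s => psub (gamma s) (off (- a) t2)) al' -> om = al + al'.
Proof.
  destruct tube_injective as (d & Hd & Hinj). exists d. split; [exact Hd|]. intros a [Ha0 Had].
  assert (Hnz : forall c t, c * fst (nu t) = 0 -> c * snd (nu t) = 0 -> c = 0).
  { intros c t H1 H2. unfold nu in *; cbn [fst snd] in *. pose proof (Hunit t).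
    assert (c * (fst (T t) ^ 2 + snd (T t) ^ 2) = 0).
    { transitivity ((c * fst (T t)) * fst (T t) - (c * - snd (T t)) * snd (T t)); [ring|].
      rewrite H1, H2; ring. }
    rewrite H in H0. lra. }
  assert (Hk : forall s t (k : Z), t - s = IZR k * L -> gamma t = gamma s /\ nu t = nu s).
  { intros s t k E. replace t with (s + IZR k * L) by lra. split; [apply period_Z; auto|].
    unfold nu. rewrite T_per_Z. reflexivity. }
  assert (Hno : forall a s t, 0 < Rabs a <= d -> gamma s <> off a t).
  { intros b s t [Hb0 Hb] E. unfold off in E.
    pose proof (f_equal fst E) as E1. pose proof (f_equal snd E) as E2. cbn [fst snd] in E1, E2.
    destruct (Hinj s t b 0 Hb) as [k Hkk]; [rewrite Rabs_R0; lra | lra | lra|].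
    destruct (Hk _ _ _ Hkk) as [G _]. rewrite <- G in E1, E2.
    rewrite (Hnz b t), Rabs_R0 in Hb0; lra. }
  split; [intros; apply Hno; auto|].
  intros om al al' t1 t2 Hom Hal Hal'.
  assert (Cg : forall t, continuous gamma t) by (apply continuous_gamma, gamma_lip).
  destruct (lift_plane (fun p => psub (gamma (fst p)) (off a (snd p)))) as [th Hth].
  { intros p. apply (continuous_psub (T := prod_UniformSpace _ _)
      (fun p => gamma (fst p)) (fun p => off a (snd p))).
    - apply (continuous_comp fst gamma); [destruct p; apply continuous_fst | apply Cg].
    - apply (continuous_comp snd (off a)); [destruct p; apply continuous_snd | apply continuous_off]. }
  { intros p. apply psub_neq0, Hno; auto. }
  assert (Hoff : forall t, off a (t + L) = off a t).
  { intros t. unfold off. rewrite Hper, nu_per. reflexivity. }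
  destruct (lift_plane_shift _ _ L 0 Hth) as [c1 Hc1].
  { intros s t; simpl. rewrite Hper, Rplus_0_r. reflexivity. }
  destruct (lift_plane_shift _ _ 0 L Hth) as [c2 Hc2].
  { intros s t; simpl. rewrite Hoff, Rplus_0_r. reflexivity. }
  assert (Hc1' : forall s t : R, th (s + L, t) = th (s, t) + c1).
  { intros s t. rewrite <- Hc1, Rplus_0_r. reflexivity. }
  assert (Hc2' : forall s t : R, th (s, t + L) = th (s, t) + c2).
  { intros s t. rewrite <- Hc2, Rplus_0_r. reflexivity. }
  assert (LC : forall u v : R -> R, (forall t, continuous u t) -> (forall t, continuous v t) ->
    lift (fun t => psub (gamma (u t)) (off a (v t))) (fun t => th (u t, v t))).
  { intros u v Hu Hv.
    refine (lift_comp (fun p : pt => psub (gamma (fst p)) (off a (snd p))) th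
      (fun t : R => (u t, v t) : pt) Hth _).
    intros t; apply continuous_pair; auto. }
  assert (A1 : al = c1).
  { apply (turns_unique _ _ _ _ Hal). exists (fun s => th (s, t1)). split; [|intros; apply Hc1'].
    apply (LC (fun s => s) (fun _ => t1)); intros; [apply continuous_id | apply continuous_const]. }
  assert (A2 : om = c1 + c2).
  { apply (turns_parallel L nu (fun t => psub (gamma t) (off a t))); [|exact Hom|].
    - intros t. unfold off, psub, crs, nu. cbn [fst snd].
      generalize (fst (gamma t)) (snd (gamma t)) (fst (T t)) (snd (T t)). intros; ring.
    - exists (fun t => th (t, t)). split; [|intros t; change (th (t + L, t + L) = th (t, t) + (c1 + c2)); rewrite Hc1', Hc2'; ring].
      apply (LC (fun t => t) (fun t => t)); intros; apply continuous_id. }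
  assert (A3 : c2 = al'); [|lra].
  (* From [off a t - gamma t2] at l = 0 to [gamma t - off (- a) t2] at l = 1. By [tube_injective] a
     zero requires t = t2 modulo L, and there the vector is [a] times the normal at t2 for every
     l. *)
  set (H := fun t l =>
    (fst (gamma t) - (fst (gamma t2) - l * a * fst (nu t2)) + (1 - l) * a * fst (nu t),
     snd (gamma t) - (snd (gamma t2) - l * a * snd (nu t2)) + (1 - l) * a * snd (nu t)) : pt).
  apply (turns_homotopy L H).
  - assert (Cs : forall p : pt, continuous (fun q : pt => snd q) p) by (intros []; apply continuous_snd).
    assert (Cf : forall (g : R -> R) (p : pt), (forall t, continuous g t) -> continuous (fun q : pt => g (fst q)) p).
    { intros g p Hg. apply (continuous_comp fst g); [destruct p; apply continuous_fst | apply Hg]. }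
    assert (C : forall (g h : R -> R) (b c : R) (p : pt), (forall t, continuous g t) ->
      (forall t, continuous h t) ->
      continuous (fun q : pt => g (fst q) - (b - snd q * a * c) + (1 - snd q) * a * h (fst q)) p).
    { intros g h b c p Hg Hh.
      apply (continuous_Rplus (T := prod_UniformSpace _ _)); [|apply continuous_Rmult; [|apply Cf, Hh]].
      - apply (continuous_Rminus (T := prod_UniformSpace _ _)); [apply Cf, Hg|].
        apply (continuous_Rminus (T := prod_UniformSpace _ _)); [apply continuous_const|].
        apply (continuous_Rmult (T := prod_UniformSpace _ _)); [|apply continuous_const].
        apply (continuous_Rmult (T := prod_UniformSpace _ _)); [apply Cs | apply continuous_const].
      - apply (continuous_Rmult (T := prod_UniformSpace _ _)); [|apply continuous_const].
        apply (continuous_Rminus (T := prod_UniformSpace _ _)); [apply continuous_const | apply Cs]. }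
    intros p. apply continuous_pair.
    + apply (C (fun t => fst (gamma t)) (fun t => fst (nu t))); intros t;
        [apply continuous_pt_fst, Cg | apply continuous_pt_fst, continuous_nu].
    + apply (C (fun t => snd (gamma t)) (fun t => snd (nu t))); intros t;
        [apply continuous_pt_snd, Cg | apply continuous_pt_snd, continuous_nu].
  - intros t l Hl E. unfold H, off in E. cbn [fst snd] in E.
    pose proof (f_equal fst E) as E1. pose proof (f_equal snd E) as E2. cbn [fst snd] in E1, E2.
    assert (B : forall c, 0 <= c <= 1 -> Rabs (c * a) <= d).
    { intros c Hc. rewrite Rabs_mult, Rabs_pos_eq by lra. nra. }
    destruct (Hinj t2 t ((1 - l) * a) (l * a)) as [k Hkk];
      [apply B; lra | apply B; lra | lra | lra |].
    destruct (Hk _ _ _ Hkk) as [G1 G2]. rewrite G1, G2 in E1, E2.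
    rewrite (Hnz a t2), Rabs_R0 in Ha0; lra.
  - intros t l. unfold H. rewrite Hper, nu_per. reflexivity.
  - assert (B0 : turns L (fun t => psub (gamma t2) (off a t)) c2).
    { exists (fun t => th (t2, t)). split; [|intros; apply Hc2'].
      apply (LC (fun _ => t2) (fun t => t)); intros; [apply continuous_const | apply continuous_id]. }
    (* The homotopy starts at the opposite of the vector lifted by [ps]. *)
    destruct B0 as (ps & Hps & Eps). exists (fun t => ps t + PI). split.
    + intros t. destruct (Hps t) as [P1 (r & Hr & P2)]. split.
      * apply (continuous_Rplus (T := R_UniformSpace) ps (fun _ => PI)); [exact P1 | apply continuous_const].
      * exists r. split; [exact Hr|]. rewrite neg_cos, neg_sin.
        pose proof (f_equal fst P2) as Q1. pose proof (f_equal snd P2) as Q2.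
        unfold psub, off in Q1, Q2. cbn [fst snd] in Q1, Q2. unfold H.
        f_equal; lra.
    + intros t. rewrite Eps. ring.
  - apply (turns_ext L (fun s => psub (gamma s) (off (- a) t2))); [|exact Hal'].
    intros t. unfold H, psub, off. unfold nu; cbn [fst snd]. f_equal; ring.
Qed.
End Tube.

(** * Iterated derivatives along the boundary *)

Lemma dist2_near (p q : pt) (e : R) : dist2 q p < e -> near e p q.
Proof.
  intros H. apply near_nrm. rewrite nrm_eq. exact H.
Qed.

Lemma near_dist2 (p q : pt) (e : R) : near e p q -> dist2 q p < 2 * e.
Proof.
  intros [H1 H2]. destruct (nrm_bound (psub q p)) as (_ & _ & B). rewrite nrm_eq in B.
  unfold psub in B; simpl fst in B; simpl snd in B. unfold dist2. lra.
Qed.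

Lemma interior2_near (D : pt -> Prop) (p : pt) :
  interior2 D p <-> exists d, 0 < d /\ forall q, near d p q -> D q.
Proof.
  split; intros (d & Hd & H).
  - exists (d / 2). split; [lra|]. intros q Hq. apply H. apply near_dist2 in Hq. lra.
  - exists d. split; [auto|]. intros q Hq. apply H, dist2_near, Hq.
Qed.

Lemma locally_near (P : pt -> Prop) (p : pt) (d : R) :
  0 < d -> (forall q, near d p q -> P q) -> locally p P.
Proof. intros Hd H. exists (mkposreal d Hd). intros q Hq. apply H, Hq. Qed.

Section Smooth.
Context (U : pt -> Prop).
Hypothesis HU : open2 U.

Lemma open_near (p : pt) : U p -> exists d, 0 < d /\ forall q, near d p q -> U q.
Proof. intros Hp. apply interior2_near, HU, Hp. Qed.

Lemma pd_ext_on (b : bool) (f g : pt -> R) (p : pt) :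
  (forall q, U q -> f q = g q) -> U p -> pd b f p = pd b g p.
Proof.
  intros E Hp. destruct (open_near p Hp) as (d & Hd & H).
  destruct b; apply Derive_ext_loc; exists (mkposreal d Hd); intros y Hy; apply E, H;
    split; simpl; try exact Hy; rewrite Rminus_diag, Rabs_R0; exact Hd.
Qed.

Lemma iter_pd_app (u w : list bool) (f : pt -> R) : iter_pd (u ++ w) f = iter_pd u (iter_pd w f).
Proof. apply fold_right_app. Qed.

Lemma smooth_iter_pd (w : list bool) (f : pt -> R) : smooth_on U f -> smooth_on U (iter_pd w f).
Proof. intros Hf u p Hp. rewrite <- iter_pd_app. apply Hf, Hp. Qed.

Lemma chain_rule (f : pt -> R) (c1 c2 : R -> R) (t l1 l2 : R) :
  smooth_on U f -> U (c1 t, c2 t) -> is_derive c1 t l1 -> is_derive c2 t l2 ->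
  is_derive (fun u => f (c1 u, c2 u)) t
    (pd true f (c1 t, c2 t) * l1 + pd false f (c1 t, c2 t) * l2).
Proof.
  intros Hf Hp H1 H2. apply is_derive_Reals.
  apply (derivable_pt_lim_comp_2d (fun x y => f (x, y)) c1 c2); [|apply is_derive_Reals, H1 | apply is_derive_Reals, H2].
  apply filterdiff_differentiable_pt_lim.
  apply (filterdiff_ext_lin _ (fun u : R * R => plus (scal (fst u) (pd true f (c1 t, c2 t)))
    (scal (snd u) (pd false f (c1 t, c2 t))))); [|intros; reflexivity].
  apply (is_derive_filterdiff (fun x y => f (x, y)) _ _ (fun x y => pd true f (x, y))).
  - destruct (open_near _ Hp) as (d & Hd & H). apply (locally_near _ _ d Hd).
    intros [x y] Hq. apply Derive_correct. apply (Hf nil (x, y)), H, Hq.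
  - apply Derive_correct. apply (Hf nil _ Hp).
  - apply (continuous_ext (pd true f)); [intros []; reflexivity|].
    apply (Hf (true :: nil) _ Hp).
Qed.

Lemma pd_comm (f : pt -> R) (p : pt) : smooth_on U f -> U p ->
  pd true (pd false f) p = pd false (pd true f) p.
Proof.
  intros Hf Hp. destruct p as [x y].
  assert (C : forall w, continuity_2d_pt (fun u v => iter_pd w f (u, v)) x y).
  { intros w. apply continuity_2d_pt_filterlim.
    apply (filterlim_ext (iter_pd w f)); [intros []; reflexivity|]. apply (Hf w _ Hp). }
  unfold pd; simpl.
  apply (Schwarz (fun u v => f (u, v)) x y).
  - apply locally_2d_locally. destruct (open_near _ Hp) as (d & Hd & H).
    apply (locally_near _ _ d Hd). intros [u v] Hq. apply H in Hq. simpl.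
    repeat split.
    + apply (Hf nil _ Hq).
    + apply (Hf nil _ Hq).
    + apply (Hf (false :: nil) _ Hq).
    + apply (Hf (true :: nil) _ Hq).
  - apply (C (true :: false :: nil)).
  - apply (C (false :: true :: nil)).
Qed.

Lemma iter_pd_swap (f : pt -> R) (u w : list bool) (a b : bool) (p : pt) : smooth_on U f -> U p ->
  iter_pd (u ++ a :: b :: w) f p = iter_pd (u ++ b :: a :: w) f p.
Proof.
  intros Hf. revert p. induction u as [|e u IH]; intros p Hp.
  - simpl. destruct a, b; try reflexivity.
    + apply pd_comm; auto using smooth_iter_pd.
    + symmetry; apply pd_comm; auto using smooth_iter_pd.
  - simpl. apply pd_ext_on; auto.
Qed.

End Smooth.

(** * Symmetric tensors in two variables *)

Section Words.
Context (N1 N2 : R).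

Definition ncomp (b : bool) : R := if b then N1 else N2.

(** The components of the tensor power of (N1, N2), a word being a multi-index. *)
Fixpoint nword (w : list bool) : R :=
  match w with nil => 1 | b :: w => ncomp b * nword w end.

(** The tensor A with (N1, N2) inserted into j slots in front of the fixed indices w. *)
Fixpoint contract (A : list bool -> R) (j : nat) (w : list bool) : R :=
  match j with
  | O => A w
  | S j => N1 * contract A j (true :: w) + N2 * contract A j (false :: w)
  end.

Lemma contract_shift (A : list bool -> R) (j : nat) (w : list bool) :
  contract (fun w => N1 * A (true :: w) + N2 * A (false :: w)) j w = contract A (S j) w.
Proof. revert w. induction j; intros w; [reflexivity|]. simpl in *. rewrite !IHj. reflexivity. Qed.

Lemma contract_swap (A : list bool -> R) (a b : bool) (w : list bool) :
  (forall u, A (u ++ a :: b :: w) = A (u ++ b :: a :: w)) ->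
  forall j u, contract A j (u ++ a :: b :: w) = contract A j (u ++ b :: a :: w).
Proof.
  intros E. induction j; intros u; simpl; [apply E|].
  pose proof (IHj (true :: u)) as E1. pose proof (IHj (false :: u)) as E2.
  simpl in E1, E2. rewrite E1, E2. reflexivity.
Qed.

(* A symmetric tensor vanishing when contracted with a vector orthogonal to the unit vector [N]
   is a multiple of the power of [N]. *)
Lemma symmetric_tensor_power (A : list bool -> R) (k : nat) :
  N1 ^ 2 + N2 ^ 2 = 1 ->
  (forall a b u w, A (u ++ a :: b :: w) = A (u ++ b :: a :: w)) ->
  (forall w, S (length w) = k -> N2 * A (true :: w) - N1 * A (false :: w) = 0) ->
  forall w, length w = k -> A w = nword w * contract A k nil.
Proof.
  intros HN Hs H0.
  (* Orthogonality survives contraction: by symmetry the slot to be contracted is moved past the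
     slot that is tested. *)
  assert (O : forall j w, (j + S (length w))%nat = k ->
    N2 * contract A j (true :: w) - N1 * contract A j (false :: w) = 0).
  { induction j; intros w Hw; simpl in *; [apply H0; lia|].
    pose proof (IHj (true :: w) ltac:(simpl; lia)) as E1.
    pose proof (IHj (false :: w) ltac:(simpl; lia)) as E2.
    pose proof (contract_swap A true false w (fun u => Hs _ _ u _) j nil) as E3. simpl in E3.
    rewrite E3 in E2 |- *.
    transitivity (N1 * (N2 * contract A j (true :: true :: w) - N1 * contract A j (false :: true :: w)) +
      N2 * (N2 * contract A j (false :: true :: w) - N1 * contract A j (false :: false :: w))); [ring|].
    rewrite E1, E2. ring. }
  assert (G : forall w j, (j + length w)%nat = k -> contract A j w = nword w * contract A k nil).
  { induction w as [|b w IH]; intros j Hj; simpl in Hj.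
    - replace j with k by lia. simpl. ring.
    - simpl. rewrite Rmult_assoc, <- (IH (S j)) by lia. simpl.
      pose proof (O j w Hj) as E.
      (* The vector (x, y) is decomposed along the unit vector and its perpendicular; [E] says that
         the perpendicular component is zero. *)
      set (x := contract A j (true :: w)) in *. set (y := contract A j (false :: w)) in *.
      destruct b; simpl.
      + fold x. transitivity (x * (N1 ^ 2 + N2 ^ 2)); [rewrite HN; ring|].
        transitivity (N1 * (N1 * x + N2 * y) + N2 * (N2 * x - N1 * y)); [ring | rewrite E; ring].
      + fold y. transitivity (y * (N1 ^ 2 + N2 ^ 2)); [rewrite HN; ring|].
        transitivity (N2 * (N1 * x + N2 * y) - N1 * (N2 * x - N1 * y)); [ring | rewrite E; ring]. }
  intros w Hw. apply (G w 0%nat). simpl; exact Hw.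
Qed.

End Words.

(** * The iterated operator as a combination of partial derivatives *)

Section Operator.
Context (U : pt -> Prop) (H : pt -> R).
Hypothesis HU : open2 U.
Hypothesis HH : smooth_on U H.

(** A list of weighted words stands for a formal polynomial in the two derivations. Evaluating the
    same list on the derivatives of H and on [nword] transfers the expansion of a complex power to
    V_n. *)
Definition ev (F : list bool -> R) (l : list (R * list bool)) : R :=
  fold_right (fun cw s => fst cw * F (snd cw) + s) 0 l.

Lemma ev_app (F : list bool -> R) (l l' : list (R * list bool)) : ev F (l ++ l') = ev F l + ev F l'.
Proof. induction l; simpl; [ring | rewrite IHl; ring]. Qed.

Definition push (c : R) (b : bool) (l : list (R * list bool)) : list (R * list bool) :=
  map (fun cw => (c * fst cw, b :: snd cw)) l.

Lemma ev_push (F : list bool -> R) (c : R) (b : bool) (l : list (R * list bool)) :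
  ev F (push c b l) = c * ev (fun w => F (b :: w)) l.
Proof. induction l; simpl; [ring | rewrite IHl; ring]. Qed.

Definition evH (l : list (R * list bool)) (q : pt) : R := ev (fun w => iter_pd w H q) l.

Lemma pd_evH (b : bool) (l : list (R * list bool)) (p : pt) : U p ->
  pd b (evH l) p = ev (fun w => iter_pd (b :: w) H p) l.
Proof.
  intros Hp.
  assert (E : is_derive (fun t => evH l (if b then (t, snd p) else (fst p, t)))
    (if b then fst p else snd p) (ev (fun w => iter_pd (b :: w) H p) l)).
  { induction l as [|[c w] l IH]; simpl.
    - apply (is_derive_const 0).
    - unfold evH; simpl. apply @is_derive_plus; [|exact IH].
      apply is_derive_scal.
      + destruct b; apply Derive_correct; apply (HH w p Hp). }
  destruct b; apply (is_derive_unique _ _ _ E).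
Qed.

Lemma continuous_evH (l : list (R * list bool)) (p : pt) : U p -> continuous (evH l) p.
Proof.
  intros Hp. induction l as [|[c w] l IH]; [apply continuous_const|].
  apply (continuous_Rplus (T := prod_UniformSpace _ _) (fun q => c * iter_pd w H q) (evH l)); [|exact IH].
  apply (continuous_Rmult (T := prod_UniformSpace _ _) (fun _ => c) (iter_pd w H));
    [apply continuous_const | apply (HH w p Hp)].
Qed.

(* The combinations of words are those of the expansion of [(x + i y)^n]. *)
Lemma Lop_words (n : nat) : exists lr li,
  (forall cw, In cw lr \/ In cw li -> length (snd cw) = n) /\
  (forall q, U q -> Nat.iter n Lop (fun q => RtoC (H q)) q = (evH lr q, evH li q)) /\
  (forall a, ev (nword (cos a) (sin a)) lr = cos (INR n * a) /\
             ev (nword (cos a) (sin a)) li = sin (INR n * a)).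
Proof.
  induction n as [|n (lr & li & Hlen & Hval & Htrig)].
  - exists ((1, nil) :: nil), nil. split; [|split].
    + intros cw [[<- | []] | []]; reflexivity.
    + intros q _. unfold evH; simpl. unfold RtoC. f_equal; ring.
    + intros a. simpl. rewrite Rmult_0_l, cos_0, sin_0. split; ring.
  - exists (push 1 true lr ++ push (-1) false li), (push 1 true li ++ push 1 false lr).
    split; [|split].
    + assert (P : forall c b l cw, (forall cw, In cw l -> length (snd cw) = n) ->
        In cw (push c b l) -> length (snd cw) = S n).
      { intros c b l cw Hl Hin. apply in_map_iff in Hin. destruct Hin as (x & <- & Hx).
        simpl. rewrite (Hl x Hx). reflexivity. }
      intros cw [Hin | Hin]; apply in_app_or in Hin; destruct Hin as [Hin | Hin];
        eapply P in Hin; eauto.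
    + intros q Hq. simpl. set (f := Nat.iter n Lop (fun q => RtoC (H q))) in *.
      unfold Lop, pdC.
      rewrite !(pd_ext_on U HU _ (fun q => Re (f q)) (evH lr)) by (auto; intros; rewrite Hval by auto; reflexivity).
      rewrite !(pd_ext_on U HU _ (fun q => Im (f q)) (evH li)) by (auto; intros; rewrite Hval by auto; reflexivity).
      rewrite !pd_evH by exact Hq. unfold evH. rewrite !ev_app, !ev_push.
      unfold Cplus, Cmult, Ci; simpl. f_equal; ring.
    + intros a. destruct (Htrig a) as [T1 T2]. rewrite !ev_app, !ev_push.
      assert (Q : forall b l, ev (fun w => nword (cos a) (sin a) (b :: w)) l =
        ncomp (cos a) (sin a) b * ev (nword (cos a) (sin a)) l).
      { intros b. induction l as [|x l IH]; [simpl; ring|].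
        set (nw := nword (cos a) (sin a)) in *.
        change (fst x * (ncomp (cos a) (sin a) b * nw (snd x)) + ev (fun w => nw (b :: w)) l =
          ncomp (cos a) (sin a) b * (fst x * nw (snd x) + ev nw l)).
        rewrite IH. ring. }
      rewrite !Q, T1, T2, S_INR. cbn [ncomp].
      replace ((INR n + 1) * a) with (INR n * a + a) by ring. rewrite cos_plus, sin_plus. split; ring.
Qed.

Lemma Vfield_continuous (n : nat) (p : pt) : U p -> continuous (Vfield n H) p.
Proof.
  intros Hp. destruct (Lop_words n) as (lr & li & _ & Hval & _).
  destruct (open_near U HU p Hp) as (d & Hd & Hd').
  apply (continuous_ext_loc _ (fun q => (evH lr q, evH li q) : pt)).
  - apply (locally_near _ _ d Hd). intros q Hq. unfold Vfield. rewrite Hval by auto. reflexivity.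
  - apply continuous_pair; apply continuous_evH; exact Hp.
Qed.

(** Differentiation along the line contracts one more slot with [nn]. The statement is for every s
    whose point lies in U, because the induction differentiates the identity in s. *)
Lemma normal_derivative (p nn : pt) (k : nat) (s : R) :
  U (fst p + s * fst nn, snd p + s * snd nn) ->
  Derive_n (fun s => H (fst p + s * fst nn, snd p + s * snd nn)) k s =
  contract (fst nn) (snd nn) (fun w => iter_pd w H (fst p + s * fst nn, snd p + s * snd nn)) k nil.
Proof.
  set (c := fun s => (fst p + s * fst nn, snd p + s * snd nn) : pt).
  assert (Hc : forall s, continuous c s).
  { intros u. apply continuous_pair; apply (continuous_Rplus (T := R_UniformSpace));
      try apply continuous_const; apply (continuous_Rmult (T := R_UniformSpace));
      try apply continuous_const; apply continuous_id. }
  revert s. induction k as [|k IH]; intros s Hs; [reflexivity|].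
  simpl Derive_n. fold c in IH, Hs |- *.
  assert (Hloc : locally s (fun s => U (c s))).
  { destruct (open_near U HU _ Hs) as (d & Hd & Hd').
    destruct (continuous_pt_near_R c s (Hc s) d Hd) as (e & He & He').
    exists (mkposreal e He). intros y Hy. apply Hd', He', Hy. }
  rewrite (Derive_ext_loc _ (fun s => contract (fst nn) (snd nn) (fun w => iter_pd w H (c s)) k nil)).
  2: { apply (filter_imp _ _ (fun s => IH s)). exact Hloc. }
  rewrite <- contract_shift.
  apply is_derive_unique.
  assert (E : forall j w, is_derive (fun s => contract (fst nn) (snd nn) (fun w => iter_pd w H (c s)) j w) s
    (contract (fst nn) (snd nn) (fun w => fst nn * iter_pd (true :: w) H (c s) +
      snd nn * iter_pd (false :: w) H (c s)) j w)).
  { induction j; intros w.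
    - change (is_derive (fun s => iter_pd w H (c s)) s (fst nn * pd true (iter_pd w H) (c s) +
        snd nn * pd false (iter_pd w H) (c s))).
      replace (fst nn * pd true (iter_pd w H) (c s) + snd nn * pd false (iter_pd w H) (c s)) with
        (pd true (iter_pd w H) (c s) * fst nn + pd false (iter_pd w H) (c s) * snd nn) by ring.
      apply (chain_rule U HU (iter_pd w H) (fun s => fst p + s * fst nn) (fun s => snd p + s * snd nn)).
      + apply smooth_iter_pd, HH.
      + exact Hs.
      + auto_derive; [auto | ring].
      + auto_derive; [auto | ring].
    - simpl. apply @is_derive_plus; apply is_derive_scal; apply IHj. }
  apply E.
Qed.

End Operator.

Section Boundary.
Context (U : pt -> Prop) (H : pt -> R) (gamma T : R -> pt) (n : nat) (c0 : R).
Hypothesis HU : open2 U.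
Hypothesis HH : smooth_on U H.
Hypothesis HgU : forall t, U (gamma t).
Hypothesis HT1 : forall t, is_derive (fun u => fst (gamma u)) t (fst (T t)).
Hypothesis HT2 : forall t, is_derive (fun u => snd (gamma u)) t (snd (T t)).
Hypothesis Hunit : forall t, fst (T t) ^ 2 + snd (T t) ^ 2 = 1.
Hypothesis Hconst : forall t, H (gamma t) = c0.
Hypothesis Hnorm : forall (j : nat) (t : R), (1 <= j <= n - 1)%nat ->
  Derive_n (fun s => H (fst (gamma t) + s * fst (nu T t), snd (gamma t) + s * snd (nu T t))) j 0 = 0.

(** Along gamma each derivative of order k - 1 is constant: it is H itself when k = 1, and otherwise
    a component of a power of the normal times a vanishing normal derivative. So the tensor of order
    k is annihilated by the tangent. This reaches order n although normal derivatives are only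
    assumed to vanish up to order n - 1. *)
Lemma boundary_words (k : nat) (t : R) (w : list bool) :
  (1 <= k <= n)%nat -> length w = k ->
  iter_pd w H (gamma t) = nword (fst (nu T t)) (snd (nu T t)) w *
    contract (fst (nu T t)) (snd (nu T t)) (fun w => iter_pd w H (gamma t)) k nil.
Proof.
  revert t w. induction k as [|k IH]; intros t w Hk Hw; [lia|].
  apply symmetric_tensor_power with (A := fun w => iter_pd w H (gamma t)); [| | | exact Hw].
  - unfold nu; cbn [fst snd]. rewrite <- (Hunit t). ring.
  - intros a b u v. apply (iter_pd_swap U HU); auto.
  - intros v Hv. injection Hv as Hv.
    change (fst (T t) * pd true (iter_pd v H) (gamma t) -
      (- snd (T t)) * pd false (iter_pd v H) (gamma t) = 0).
    assert (E : exists c, forall u, iter_pd v H (gamma u) = c).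
    { destruct k as [|k].
      - exists c0. intros u. destruct v; [apply Hconst | discriminate].
      - exists 0. intros u. rewrite (IH u v) by lia.
        pose proof (Hnorm (S k) u ltac:(lia)) as E.
        rewrite (normal_derivative U H HU HH (gamma u) (nu T u)) in E.
        + replace (fst (gamma u) + 0 * fst (nu T u), snd (gamma u) + 0 * snd (nu T u)) with (gamma u) in E.
          * rewrite E. ring.
          * rewrite (surjective_pairing (gamma u)) at 1. f_equal; ring.
        + replace (fst (gamma u) + 0 * fst (nu T u), snd (gamma u) + 0 * snd (nu T u)) with (gamma u); auto.
          rewrite (surjective_pairing (gamma u)) at 1. f_equal; ring. }
    destruct E as [c Ec].
    assert (D : is_derive (fun u => iter_pd v H (fst (gamma u), snd (gamma u))) t
      (pd true (iter_pd v H) (fst (gamma t), snd (gamma t)) * fst (T t) +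
       pd false (iter_pd v H) (fst (gamma t), snd (gamma t)) * snd (T t))).
    { apply (chain_rule U HU (iter_pd v H) (fun u => fst (gamma u)) (fun u => snd (gamma u)));
        [apply smooth_iter_pd, HH | rewrite <- surjective_pairing; auto | apply HT1 | apply HT2]. }
    apply is_derive_unique in D.
    rewrite (Derive_ext _ (fun _ => c)), Derive_const in D
      by (intros u; rewrite <- surjective_pairing; apply Ec).
    rewrite <- surjective_pairing in D. lra.
Qed.

Lemma Vfield_boundary (t a : R) : (1 <= n)%nat -> nu T t = (cos a, sin a) ->
  crs (Vfield n H (gamma t)) (cos (INR n * a), sin (INR n * a)) = 0.
Proof.
  intros Hn Ha.
  destruct (Lop_words U H HU HH n) as (lr & li & Hlen & Hval & Htrig).
  pose proof (boundary_words n t) as HB.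
  set (c := contract _ _ _ n nil) in HB. rewrite Ha in HB. cbn [fst snd] in HB.
  assert (E : forall l, (forall cw, In cw l -> length (snd cw) = n) ->
    evH H l (gamma t) = c * ev (nword (cos a) (sin a)) l).
  { induction l as [|cw l IH]; intros Hl; unfold evH in *; simpl; [ring|].
    rewrite IH by (intros; apply Hl; right; auto).
    rewrite HB; [ring | lia | apply Hl; left; auto]. }
  unfold Vfield. rewrite Hval by auto. unfold crs; simpl.
  rewrite !E by (intros; apply Hlen; auto). destruct (Htrig a) as [-> ->]. ring.
Qed.

End Boundary.

(** * Grids *)

Lemma locate (f : nat -> R) (N : nat) (x : R) : f 0%nat <= x < f N ->
  exists i, (i < N)%nat /\ f i <= x < f (S i).
Proof.
  induction N; intros [H1 H2]; [lra|].
  destruct (Rlt_dec x (f N)) as [Hx | Hx].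
  - destruct (IHN (conj H1 Hx)) as (i & Hi & H). exists i; split; [lia | exact H].
  - exists N. split; [lia | lra].
Qed.

(** The forbidden offsets are s apart, so a window of length at most s has at most one inside; the
    part above it is kept. An interval rather than a point is returned in order to iterate over a
    list. *)
Lemma offset_interval (s x al be : R) : 0 < s -> al < be ->
  exists al' be', al <= al' < be' /\ be' <= be /\
    forall o, al' < o < be' -> forall i, x <> o + INR i * s.
Proof.
  intros Hs Hab. set (b := Rmin be (al + s)).
  assert (Hb : al < b <= be /\ b <= al + s).
  { unfold b. pose proof (Rmin_l be (al + s)). pose proof (Rmin_r be (al + s)).
    split; [split; [apply Rmin_glb_lt; lra | lra] | lra]. }
  destruct (classic (exists i, al < x - INR i * s < b)) as [[i Hi] | Hno].
  - exists (x - INR i * s), b. split; [lra|]. split; [lra|]. intros o Ho j E.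
    assert (0 < (INR i - INR j) * s < s) as [G1 G2] by lra.
    assert (0 < INR i - INR j < 1) as [G3 G4] by (split; nra).
    assert (INR j < INR i) as G5 by lra. apply INR_lt in G5.
    assert (S j <= i)%nat as G6 by lia. apply le_INR in G6. rewrite S_INR in G6. lra.
  - exists al, b. split; [lra|]. split; [lra|]. intros o Ho j E. apply Hno. exists j. lra.
Qed.

Lemma offset_exists (l : list R) (s B : R) : 0 < s ->
  exists o, o < B /\ forall x, In x l -> forall i, x <> o + INR i * s.
Proof.
  intros Hs.
  assert (G : forall al be, al < be -> exists al' be', al <= al' < be' /\ be' <= be /\
    forall o, al' < o < be' -> forall x, In x l -> forall i, x <> o + INR i * s).
  { induction l as [|y l IH]; intros al be Hab.
    - exists al, be. split; [lra|]. split; [lra|]. intros o _ x [].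
    - destruct (offset_interval s y al be Hs Hab) as (a1 & b1 & H1 & H2 & H3).
      destruct (IH a1 b1 ltac:(lra)) as (a2 & b2 & H4 & H5 & H6).
      exists a2, b2. split; [lra|]. split; [lra|]. intros o Ho x [<- | Hx].
      + apply H3; lra.
      + apply H6; auto. }
  destruct (G (B - 1) B ltac:(lra)) as (al & be & H1 & H2 & H3).
  exists ((al + be) / 2). split; [lra|]. apply H3; lra.
Qed.

(** A square of radius [d / 2] holds at most one point of Z, and finitely many such squares cover
    the box. The list grows by at most one point for each square. *)
Lemma finite_separated (Z : pt -> Prop) (M d : R) : 0 < d ->
  (forall z, Z z -> inbox M z) ->
  (forall z z', Z z -> Z z' -> near d z z' -> z = z') ->
  exists l, NoDup l /\ forall p, In p l <-> Z p.
Proof.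
  intros Hd Hb Hs.
  assert (G : forall cs : list pt, exists l, NoDup l /\
    forall p, In p l <-> Z p /\ exists c, In c cs /\ near (d / 2) c p).
  { induction cs as [|c cs (l & Hnd & Hl)].
    - exists nil. split; [constructor|]. intros p; split; [intros [] | intros (_ & c & [] & _)].
    - destruct (classic (exists z, Z z /\ near (d / 2) c z /\ ~ In z l)) as [(z & Hz & Hc & Hn) | Hno].
      + exists (z :: l). split; [constructor; auto|]. intros p. split.
        * intros [<- | Hp]; [split; [auto | exists c; split; [left; auto | auto]]|].
          apply Hl in Hp. destruct Hp as (Hp & c' & Hc' & Hn'). split; [auto|].
          exists c'; split; [right|]; auto.
        * intros (Hp & c' & [<- | Hc'] & Hn'); [left | right; apply Hl; eauto].
          apply Hs; auto. replace d with (d / 2 + d / 2) by lra.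
          eapply near_trans; [apply near_sym; exact Hc | exact Hn'].
      + exists l. split; [auto|]. intros p. split.
        * intros Hp. apply Hl in Hp. destruct Hp as (Hp & c' & Hc' & Hn'). split; [auto|].
          exists c'; split; [right|]; auto.
        * intros (Hp & c' & [<- | Hc'] & Hn'); [|apply Hl; eauto].
          apply NNPP. intros Hnin. apply Hno. exists p; auto. }
  destruct (INR_unbounded (2 * M / (d / 4))) as [N HN].
  set (f := fun i => - M + INR i * (d / 4)).
  destruct (G (list_prod (map f (seq 0 N)) (map f (seq 0 N)))) as (l & Hnd & Hl).
  exists l. split; [exact Hnd|]. intros p. rewrite Hl. split; [tauto|]. intros Hp. split; [exact Hp|].
  assert (X : forall x, - M <= x <= M -> exists i, (i < N)%nat /\ f i <= x < f (S i)).
  { intros x Hx. apply locate. unfold f. simpl INR.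
    apply Rlt_div_l in HN; [|lra]. split; lra. }
  destruct (Hb p Hp) as [B1 B2].
  destruct (X _ B1) as (i & Hi & Hi'). destruct (X _ B2) as (j & Hj & Hj').
  exists (f i, f j). split.
  - apply in_prod; apply in_map, in_seq; lia.
  - unfold f in *. rewrite S_INR in Hi', Hj'.
    split; simpl; rewrite Rabs_pos_eq; lra.
Qed.

Lemma uniform_on_list {A : Type} (l : list A) (Q : A -> R -> Prop) :
  (forall z, In z l -> exists r, 0 < r /\ forall s, 0 < s < r -> Q z s) ->
  exists r, 0 < r /\ forall z, In z l -> forall s, 0 < s < r -> Q z s.
Proof.
  induction l as [|y l IH]; intros H.
  - exists 1. split; [lra | intros z []].
  - destruct IH as (r & Hr & H1); [intros; apply H; right; auto|].
    destruct (H y (or_introl eq_refl)) as (r' & Hr' & H2).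
    exists (Rmin r r'). split; [apply Rmin_pos; auto|].
    pose proof (Rmin_l r r'). pose proof (Rmin_r r r').
    intros z [<- | Hz] s Hs; [apply H2; lra | apply H1; auto; lra].
Qed.

Definition lsum {A : Type} (f : A -> R) (l : list A) : R := fold_right (fun z t => f z + t) 0 l.

Lemma lsum_zero {A : Type} (f : A -> R) (l : list A) :
  (forall z, In z l -> f z = 0) -> lsum f l = 0.
Proof.
  induction l as [|y l IH]; intros H; simpl; [reflexivity|].
  rewrite (H y (or_introl eq_refl)), IH; [ring | intros; apply H; right; auto].
Qed.

Lemma lsum_single {A : Type} (f : A -> R) (l : list A) (z : A) : NoDup l -> In z l ->
  (forall y, In y l -> y <> z -> f y = 0) -> lsum f l = f z.
Proof.
  induction l as [|y l IH]; intros Hnd Hin H; [destruct Hin|].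
  inversion Hnd as [|? ? Hy Hnd']; subst. simpl. destruct Hin as [-> | Hin].
  - rewrite lsum_zero; [ring|]. intros x Hx. apply H; [right; auto|]. intros ->; contradiction.
  - rewrite IH; auto.
    + rewrite (H y); [ring | left; auto | intros ->; contradiction].
    + intros x Hx. apply H. right; auto.
Qed.

Section Grid.
Context (o s : R) (N : nat) (c : nat -> nat -> R).
Hypothesis Hs : 0 < s.

Definition gr (i : nat) : R := o + INR i * s.

Lemma gr_S (i : nat) : gr (S i) = gr i + s.
Proof. unfold gr. rewrite S_INR. ring. Qed.

Lemma gr_lt (i j : nat) : (i < j)%nat -> gr (S i) <= gr j.
Proof.
  intros Hij. unfold gr. assert (INR (S i) <= INR j) by (apply le_INR; lia). nra.
Qed.

Definition gflux (F : pt -> pt -> R) : R :=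
  flux N c (fun i j => F (gr i, gr j) (gr (S i), gr j)) (fun i j => F (gr i, gr j) (gr i, gr (S j))).

Lemma gflux_circ (F : pt -> pt) :
  gflux (darg F) = rsum N (fun i => rsum N (fun j => c i j * circ F (gr i) (gr (S i)) (gr j) (gr (S j)))).
Proof. reflexivity. Qed.

Definition offgrid (q : pt) : Prop := forall i, fst q <> gr i /\ snd q <> gr i.

Definition incell (q : pt) (i j : nat) : Prop :=
  gr i < fst q < gr (S i) /\ gr j < snd q < gr (S j).

Lemma cell_exists (q : pt) : offgrid q -> o < fst q < gr N -> o < snd q < gr N ->
  exists i j, (i < N)%nat /\ (j < N)%nat /\ incell q i j.
Proof.
  intros Hq Hx Hy.
  assert (G0 : gr 0 = o) by (unfold gr; simpl; ring).
  destruct (locate gr N (fst q)) as (i & Hi & H1); [rewrite G0; lra|].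
  destruct (locate gr N (snd q)) as (j & Hj & H2); [rewrite G0; lra|].
  exists i, j. split; [auto|]. split; [auto|].
  destruct (Hq i) as [H3 _]. destruct (Hq j) as [_ H4]. split; lra.
Qed.

Lemma circ_outside (q : pt) (i j : nat) : offgrid q -> ~ incell q i j ->
  circ (fun p => psub p q) (gr i) (gr (S i)) (gr j) (gr (S j)) = 0.
Proof.
  intros Hq Hn. pose proof (gr_S i) as Ei. pose proof (gr_S j) as Ej.
  apply circ_zero; [lra | lra |]. intros p Hx Hy. split; [apply continuous_from|].
  apply psub_neq0. intros ->. apply Hn.
  destruct (Hq i) as [H1 _]. destruct (Hq (S i)) as [H2 _].
  destruct (Hq j) as [_ H3]. destruct (Hq (S j)) as [_ H4]. split; lra.
Qed.

Lemma incell_unique (q : pt) (i j i' j' : nat) : incell q i j -> incell q i' j' -> i = i' /\ j = j'.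
Proof.
  intros [H1 H2] [H3 H4]. split.
  - destruct (Nat.lt_total i i') as [H | [H | H]]; [|exact H|]; apply gr_lt in H; lra.
  - destruct (Nat.lt_total j j') as [H | [H | H]]; [|exact H|]; apply gr_lt in H; lra.
Qed.

Lemma gflux_point (q : pt) (i j : nat) : offgrid q -> (i < N)%nat -> (j < N)%nat -> incell q i j ->
  gflux (darg (fun p => psub p q)) = c i j * (2 * PI).
Proof.
  intros Hq Hi Hj Hin. rewrite gflux_circ.
  rewrite (rsum_single N i); [|exact Hi|].
  - rewrite (rsum_single N j); [|exact Hj|].
    + rewrite circ_inside; [reflexivity | apply Hin | apply Hin].
    + intros j' _ Hne. rewrite circ_outside; [ring | exact Hq|]. intros H'.
      apply Hne. apply (incell_unique _ _ _ _ _ H' Hin).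
  - intros i' _ Hne. apply rsum_zero. intros j' _.
    rewrite circ_outside; [ring | exact Hq|]. intros H'.
    apply Hne. apply (incell_unique _ _ _ _ _ H' Hin).
Qed.

(* Only the edges along which the weight [c] jumps contribute, up to a gradient. *)
Lemma gflux_near (F K : pt -> pt -> R) (G : pt -> R) (k : R) (B : pt -> Prop) :
  (forall i, c i 0%nat = 0 /\ c i N = 0 /\ c 0%nat i = 0 /\ c N i = 0) ->
  (forall i j, c i j <> c (S i) j -> B (gr (S i), gr j)) ->
  (forall i j, c i j <> c i (S j) -> B (gr i, gr (S j))) ->
  (forall p p', B p -> near (2 * s) p p' -> F p p' = k * K p p' + (G p' - G p)) ->
  gflux F = k * gflux K.
Proof.
  intros Hc Hv Hh HF. unfold gflux.
  set (R1 := fun p p' => F p p' - k * K p p' - (G p' - G p)).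
  rewrite (flux_comb N c _ _ (fun i j => K (gr i, gr j) (gr (S i), gr j))
    (fun i j => K (gr i, gr j) (gr i, gr (S j)))
    (fun i j => F (gr i, gr j) (gr (S i), gr j) - k * K (gr i, gr j) (gr (S i), gr j))
    (fun i j => F (gr i, gr j) (gr i, gr (S j)) - k * K (gr i, gr j) (gr i, gr (S j))) k)
    by (intros; ring).
  rewrite (flux_comb N c (fun i j => F _ _ - _) _
    (fun i j => G (gr (S i), gr j) - G (gr i, gr j)) (fun i j => G (gr i, gr (S j)) - G (gr i, gr j))
    (fun i j => R1 (gr i, gr j) (gr (S i), gr j)) (fun i j => R1 (gr i, gr j) (gr i, gr (S j))) 1)
    by (intros; unfold R1; ring).
  rewrite (flux_gradient N c (fun i j => G (gr i, gr j))).
  assert (A : forall x, Rabs (x - x) < 2 * s) by (intros; rewrite Rminus_diag, Rabs_R0; lra).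
  assert (A' : forall i, Rabs (gr (S i) - gr i) < 2 * s).
  { intros i. rewrite gr_S. replace (gr i + s - gr i) with s by ring. rewrite Rabs_pos_eq; lra. }
  rewrite (flux_boundary N c (fun i j => R1 (gr i, gr j) (gr (S i), gr j))
    (fun i j => R1 (gr i, gr j) (gr i, gr (S j)))); [ring | exact Hc | |].
  - intros i j _ _ Hne. unfold R1. rewrite HF; [ring | apply Hv, Hne | split; simpl; auto].
  - intros i j _ _ Hne. unfold R1. rewrite HF; [ring | apply Hh, Hne | split; simpl; auto].
Qed.

End Grid.

(** * The two sides of the boundary *)

Lemma is_derive_sq_dist (g1 g2 : R -> R) (x y u l1 l2 : R) :
  is_derive g1 u l1 -> is_derive g2 u l2 ->
  is_derive (fun u => (x - g1 u) ^ 2 + (y - g2 u) ^ 2) u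
    (-2 * ((x - g1 u) * l1 + (y - g2 u) * l2)).
Proof.
  intros H1 H2. auto_derive.
  - split; [eexists; exact H1 | split; [eexists; exact H2 | auto]].
  - replace (Derive _ u) with l1 by (symmetry; exact (is_derive_unique g1 u l1 H1)).
    replace (Derive _ u) with l2 by (symmetry; exact (is_derive_unique g2 u l2 H2)). ring.
Qed.

Section Domain.
Context (D : pt -> Prop) (gamma : R -> pt).
Hypothesis HDcl : closed2 D.
Hypothesis HDfr : forall p, frontier2 D p <-> exists t, p = gamma t.

Lemma curve_in_domain (t : R) : D (gamma t).
Proof.
  apply NNPP. intros Hn. destruct (HDcl _ Hn) as (e & He & H).
  assert (Hf : frontier2 D (gamma t)) by (apply HDfr; eauto).
  destruct (Hf e He) as [(q & Hq & Hd) _]. exact (H q Hd Hq).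
Qed.

Lemma off_curve_constant (p : pt) : (forall t, p <> gamma t) ->
  exists d, 0 < d /\ forall q, near d p q -> (D q <-> D p).
Proof.
  intros Hp.
  assert (Hf : ~ frontier2 D p).
  { intros Hf. apply HDfr in Hf. destruct Hf as [t Ht]. exact (Hp t Ht). }
  apply not_all_ex_not in Hf. destruct Hf as [e He].
  apply imply_to_and in He. destruct He as [He Hn].
  exists (e / 2). split; [lra|].
  assert (N : forall q, near (e / 2) p q -> dist2 q p < e).
  { intros q Hq. apply near_dist2 in Hq. lra. }
  assert (Np : near (e / 2) p p) by (apply near_refl; lra).
  intros q Hq. apply not_and_or in Hn. destruct Hn as [Hn | Hn]; split; intros H.
  - exfalso; apply Hn; eauto.
  - exfalso; apply Hn; eauto.
  - apply NNPP; intros H'; apply Hn; eauto.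
  - apply NNPP; intros H'; apply Hn; eauto.
Qed.

Lemma interior_iff (p : pt) : interior2 D p <-> D p /\ forall t, p <> gamma t.
Proof.
  split.
  - intros (e & He & H). split; [apply H|].
    + unfold dist2. rewrite !Rminus_diag. replace (0 ^ 2 + 0 ^ 2) with 0 by ring.
      rewrite sqrt_0. lra.
    + intros t Ht. assert (Hf : frontier2 D p) by (apply HDfr; eauto).
      destruct (Hf e He) as [_ (q & Hq & Hd)]. exact (Hq (H q Hd)).
  - intros [Hp Hc]. destruct (off_curve_constant p Hc) as (d & Hd & H).
    apply interior2_near. exists d. split; [exact Hd|]. intros q Hq. apply (H q Hq), Hp.
Qed.

(** Membership in D, encoded by the values PI and 0, is locally constant off gamma, hence a
    continuous function whose sine vanishes. *)
Lemma path_in_domain (c : R -> pt) : (forall l, continuous c l) ->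
  (forall l t, 0 <= l <= 1 -> c l <> gamma t) -> D (c 0) -> D (c 1).
Proof.
  intros Hc Hn H0.
  set (g := fun l => if excluded_middle_informative (D (c (clamp l))) then PI else 0).
  assert (E : g 0 = g 1).
  { apply (sin_zero_const g).
    - intros l. apply continuous_R_iff. intros e He.
      destruct (off_curve_constant (c (clamp l))) as (d & Hd & H).
      { intros t; apply Hn, clamp_bound. }
      assert (Cc : continuous (fun l => c (clamp l)) l).
      { apply (continuous_comp clamp c); [apply continuous_clamp | apply Hc]. }
      destruct (continuous_pt_near_R _ _ Cc d Hd) as (d' & Hd' & H').
      exists d'. split; [exact Hd'|]. intros y Hy. specialize (H _ (H' y Hy)).
      unfold g. destruct (excluded_middle_informative _), (excluded_middle_informative _);
        try tauto; rewrite Rminus_diag, Rabs_R0; exact He.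
    - intros l. unfold g. destruct (excluded_middle_informative _); [apply sin_PI | apply sin_0]. }
  unfold g in E. rewrite !clamp_id in E by lra. pose proof PI_RGT_0.
  destruct (excluded_middle_informative (D (c 0))); [|contradiction].
  destruct (excluded_middle_informative (D (c 1))); [assumption | lra].
Qed.

Lemma segment_crosses (p p' : pt) : (D p -> ~ D p') -> (~ D p -> D p') ->
  exists l t, gamma t = seg p p' l.
Proof.
  intros H1 H2. apply NNPP. intros Hn.
  assert (C : forall l t, seg p p' l <> gamma t) by (intros l t E; apply Hn; eauto).
  destruct (classic (D p)) as [Hp | Hp].
  - apply (H1 Hp). rewrite <- (seg_1 p p'). apply path_in_domain; auto.
    + intros; apply continuous_seg.
    + rewrite seg_0; exact Hp.
  - apply Hp. rewrite <- (seg_0 p p').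
    replace 0 with (1 - 1) by ring. apply (path_in_domain (fun l => seg p p' (1 - l))).
    + intros l. apply (continuous_comp (fun l => 1 - l) (seg p p')); [|apply continuous_seg].
      apply (continuous_Rminus (T := R_UniformSpace)); [apply continuous_const | apply continuous_id].
    + intros; apply C.
    + replace (1 - 0) with 1 by ring. rewrite seg_1. auto.
Qed.

Context (T : R -> pt) (L : R).
Hypothesis HL : 0 < L.
Hypothesis Hper : forall t, gamma (t + L) = gamma t.
Hypothesis HT1 : forall t, is_derive (fun u => fst (gamma u)) t (fst (T t)).
Hypothesis HT2 : forall t, is_derive (fun u => snd (gamma u)) t (snd (T t)).
Hypothesis Hunit : forall t, fst (T t) ^ 2 + snd (T t) ^ 2 = 1.

(** At a point of gamma nearest to p the difference is orthogonal to the tangent, hence a multiple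
    of the normal. *)
Lemma nearest_point (p : pt) : exists t a, p = off gamma T a t /\
  forall u, a ^ 2 <= (fst p - fst (gamma u)) ^ 2 + (snd p - snd (gamma u)) ^ 2.
Proof.
  set (f := fun u => (fst p - fst (gamma u)) ^ 2 + (snd p - snd (gamma u)) ^ 2).
  assert (Hf : forall u, is_derive f u
    (-2 * ((fst p - fst (gamma u)) * fst (T u) + (snd p - snd (gamma u)) * snd (T u)))).
  { intros u. apply (is_derive_sq_dist (fun u => fst (gamma u)) (fun u => snd (gamma u))); auto. }
  destruct (continuity_ab_min f 0 L (Rlt_le _ _ HL)) as (t & Hmin & _).
  { intros c _. apply continuity_pt_filterlim, (ex_derive_continuous f c). eexists; apply Hf. }
  (* The minimum over one period may sit at an end of the interval; periodicity makes it global, so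
     that the derivative vanishes in any case. *)
  assert (Hglob : forall u, f t <= f u).
  { intros u. destruct (period_reduce L u HL) as [k Hk]. unfold f at 2.
    rewrite <- (period_Z gamma L Hper k u). apply (Hmin (u + IZR k * L)). lra. }
  assert (Hz : -2 * ((fst p - fst (gamma t)) * fst (T t) + (snd p - snd (gamma t)) * snd (T t)) = 0).
  { pose proof (proj1 (is_derive_Reals _ _ _) (Hf t)) as Hd.
    assert (pr : derivable_pt f t) by (eexists; exact Hd).
    rewrite <- (deriv_minimum f (t - 1) (t + 1) t pr ltac:(lra) ltac:(lra) (fun u _ _ => Hglob u)).
    symmetry. apply derive_pt_eq_0. exact Hd. }
  set (x := fst p - fst (gamma t)) in *. set (y := snd p - snd (gamma t)) in *.
  pose proof (Hunit t) as Hu. set (a := fst (T t)) in *. set (b := snd (T t)) in *.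
  assert (Hab : x * a + y * b = 0) by lra.
  assert (Ex : x = (y * a - x * b) * - b).
  { transitivity (x * (a ^ 2 + b ^ 2) - a * (x * a + y * b)); [rewrite Hu, Hab; ring | ring]. }
  assert (Ey : y = (y * a - x * b) * a).
  { transitivity (y * (a ^ 2 + b ^ 2) - b * (x * a + y * b)); [rewrite Hu, Hab; ring | ring]. }
  exists t, (y * a - x * b). split.
  - unfold off, nu; cbn [fst snd]. fold a b. rewrite (surjective_pairing p).
    f_equal; [rewrite <- Ex; unfold x | rewrite <- Ey; unfold y]; ring.
  - intros u. replace ((y * a - x * b) ^ 2) with (f t); [apply Hglob|].
    set (v := y * a - x * b) in *. unfold f. fold x y. rewrite Ex, Ey.
    transitivity (v ^ 2 * (a ^ 2 + b ^ 2)); [ring | rewrite Hu; ring].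
Qed.

Context (d : R).
Hypothesis Hd : 0 < d.
Hypothesis Htube : forall a, 0 < Rabs a <= d -> forall s t, gamma s <> off gamma T a t.
Hypothesis Hoff : forall a t, continuous (off gamma T a) t.
Hypothesis HDint : exists p, interior2 D p.

Lemma move_across (a a' t : R) : 0 < a * a' -> Rabs a <= d -> Rabs a' <= d ->
  D (off gamma T a t) -> D (off gamma T a' t).
Proof.
  intros Haa Ha Ha' H0.
  set (c := fun l => off gamma T (a + l * (a' - a)) t).
  replace (off gamma T a' t) with (c 1) by (unfold c; f_equal; ring).
  apply path_in_domain.
  - intros l. unfold c, off. apply continuous_pair;
      (apply (continuous_Rplus (T := R_UniformSpace)); [apply continuous_const|];
       apply (continuous_Rmult (T := R_UniformSpace)); [|apply continuous_const];
       apply (continuous_Rplus (T := R_UniformSpace)); [apply continuous_const|];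
       apply (continuous_Rmult (T := R_UniformSpace)); [apply continuous_id | apply continuous_const]).
  - intros l t' Hl E. symmetry in E. revert E. apply Htube.
    apply Rabs_le_between in Ha. apply Rabs_le_between in Ha'.
    split; [apply Rabs_pos_lt; intros E; nra | apply Rabs_le; nra].
  - unfold c. replace (a + 0 * (a' - a)) with a by ring. exact H0.
Qed.

Lemma move_along (a t t' : R) : 0 < Rabs a <= d -> D (off gamma T a t) -> D (off gamma T a t').
Proof.
  intros Ha H0.
  set (c := fun l => off gamma T a (t + l * (t' - t))).
  replace (off gamma T a t') with (c 1) by (unfold c; f_equal; ring).
  apply path_in_domain.
  - intros l. apply (continuous_comp (fun l => t + l * (t' - t)) (off gamma T a)); [|apply Hoff].
    apply (continuous_Rplus (T := R_UniformSpace)); [apply continuous_const|].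
    apply (continuous_Rmult (T := R_UniformSpace)); [apply continuous_id | apply continuous_const].
  - intros l u _ E. symmetry in E. revert E. apply Htube, Ha.
  - unfold c. replace (t + 0 * (t' - t)) with t by ring. exact H0.
Qed.

(** From an interior point p the path runs straight towards a nearest point of gamma and stops
    within distance d of it. On the way it stays closer to p than gamma is, so it does not leave
    D. *)
Lemma inner_side : exists a t, 0 < Rabs a <= d /\ D (off gamma T a t).
Proof.
  destruct HDint as [p Hp]. apply interior_iff in Hp. destruct Hp as [Hp Hpc].
  destruct (nearest_point p) as (t & a & Ep & Hmin).
  assert (Ha0 : a <> 0).
  { intros ->. apply (Hpc t). rewrite Ep. unfold off.
    rewrite (surjective_pairing (gamma t)). cbn [fst snd]. f_equal; ring. }
  set (r := Rmin 1 (d / Rabs a)).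
  pose proof (Rabs_pos_lt a Ha0) as Ha1.
  assert (Hr : 0 < r <= 1 /\ r * Rabs a <= d).
  { unfold r. pose proof (Rmin_l 1 (d / Rabs a)). pose proof (Rmin_r 1 (d / Rabs a)).
    assert (0 < d / Rabs a) by (apply Rdiv_lt_0_compat; auto).
    split; [split; [apply Rmin_pos; lra | lra]|].
    replace d with (d / Rabs a * Rabs a) at 2 by (field; lra). apply Rmult_le_compat_r; lra. }
  exists (r * a), t. rewrite Rabs_mult, (Rabs_pos_eq r) by lra. split; [split; nra|].
  set (c := fun l => off gamma T ((1 + l * (r - 1)) * a) t).
  replace (off gamma T (r * a) t) with (c 1) by (unfold c; f_equal; ring).
  apply path_in_domain.
  - intros l. unfold c, off. apply continuous_pair;
      (apply (continuous_Rplus (T := R_UniformSpace)); [apply continuous_const|];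
       apply (continuous_Rmult (T := R_UniformSpace)); [|apply continuous_const];
       apply (continuous_Rmult (T := R_UniformSpace)); [|apply continuous_const];
       apply (continuous_Rplus (T := R_UniformSpace)); [apply continuous_const|];
       apply (continuous_Rmult (T := R_UniformSpace)); [apply continuous_id | apply continuous_const]).
  - intros l u Hl E. specialize (Hmin u). rewrite <- E in Hmin. unfold c in Hmin.
    set (m := 1 + l * (r - 1)) in *.
    assert (Hm : 0 < m <= 1) by (unfold m; split; nra).
    rewrite Ep in Hmin. unfold off, nu in Hmin; cbn [fst snd] in Hmin.
    assert (E2 : a ^ 2 <= ((1 - m) * a) ^ 2 * (fst (T t) ^ 2 + snd (T t) ^ 2)).
    { eapply Rle_trans; [exact Hmin|]. right. ring. }
    rewrite Hunit in E2. assert (0 < a ^ 2) by nra.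
    assert (((1 - m) * a) ^ 2 = (1 - m) ^ 2 * a ^ 2) as E3 by ring. rewrite E3 in E2.
    assert ((1 - m) ^ 2 < 1) by nra. nra.
  - unfold c. replace ((1 + 0 * (r - 1)) * a) with a by ring. rewrite <- Ep. exact Hp.
Qed.

(** Otherwise both sides of gamma would lie in D up to distance |a|. But a point outside D close to
    [gamma 0] has the form [off b t] with |b| < |a|, and b has the sign of a or of - a. *)
Lemma outer_side (a t0 : R) : 0 < Rabs a <= d -> D (off gamma T a t0) ->
  exists t, ~ D (off gamma T (- a) t).
Proof.
  intros Ha Hin. apply NNPP. intros Hno.
  assert (Hin' : forall t, D (off gamma T (- a) t)).
  { intros t. apply NNPP. intros H. apply Hno; eauto. }
  assert (Hf : frontier2 D (gamma 0)) by (apply HDfr; eauto).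
  destruct (Hf (Rabs a) (proj1 Ha)) as [_ (q & Hq & Hdq)].
  destruct (nearest_point q) as (t & b & Eq & Hmin).
  assert (Hb : Rabs b < Rabs a).
  { eapply Rle_lt_trans; [|exact Hdq]. unfold dist2. rewrite <- sqrt_Rsqr_abs.
    apply sqrt_le_1_alt. unfold Rsqr. replace (b * b) with (b ^ 2) by ring. apply Hmin. }
  assert (Hb0 : b <> 0).
  { intros ->. apply Hq. replace q with (gamma t); [apply curve_in_domain|].
    rewrite Eq. unfold off. rewrite (surjective_pairing (gamma t)) at 1. f_equal; ring. }
  apply Hq. rewrite Eq.
  assert (Ha0 : a <> 0) by (intros ->; rewrite Rabs_R0 in Ha; lra).
  destruct (Rlt_dec 0 (a * b)) as [Hab | Hab].
  - apply (move_across a); [exact Hab | apply Ha | lra |]. apply (move_along a t0); auto.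
  - apply (move_across (- a)); [| rewrite Rabs_Ropp; apply Ha | lra | apply Hin'].
    assert (a * b <> 0) by (apply Rmult_integral_contrapositive; auto). lra.
Qed.

End Domain.

(** * The sum of the indices *)

Lemma Derive_periodic (f : R -> R) (L : R) : (forall t, f (t + L) = f t) ->
  forall t, Derive f (t + L) = Derive f t.
Proof.
  intros Hf t. unfold Derive. f_equal. apply Lim_ext. intros h.
  replace (t + L + h) with ((t + h) + L) by ring. rewrite !Hf. reflexivity.
Qed.

Lemma periodic_bounded (g : R -> R) (L : R) : 0 < L ->
  (forall t, g (t + L) = g t) -> (forall t, continuous g t) ->
  exists M, 0 < M /\ forall t, Rabs (g t) <= M.
Proof.
  intros HL Hp Hc.
  destruct (continuity_ab_maj (fun t => Rabs (g t)) 0 L (Rlt_le _ _ HL)) as (m & Hm & _).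
  { intros c _. apply continuity_pt_filterlim. apply (continuous_comp_Rabs g c), Hc. }
  exists (Rabs (g m) + 1). split; [pose proof (Rabs_pos (g m)); lra|]. intros t.
  destruct (period_reduce L t HL) as [k Hk].
  assert (E : g (t + IZR k * L) = g t).
  { rewrite (shift_int g 0 L); [ring | intros; rewrite Hp; ring]. }
  specialize (Hm (t + IZR k * L) ltac:(lra)). rewrite E in Hm. lra.
Qed.

Lemma periodic_lipschitz (f : R -> R) (L : R) : 0 < L ->
  (forall t, f (t + L) = f t) -> (forall t, ex_derive f t) -> (forall t, ex_derive (Derive f) t) ->
  exists M, 0 < M /\ forall s t, Rabs (f s - f t) <= M * Rabs (s - t).
Proof.
  intros HL Hp H1 H2.
  destruct (periodic_bounded (Derive f) L HL) as (M & HM & Hb).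
  - apply Derive_periodic, Hp.
  - intros t. apply (ex_derive_continuous (Derive f) t), H2.
  - exists M. split; [exact HM|]. intros s t.
    destruct (mean_value f (Derive f) t s) as (c & _ & E).
    { intros x. apply Derive_correct, H1. }
    rewrite E, Rabs_mult. apply Rmult_le_compat_r; [apply Rabs_pos | apply Hb].
Qed.

Theorem theorem3
  (D : pt -> Prop) (gamma : R -> pt) (L : R) (n : nat) (H : pt -> R) (U : pt -> Prop)
  (* D is a compact domain with non-empty interior whose boundary is the curve gamma *)
  (HDcl : closed2 D) (HDbd : bounded2 D)
  (HDint : exists p, interior2 D p)
  (HDfr : forall p, frontier2 D p <-> exists t, p = gamma t)
  (* gamma: smooth simple closed curve of length L, arc-length parametrized *)
  (HL : 0 < L)
  (Hgs1 : smooth1 (fun t => fst (gamma t))) (Hgs2 : smooth1 (fun t => snd (gamma t)))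
  (Hper : forall t, gamma (t + L) = gamma t)
  (Hsimple : forall s t, 0 <= s < L -> 0 <= t < L -> gamma s = gamma t -> s = t)
  (Harc : forall t, (Derive (fun u => fst (gamma u)) t) ^ 2
                    + (Derive (fun u => snd (gamma u)) t) ^ 2 = 1)
  (Hn : (1 <= n)%nat)
  (* H smooth on an open neighbourhood U of D *)
  (HUo : open2 U) (HDU : forall p, D p -> U p) (HHs : smooth_on U H)
  (* H constant on gamma *)
  (Hconst : exists c, forall t, H (gamma t) = c)
  (* j-th normal derivatives vanish along gamma, j = 1 .. n-1 *)
  (Hnorm : forall (j : nat) (t : R), (1 <= j <= n - 1)%nat ->
     Derive_n (fun s => H (fst (gamma t) - s * Derive (fun u => snd (gamma u)) t,
                           snd (gamma t) + s * Derive (fun u => fst (gamma u)) t)) j 0 = 0)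
  (* V_n has only isolated zeros in D and none on gamma *)
  (Hiso : forall p, D p -> is_zero (Vfield n H) p ->
     exists eps, 0 < eps /\ forall q, D q -> is_zero (Vfield n H) q ->
       dist2 q p < eps -> q = p)
  (Hbdry : forall t, ~ is_zero (Vfield n H) (gamma t)) :
  exists (zs : list pt) (ks : list Z),
    NoDup zs /\
    (forall p, In p zs <-> (interior2 D p /\ is_zero (Vfield n H) p)) /\
    Forall2 (index_is (Vfield n H)) zs ks /\
    sumZ ks = Z.of_nat n.
Proof.
  set (T := fun t => (Derive (fun u => fst (gamma u)) t, Derive (fun u => snd (gamma u)) t) : pt).
  assert (HT1 : forall t, is_derive (fun u => fst (gamma u)) t (fst (T t))).
  { intros t. apply Derive_correct, (Hgs1 0%nat). }
  assert (HT2 : forall t, is_derive (fun u => snd (gamma u)) t (snd (T t))).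
  { intros t. apply Derive_correct, (Hgs2 0%nat). }
  assert (HTp1 : forall t, fst (T (t + L)) = fst (T t)).
  { intros t. apply (Derive_periodic (fun u => fst (gamma u))). intros u; rewrite Hper; reflexivity. }
  assert (HTp2 : forall t, snd (T (t + L)) = snd (T t)).
  { intros t. apply (Derive_periodic (fun u => snd (gamma u))). intros u; rewrite Hper; reflexivity. }
  assert (HTper : forall t, T (t + L) = T t).
  { intros t. rewrite (surjective_pairing (T (t + L))), HTp1, HTp2. reflexivity. }
  destruct (periodic_lipschitz (fun t => fst (T t)) L HL HTp1 (Hgs1 1%nat) (Hgs1 2%nat)) as (K1 & HK1 & Hl1).
  destruct (periodic_lipschitz (fun t => snd (T t)) L HL HTp2 (Hgs2 1%nat) (Hgs2 2%nat)) as (K2 & HK2 & Hl2).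
  assert (HK : 0 < K1 + K2) by lra.
  assert (HTlip : forall s t, Rabs (fst (T s) - fst (T t)) <= (K1 + K2) * Rabs (s - t) /\
                              Rabs (snd (T s) - snd (T t)) <= (K1 + K2) * Rabs (s - t)).
  { intros s t. pose proof (Hl1 s t). pose proof (Hl2 s t). pose proof (Rabs_pos (s - t)).
    split; nra. }
  pose proof (gamma_lip gamma T HT1 HT2 Harc) as Hglip.
  assert (Cg : forall t, continuous gamma t) by (apply continuous_gamma, Hglip).
  assert (Cnu : forall t, continuous (nu T) t) by (apply (continuous_nu T _ HK HTlip)).
  assert (Coff : forall a t, continuous (off gamma T a) t)
    by (intros; eapply continuous_off; eauto).
  pose proof (curve_in_domain D gamma HDcl HDfr) as HgD.
  set (V := Vfield n H) in *.
  assert (CV : forall p, U p -> continuous V p) by (apply Vfield_continuous; auto).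
  destruct (rotation_number gamma T L (K1 + K2) HL Hper HTper Hsimple HT1 HT2 Harc HK HTlip)
    as (d & Hd & Hrot).
  assert (Htube : forall a, 0 < Rabs a <= d -> forall s t, gamma s <> off gamma T a t)
    by (intros a Ha; apply Hrot, Ha).
  destruct (inner_side D gamma HDfr T L HL Hper HT1 HT2 Harc d Hd HDint) as (a & ti & Ha & Hin).
  destruct (outer_side D gamma HDcl HDfr T L HL Hper HT1 HT2 Harc d Htube Coff a ti Ha Hin) as (te & Hout).
  set (qi := off gamma T a ti) in *. set (qo := off gamma T (- a) te) in *.
  assert (Hqi : forall t, gamma t <> qi) by (intros; apply Htube, Ha).
  assert (Hqo : forall t, gamma t <> qo) by (intros; apply Htube; rewrite Rabs_Ropp; exact Ha).
  assert (Hturn : forall q, (forall t, gamma t <> q) -> exists om, turns L (fun t => psub (gamma t) q) om).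
  { intros q Hq. apply turns_exists.
    - intros t. apply (continuous_psub gamma (fun _ => q)); [apply Cg | apply continuous_const].
    - intros t. apply psub_neq0, Hq.
    - intros t. rewrite Hper. reflexivity. }
  destruct (Hturn qi Hqi) as [omi Homi]. destruct (Hturn qo Hqo) as [omo Homo].
  assert (Hnu1 : forall t al, isarg (nu T t) al -> nu T t = (cos al, sin al)).
  { intros t al (r & Hr & E). rewrite E.
    pose proof (f_equal fst E) as E1. pose proof (f_equal snd E) as E2.
    unfold nu in E1, E2; cbn [fst snd] in E1, E2.
    pose proof (Harc t) as Hu. change (fst (T t) ^ 2 + snd (T t) ^ 2 = 1) in Hu.
    pose proof (sin2_cos2 al) as Q. unfold Rsqr in Q.
    assert (r ^ 2 * (sin al * sin al + cos al * cos al) = 1).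
    { rewrite <- Hu. transitivity ((r * sin al) ^ 2 + (- - (r * cos al)) ^ 2); [ring|].
      rewrite <- E1, <- E2. ring. }
    rewrite Q in H0. assert (r = 1) by nra. subst r. rewrite !Rmult_1_l. reflexivity. }
  destruct (turns_exists L (nu T) Cnu) as [om Hom].
  { intros t E. pose proof (Harc t) as Hu. change (fst (T t) ^ 2 + snd (T t) ^ 2 = 1) in Hu.
    unfold nu in E. injection E as E1 E2.
    change (snd (T t)) with (Derive (fun u => snd (gamma u)) t) in Hu.
    change (fst (T t)) with (Derive (fun u => fst (gamma u)) t) in Hu. nra. }
  { intros t. unfold nu. rewrite HTper. reflexivity. }
  assert (Eom : om = omi + omo) by (eapply Hrot; eauto).
  assert (HomV : turns L (fun t => V (gamma t)) (INR n * om)).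
  { destruct (turns_exists L (fun t => V (gamma t))) as [omV HomV].
    - intros t. apply (continuous_comp gamma V); [apply Cg | apply CV, HDU, HgD].
    - intros t. apply Hbdry.
    - intros t. rewrite Hper. reflexivity.
    - destruct Hom as (ps & Hps & Eps). destruct Hconst as [c0 Hc0].
      replace (INR n * om) with omV; [exact HomV|].
      apply (turns_parallel L (fun t => V (gamma t)) (fun t => (cos (INR n * ps t), sin (INR n * ps t))));
        [|exact HomV|].
      + intros t. apply (Vfield_boundary U H gamma T n c0); auto.
        * intros j u Hj. etransitivity; [|exact (Hnorm j u Hj)]. apply Derive_n_ext. intros s.
          unfold nu; cbn [fst snd T]. f_equal. f_equal. ring.
        * apply Hnu1, Hps.
      + exists (fun t => INR n * ps t). split.
        * intros t. split.
          -- apply (continuous_Rmult (T := R_UniformSpace) (fun _ => INR n) ps);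
               [apply continuous_const | apply Hps].
          -- exists 1. split; [lra | rewrite !Rmult_1_l; reflexivity].
        * intros t. rewrite Eps. ring. }
  assert (RV : regular_along gamma V).
  { intros t. split; [apply Hbdry|]. destruct (open_near U HUo (gamma t) (HDU _ (HgD t))) as (e & He & H').
    exists e. split; [exact He|]. intros q Hq. apply CV, H', Hq. }
  assert (RW : forall q, (forall t, gamma t <> q) -> regular_along gamma (fun p => psub p q)).
  { intros q Hq t. split; [apply psub_neq0, Hq|]. exists 1. split; [lra|]. intros; apply continuous_from. }
  destruct (darg_near_curve gamma L HL Hper Hglip Hsimple V _ RV HomV) as (rV & HrV & NV).
  destruct (darg_near_curve gamma L HL Hper Hglip Hsimple _ _ (RW qi Hqi) Homi) as (ri & Hri & Ni).
  destruct (darg_near_curve gamma L HL Hper Hglip Hsimple _ _ (RW qo Hqo) Homo) as (ro & Hro & No).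
  (* [shift] depends on [rho] and on the mesh, so one value of each has to serve the three
     fields. *)
  set (rho := Rmin rV (Rmin ri ro)).
  assert (Hrho : 0 < rho /\ rho <= rV /\ rho <= ri /\ rho <= ro).
  { unfold rho. pose proof (Rmin_l rV (Rmin ri ro)). pose proof (Rmin_r rV (Rmin ri ro)).
    pose proof (Rmin_l ri ro). pose proof (Rmin_r ri ro).
    split; [repeat apply Rmin_pos; auto | lra]. }
  destruct (NV rho ltac:(lra)) as (sV & HsV & NV'). destruct (Ni rho ltac:(lra)) as (si & Hsi & Ni').
  destruct (No rho ltac:(lra)) as (so & Hso & No'). clear NV Ni No.
  destruct HDbd as [M HM].
  assert (HDM : forall p, D p -> inbox M p).
  { intros p Hp. specialize (HM p Hp). destruct (nrm_bound p) as (B1 & B2 & _). unfold nrm in *.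
    split; apply Rabs_le_between; lra. }
  (* A cell with its corner in D may stick out of D. Below the scale [e0] it stays in U, contains no
     zero of V outside D, and contains at most one zero. *)
  destruct (box_uniform M (fun e p => D p -> (forall q, near e p q -> U q /\ (V q = (0, 0) -> D q)) /\
    (forall z, near e p z -> D z -> V p = (0, 0) -> V z = (0, 0) -> z = p))) as (e0 & He0 & Hunif).
  { intros e e' q He HP Hq. destruct (HP Hq) as [P1 P2]. split.
    - intros p Hp. apply P1. eapply near_le; [|exact Hp]; lra.
    - intros z Hz. apply P2. eapply near_le; [|exact Hz]; lra. }
  { intros p _. destruct (classic (D p)) as [Hp | Hp].
    - assert (A1 : exists e1, 0 < e1 /\ forall q, near e1 p q -> U q /\ (V q = (0, 0) -> D q)).
      { destruct (open_near U HUo p (HDU p Hp)) as (e1 & He1 & Hu1).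
        destruct (classic (exists t, p = gamma t)) as [[t ->] | Hpt].
        - destruct (continuous_dot_pos V (gamma t)) as (e2 & He2 & Hu2);
            [apply CV, HDU, HgD | apply Hbdry |].
          exists (Rmin e1 e2). split; [apply Rmin_pos; auto|]. intros q Hq. split.
          + apply Hu1. eapply near_le; [apply Rmin_l | exact Hq].
          + intros Eq. exfalso.
            pose proof (Hu2 q q ltac:(eapply near_le; [apply Rmin_r | exact Hq])
              ltac:(eapply near_le; [apply Rmin_r | exact Hq])) as X.
            rewrite Eq in X. unfold dot in X; simpl in X. lra.
        - assert (Hi : interior2 D p) by (apply (interior_iff D gamma HDfr); split; eauto).
          apply interior2_near in Hi. destruct Hi as (e2 & He2 & Hu2).
          exists e2. split; [exact He2|]. intros q Hq. split; auto. }
      assert (A2 : exists e2, 0 < e2 /\ forall z z', near e2 p z -> near e2 p z' -> D z -> D z' ->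
        V z = (0, 0) -> V z' = (0, 0) -> z = z').
      { destruct (classic (V p = (0, 0))) as [Hz | Hz].
        - destruct (Hiso p Hp Hz) as (e2 & He2 & Hu2). exists (e2 / 2). split; [lra|].
          intros z z' N1 N2 D1 D2 V1 V2. apply near_dist2 in N1, N2.
          rewrite (Hu2 z D1 V1), (Hu2 z' D2 V2) by lra. reflexivity.
        - destruct (continuous_dot_pos V p) as (e2 & He2 & Hu2); [apply CV, HDU, Hp | exact Hz |].
          exists e2. split; [exact He2|]. intros z z' N1 _ _ _ V1. exfalso.
          pose proof (Hu2 z z N1 N1) as X. rewrite V1 in X. unfold dot in X; simpl in X. lra. }
      destruct A1 as (e1 & He1 & A1). destruct A2 as (e2 & He2 & A2).
      exists (Rmin e1 e2 / 2). pose proof (Rmin_l e1 e2). pose proof (Rmin_r e1 e2).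
      split; [pose proof (Rmin_pos e1 e2 He1 He2); lra|]. intros q Hq Dq. split.
      + intros q' Hq'. apply A1. eapply near_le; [|exact (near_trans _ _ _ _ _ Hq Hq')]. lra.
      + intros z Hz Dz Vq Vz. apply A2; auto.
        * eapply near_le; [|exact (near_trans _ _ _ _ _ Hq Hz)]. lra.
        * eapply near_le; [|exact Hq]. pose proof (Rmin_pos e1 e2 He1 He2). lra.
    - destruct (off_curve_constant D gamma HDfr p) as (e & He & Hu).
      { intros t ->. apply Hp, HgD. }
      exists e. split; [exact He|]. intros q Hq Dq. exfalso. apply Hp, (Hu q Hq), Dq. }
  destruct (finite_separated (fun z => D z /\ V z = (0, 0)) M e0 He0) as (zs & Hnd & Hzs).
  { intros z [Dz _]; auto. }
  { intros z z' [D1 V1] [D2 V2] Hzz. symmetry. apply (proj2 (Hunif z (HDM z D1) D1)); auto. }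
  assert (Hzint : forall z, In z zs -> interior2 D z).
  { intros z Hz. apply Hzs in Hz. destruct Hz as [Dz Vz].
    apply (interior_iff D gamma HDfr). split; [exact Dz|]. intros t ->. exact (Hbdry t Vz). }
  assert (Hidx : forall z, In z zs -> exists k, index_is V z k /\ exists r, 0 < r /\ forall x x' y y',
      near r z (x, y) -> near r z (x', y') -> x < fst z < x' -> y < snd z < y' ->
      circ V x x' y y' = 2 * PI * IZR k).
  { intros z Hz. pose proof (Hzint z Hz) as Hi. apply Hzs in Hz. destruct Hz as [Dz Vz].
    apply interior2_near in Hi. destruct Hi as (e1 & He1 & Hu1).
    apply (index_exists V z (Rmin e0 e1)); [apply Rmin_pos; auto|].
    intros q Hq Hne. split.
    - apply CV, HDU, Hu1. eapply near_le; [apply Rmin_r | exact Hq].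
    - intros Vq. apply Hne. apply (proj2 (Hunif z (HDM z Dz) Dz)); auto.
      + eapply near_le; [apply Rmin_l | exact Hq].
      + apply Hu1. eapply near_le; [apply Rmin_r | exact Hq]. }
  (* One and the same integer has to serve as index on circles and as circulation around small
     rectangles. *)
  set (kz := fun z => epsilon (inhabits 0%Z) (fun k => index_is V z k /\ exists r, 0 < r /\
      forall x x' y y', near r z (x, y) -> near r z (x', y') -> x < fst z < x' -> y < snd z < y' ->
      circ V x x' y y' = 2 * PI * IZR k)).
  assert (Hkz : forall z, In z zs -> index_is V z (kz z) /\ exists r, 0 < r /\
      forall x x' y y', near r z (x, y) -> near r z (x', y') -> x < fst z < x' -> y < snd z < y' ->
      circ V x x' y y' = 2 * PI * IZR (kz z)).
  { intros z Hz. unfold kz. apply epsilon_spec, Hidx, Hz. }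
  clear Hidx.
  destruct (uniform_on_list zs (fun z s =>
    (forall q, near s z q -> D q) /\
    forall x x' y y', near s z (x, y) -> near s z (x', y') -> x < fst z < x' -> y < snd z < y' ->
      circ V x x' y y' = 2 * PI * IZR (kz z))) as (sz & Hsz & HQ).
  { intros z Hz. pose proof (Hzint z Hz) as Hi. apply interior2_near in Hi.
    destruct Hi as (e1 & He1 & Hu1). destruct (Hkz z Hz) as (_ & r & Hr & Hc).
    exists (Rmin e1 r). split; [apply Rmin_pos; auto|].
    pose proof (Rmin_l e1 r). pose proof (Rmin_r e1 r). intros s Hs. split.
    - intros q Hq. apply Hu1. eapply near_le; [|exact Hq]. lra.
    - intros x x' y y' N1 N2. apply Hc; [eapply near_le; [|exact N1] | eapply near_le; [|exact N2]]; lra. }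
  destruct (off_curve_constant D gamma HDfr qi) as (ei & Hei & Hui); [intros t E; apply (Hqi t); auto|].
  destruct (off_curve_constant D gamma HDfr qo) as (eo & Heo & Huo); [intros t E; apply (Hqo t); auto|].
  assert (Hs : exists s, 0 < s /\ s < sV /\ s < si /\ s < so /\ s < e0 /\ s < sz /\ s < ei /\ s < eo).
  { exists (Rmin (Rmin (Rmin sV si) (Rmin so e0)) (Rmin sz (Rmin ei eo)) / 2).
    assert (G : forall x y, 0 < x -> 0 < y -> 0 < Rmin x y /\ Rmin x y <= x /\ Rmin x y <= y).
    { intros x y Hx Hy. split; [apply Rmin_pos; auto | split; [apply Rmin_l | apply Rmin_r]]. }
    destruct (G sV si HsV Hsi) as (G1 & G2 & G3). destruct (G so e0 Hso He0) as (G4 & G5 & G6).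
    destruct (G _ _ G1 G4) as (G7 & G8 & G9). destruct (G ei eo Hei Heo) as (G10 & G11 & G12).
    destruct (G sz _ Hsz G10) as (G13 & G14 & G15). destruct (G _ _ G7 G13) as (G16 & G17 & G18).
    repeat split; lra. }
  destruct Hs as (s & Hs0 & HsV' & Hsi' & Hso' & Hse & Hsz' & Hsei & Hseo).
  set (pts := qi :: qo :: zs).
  (* The grid reaches beyond [B] in all directions, so it surrounds D and [qo] and its extreme
     corners have weight 0. *)
  set (B := M + Rabs (fst qo) + Rabs (snd qo) + 1).
  destruct (offset_exists (map fst pts ++ map snd pts) s (- B) Hs0) as (o & Ho & Havoid).
  assert (Hoffg : forall q, In q pts -> offgrid o s q).
  { intros q Hq i. split; apply Havoid, in_or_app; [left | right]; apply in_map; exact Hq. }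
  destruct (INR_unbounded ((B - o) / s)) as [N HN].
  assert (HgN : B < gr o s N).
  { unfold gr. apply Rlt_div_l in HN; [lra | exact Hs0]. }
  assert (Hg0 : gr o s 0 = o) by (unfold gr; simpl; ring).
  assert (HB : M < B /\ Rabs (fst qo) < B /\ Rabs (snd qo) < B).
  { pose proof (Rabs_pos (fst qo)). pose proof (Rabs_pos (snd qo)).
    destruct (HDM _ Hin) as [[] _]. unfold B. repeat split; lra. }
  set (c := fun i j => if excluded_middle_informative (D (gr o s i, gr o s j)) then 1 else 0).
  assert (Hc1 : forall i j, D (gr o s i, gr o s j) -> c i j = 1).
  { intros i j Hij. unfold c. destruct (excluded_middle_informative _); [reflexivity | contradiction]. }
  assert (Hc0 : forall i j, ~ D (gr o s i, gr o s j) -> c i j = 0).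
  { intros i j Hij. unfold c. destruct (excluded_middle_informative _); [contradiction | reflexivity]. }
  assert (Hcb : forall i, c i 0%nat = 0 /\ c i N = 0 /\ c 0%nat i = 0 /\ c N i = 0).
  { intros i. repeat split; apply Hc0; intros Hd'; destruct (HDM _ Hd') as [[] []];
      cbn [fst snd] in *; lra. }
  assert (Hjump : forall i j i' j', c i j <> c i' j' ->
    (D (gr o s i, gr o s j) -> ~ D (gr o s i', gr o s j')) /\
    (~ D (gr o s i, gr o s j) -> D (gr o s i', gr o s j'))).
  { intros i j i' j' Hne. split.
    - intros D1 D2. apply Hne. rewrite !Hc1; auto.
    - intros D1. apply NNPP. intros D2. apply Hne. rewrite !Hc0; auto. }
  assert (Hseg : forall p p', Rabs (fst p' - fst p) <= s -> Rabs (snd p' - snd p) <= s ->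
    (exists l t, gamma t = seg p p' l) -> exists t, near (2 * s) (gamma t) p').
  { intros p p' X1 X2 (l & t & E). exists t. rewrite E. pose proof (clamp_bound l).
    unfold seg; split; cbn [fst snd].
    - replace (fst p' - (fst p + clamp l * (fst p' - fst p))) with ((1 - clamp l) * (fst p' - fst p)) by ring.
      rewrite Rabs_mult, Rabs_pos_eq by lra. pose proof (Rabs_pos (fst p' - fst p)). nra.
    - replace (snd p' - (snd p + clamp l * (snd p' - snd p))) with ((1 - clamp l) * (snd p' - snd p)) by ring.
      rewrite Rabs_mult, Rabs_pos_eq by lra. pose proof (Rabs_pos (snd p' - snd p)). nra. }
  assert (Hstep : forall i, Rabs (gr o s (S i) - gr o s i) <= s /\ Rabs (gr o s i - gr o s i) <= s).
  { intros i. rewrite gr_S. replace (gr o s i + s - gr o s i) with s by ring.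
    rewrite Rminus_diag, Rabs_R0, Rabs_pos_eq; lra. }
  set (m0 := gflux o s N c (shift gamma rho s)).
  assert (Hflux : forall (F : pt -> pt) om',
    (exists G : pt -> R, forall p p', (exists t, near (2 * s) (gamma t) p) -> near (2 * s) p p' ->
      darg F p p' = om' / L * shift gamma rho s p p' + (G p' - G p)) ->
    gflux o s N c (darg F) = om' / L * m0).
  { intros F om' [G HG].
    apply (gflux_near o s N c Hs0 _ _ G _ (fun p => exists t, near (2 * s) (gamma t) p)); auto.
    - intros i j Hne. destruct (Hjump _ _ _ _ Hne) as [J1 J2].
      apply (Hseg (gr o s i, gr o s j)); try apply Hstep.
      apply (segment_crosses D gamma HDfr); auto.
    - intros i j Hne. destruct (Hjump _ _ _ _ Hne) as [J1 J2].
      apply (Hseg (gr o s i, gr o s j)); try apply Hstep.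
      apply (segment_crosses D gamma HDfr); auto. }
  pose proof (Hflux V _ (NV' s ltac:(lra))) as FV.
  pose proof (Hflux _ _ (Ni' s ltac:(lra))) as Fi.
  pose proof (Hflux _ _ (No' s ltac:(lra))) as Fo.
  assert (Hcorner : forall q i j, incell o s q i j -> near s q (gr o s i, gr o s j)).
  { intros q i j [C1 C2]. rewrite gr_S in C1, C2. split; cbn [fst snd]; apply Rabs_lt_between; lra. }
  assert (Hcorner' : forall q i j, incell o s q i j -> near s q (gr o s (S i), gr o s (S j))).
  { intros q i j [C1 C2]. rewrite !gr_S in *. split; cbn [fst snd]; apply Rabs_lt_between; lra. }
  assert (Hcell : forall q, In q pts -> (D q \/ q = qo) ->
    exists i j, (i < N)%nat /\ (j < N)%nat /\ incell o s q i j).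
  { intros q Hq Hor. apply cell_exists; [apply Hoffg, Hq | |].
    - destruct Hor as [Dq | ->].
      + destruct (HDM _ Dq) as [[] []]. lra.
      + destruct HB as (HB0 & HB1 & HB2). apply Rabs_lt_between in HB1. lra.
    - destruct Hor as [Dq | ->].
      + destruct (HDM _ Dq) as [[] []]. lra.
      + destruct HB as (HB0 & HB1 & HB2). apply Rabs_lt_between in HB2. lra. }
  assert (Fi1 : omi / L * m0 = 2 * PI).
  { assert (Hp : In qi pts) by (left; reflexivity).
    destruct (Hcell qi Hp (or_introl Hin)) as (i & j & Hi & Hj & Hij).
    rewrite <- Fi, (gflux_point o s N c Hs0 qi i j (Hoffg _ Hp) Hi Hj Hij).
    rewrite Hc1; [ring|]. apply (Hui (gr o s i, gr o s j)); [|exact Hin].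
    eapply near_le; [|apply Hcorner, Hij]. lra. }
  assert (Fo1 : omo / L * m0 = 0).
  { assert (Hp : In qo pts) by (right; left; reflexivity).
    destruct (Hcell qo Hp (or_intror eq_refl)) as (i & j & Hi & Hj & Hij).
    rewrite <- Fo, (gflux_point o s N c Hs0 qo i j (Hoffg _ Hp) Hi Hj Hij).
    rewrite Hc0; [ring|]. intros Dg. apply Hout. apply (Huo (gr o s i, gr o s j)); [|exact Dg].
    eapply near_le; [|apply Hcorner, Hij]. lra. }
  assert (Hpz : forall z, In z zs -> In z pts) by (intros; right; right; assumption).
  (* Cell by cell, V circulates like the fields p - z taken with the indices as coefficients: a cell
     of weight 1 contains no zero or exactly one, strictly inside. *)
  assert (Ecirc : forall i j, c i j * circ V (gr o s i) (gr o s (S i)) (gr o s j) (gr o s (S j)) =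
    lsum (fun z => IZR (kz z) *
      (c i j * circ (fun p => psub p z) (gr o s i) (gr o s (S i)) (gr o s j) (gr o s (S j)))) zs).
  { intros i j. destruct (classic (D (gr o s i, gr o s j))) as [Dg | Dg].
    2: { rewrite Hc0 by exact Dg. rewrite lsum_zero; [ring | intros; ring]. }
    destruct (classic (exists z, In z zs /\ incell o s z i j)) as [(z & Hz & Hij) | Hno].
    - rewrite (lsum_single _ zs z Hnd Hz).
      + rewrite (proj2 (HQ z Hz s ltac:(lra))); [|apply Hcorner, Hij | apply Hcorner', Hij | apply Hij | apply Hij].
        rewrite circ_inside; [ring | apply Hij | apply Hij].
      + intros y Hy Hne. rewrite circ_outside; [ring | exact Hs0 | apply Hoffg, Hpz, Hy |].
        intros Hyij. apply Hne.
        pose proof (proj1 (Hzs z) Hz) as [Dz Vz]. pose proof (proj1 (Hzs y) Hy) as [Dy Vy].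
        apply (proj2 (Hunif z (HDM z Dz) Dz)); auto.
        destruct Hij as [C1 C2]. destruct Hyij as [C3 C4]. rewrite gr_S in C1, C2, C3, C4.
        split; apply Rabs_lt_between; lra.
    - rewrite lsum_zero.
      + rewrite circ_zero; [ring | rewrite gr_S; lra | rewrite gr_S; lra |].
        intros p Hx Hy. rewrite gr_S in Hx, Hy.
        assert (Np : near e0 (gr o s i, gr o s j) p).
        { split; cbn [fst snd]; apply Rabs_lt_between; lra. }
        destruct (proj1 (Hunif _ (HDM _ Dg) Dg) p Np) as [Up Zp].
        split; [apply CV, Up|]. intros Vp.
        assert (Hpz' : In p zs) by (apply Hzs; split; auto).
        apply Hno. exists p. split; [exact Hpz'|].
        pose proof (Hoffg p (Hpz p Hpz')) as Hog.
        destruct (Hog i) as [A1 _]. destruct (Hog (S i)) as [A2 _].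
        destruct (Hog j) as [_ A3]. destruct (Hog (S j)) as [_ A4].
        rewrite gr_S in A2, A4. split; rewrite gr_S; lra.
      + intros z Hz. rewrite circ_outside; [ring | exact Hs0 | apply Hoffg, Hpz, Hz |].
        intros Hij. apply Hno; eauto. }
  assert (FV1 : gflux o s N c (darg V) = lsum (fun z => IZR (kz z) * (2 * PI)) zs).
  { assert (FZ : forall z, In z zs -> gflux o s N c (darg (fun p => psub p z)) = 2 * PI).
    { intros z Hz. pose proof (proj1 (Hzs z) Hz) as [Dz Vz].
      destruct (Hcell z (Hpz z Hz) (or_introl Dz)) as (i & j & Hi & Hj & Hij).
      rewrite (gflux_point o s N c Hs0 z i j (Hoffg _ (Hpz z Hz)) Hi Hj Hij).
      rewrite Hc1; [ring|]. apply (proj1 (HQ z Hz s ltac:(lra))). apply Hcorner, Hij. }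
    rewrite gflux_circ.
    transitivity (lsum (fun z => IZR (kz z) * gflux o s N c (darg (fun p => psub p z))) zs).
    - rewrite (rsum_ext N _ _ (fun i _ => rsum_ext N _ _ (fun j _ => Ecirc i j))).
      clear - zs. induction zs as [|z l IH]; cbn [lsum fold_right].
      + apply rsum_zero; intros; apply rsum_zero; intros; reflexivity.
      + fold (lsum (fun z => IZR (kz z) * gflux o s N c (darg (fun p => psub p z))) l).
        rewrite <- IH, gflux_circ, <- rsum_scal, <- rsum_plus.
        apply rsum_ext; intros i _. rewrite <- rsum_scal, <- rsum_plus. reflexivity.
    - clear - FZ. induction zs as [|z l IH]; [reflexivity|]. cbn [lsum fold_right].
      rewrite (FZ z) by (left; reflexivity). f_equal. apply IH. intros; apply FZ; right; auto. }
  exists zs, (map kz zs). split; [exact Hnd|]. split; [|split].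
  - intros p. split.
    + intros Hp. split; [apply Hzint, Hp | apply (proj1 (Hzs p) Hp)].
    + intros [Hp Vp]. apply Hzs. split; [apply (interior_iff D gamma HDfr), Hp | exact Vp].
  - clear - Hkz. induction zs as [|z l IH]; simpl; constructor.
    + apply Hkz; left; reflexivity.
    + apply IH. intros; apply Hkz; right; auto.
  - assert (Esum : lsum (fun z => IZR (kz z) * (2 * PI)) zs = IZR (sumZ (map kz zs)) * (2 * PI)).
    { clear. induction zs as [|z l IH]; [simpl; ring|].
      change (IZR (kz z) * (2 * PI) + lsum (fun z => IZR (kz z) * (2 * PI)) l =
        IZR (kz z + sumZ (map kz l)) * (2 * PI)).
      rewrite IH, plus_IZR. ring. }
    rewrite FV, Esum in FV1.
    apply eq_IZR. rewrite <- INR_IZR_INZ.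
    apply (Rmult_eq_reg_r (2 * PI)); [|pose proof PI_RGT_0; lra].
    (* Writing 2 PI as 2 PI + 0 turns the right side into n times [(omi + omo) / L * m0], so [m0]
       need not be evaluated. *)
    rewrite <- FV1, Eom. rewrite <- (Rplus_0_r (2 * PI)), <- Fi1, <- Fo1. field. lra.
Qed.
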